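(* Assume that conditions (A1) and (A2) stated in the context hold, with $r$ and $\mathsf{D}$ the integer and the set given by (A1). Then for every initial distribution $\chi\in\mathcal{M}(\mathsf{D},r)$ and every bounded measurable function $h:\mathsf{X}\to\mathbb{R}$, the sequence of random variables $\big(\sigma_\chi^2\langle Y_0^{n-1}\rangle(h)\big)_{n\in\mathbb{N}^*}$ is tight, i.e. for every $\epsilon>0$ there is $a>0$ such that $\mathbb{P}\big(|\sigma_\chi^2\langle Y_0^{n-1}\rangle(h)|>a\big)\le\epsilon$ for all $n\in\mathbb{N}^*$.
   Context: Notation: $\mathbb{N}=\{0,1,2,\dots\}$, $\mathbb{N}^*=\{1,2,\dots\}$; $\ln^+x=\max(\ln x,0)$, $\ln^-x=\max(-\ln x,0)$; $u_k^m=(u_k,\dots,u_m)$; $\|f\|_\infty=\sup_{x\in\mathsf{X}}|f(x)|$; for a measure $\mu$, a kernel $\mathbf{K}$ and a function $f$: $\mu f=\int f\,d\mu$, $\mathbf{K}f(x)=\int f(x')\mathbf{K}(x,dx')$, $\mu\mathbf{K}f=\int\mu(dx)\mathbf{K}f(x)$. Model: $(\mathsf{X},\mathcal{X})$ (with $\mathcal{X}$ countably generated) and $(\mathsf{Y},\mathcal{Y})$ are measurable spaces, $\mathbf{Q}$ is a Markov kernel on $(\mathsf{X},\mathcal{X})$, $\nu$ is a $\sigma$-finite measure on $(\mathsf{Y},\mathcal{Y})$, and $g:\mathsf{X}\times\mathsf{Y}\to(0,\infty)$ is measurable with $\int g(x,y)\,\nu(dy)=1$ for all $x$. Write $g\langle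 y\rangle(x)=g(x,y)$. For $k\le m$ let $$\mathbf{L}\langle y_k^m\rangle(x_k,\mathsf{A})=\int\cdots\int \mathbf{1}_{\mathsf{A}}(x_{m+1})\prod_{\ell=k}^m g(x_\ell,y_\ell)\,\mathbf{Q}(x_\ell,dx_{\ell+1}),$$ and $\mathbf{L}\langle y_k^m\rangle(x,\mathsf{A})=\delta_x(\mathsf{A})$ for $k>m$. For a probability measure $\chi$ on $(\mathsf{X},\mathcal{X})$ (initial distribution) let $\phi_\chi\langle y_k^m\rangle(\mathsf{A})=\chi\mathbf{L}\langle y_k^m\rangle\mathbf{1}_{\mathsf{A}}/\chi\mathbf{L}\langle y_k^m\rangle\mathbf{1}_{\mathsf{X}}$ (predictor), so $\phi_\chi\langle y_k^m\rangle=\chi$ when $k>m$. Asymptotic variance of the bootstrap particle predictor: for $y_0^{n-1}\in\mathsf{Y}^n$ and bounded measurable $h$, $$\sigma_\chi^2\langle y_0^{n-1}\rangle(h)=\sum_{k=0}^n\int\phi_\chi\langle y_0^{k-1}\rangle(dx)\left(\frac{\mathbf{L}\langle y_k^{n-1}\rangle h(x)-\phi_\chi\langle y_0^{n-1}\rangle h\times\mathbf{L}\langle y_k^{n-1}\rangle\mathbf{1}_{\mathsf{X}}(x)}{\phi_\chi\langle y_0^{k-1}\rangle\mathbf{L}\langle y_k^{n-1}\rangle\mathbf{1}_{\mathsf{X}}}\right)^2.$$ Observations: $(Y_n)_{n\in\mathbb{Z}}$ is a $\mathsf{Y}$-valued stationary process on a probability space with probability $\mathbb{P}$ and expectation $\mathbb{E}$;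 it is not assumed to be generated by the hidden Markov model with transition kernel $\mathbf{Q}$ and observation density $g$. Local Doeblin sets: let $r\in\mathbb{N}^*$. A set $\mathsf{C}\in\mathcal{X}$ is $r$-local Doeblin with respect to $\{\mathbf{Q},g\}$ if there exist positive functions $\epsilon_{\mathsf{C}}^-,\epsilon_{\mathsf{C}}^+$ on $\mathsf{Y}^r$, probability measures $\{\mu_{\mathsf{C}}\langle z\rangle;z\in\mathsf{Y}^r\}$ and positive functions $\{\varphi_{\mathsf{C}}\langle z\rangle;z\in\mathsf{Y}^r\}$ such that for all $z\in\mathsf{Y}^r$, $\mu_{\mathsf{C}}\langle z\rangle(\mathsf{C})=1$ and for all $\mathsf{A}\in\mathcal{X}$, $x\in\mathsf{C}$, $$\epsilon_{\mathsf{C}}^-\langle z\rangle\varphi_{\mathsf{C}}\langle z\rangle(x)\mu_{\mathsf{C}}\langle z\rangle(\mathsf{A})\le\mathbf{L}\langle z\rangle(x,\mathsf{A}\cap\mathsf{C})\le\epsilon_{\mathsf{C}}^+\langle z\rangle\varphi_{\mathsf{C}}\langle z\rangle(x)\mu_{\mathsf{C}}\langle z\rangle(\mathsf{A}).$$ (A1) The process $(Y_n)_{n\in\mathbb{Z}}$ is strictly stationary and ergodic, and there exist $r\in\mathbb{N}^*$ and $\mathsf{K}\in\mathcal{Y}^{\otimes r}$ such that: (i) the process $(Z_n)_{n\in\mathbb{Z}}$, $Z_n=Y_{nr}^{(n+1)r-1}$, is ergodic and $\mathbb{P}(Z_0\in\mathsf{K})>2/3$; (ii) for all $\eta>0$ there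 exists an $r$-local Doeblin set $\mathsf{C}\in\mathcal{X}$ such that for all $y_0^{r-1}\in\mathsf{K}$, $\sup_{x\in\mathsf{C}^c}\mathbf{L}\langle y_0^{r-1}\rangle(x,\mathsf{X})\le\eta\,\|\mathbf{L}\langle y_0^{r-1}\rangle(\cdot,\mathsf{X})\|_\infty<\infty$, and $\inf_{y_0^{r-1}\in\mathsf{K}}\epsilon_{\mathsf{C}}^-\langle y_0^{r-1}\rangle/\epsilon_{\mathsf{C}}^+\langle y_0^{r-1}\rangle>0$, with $\epsilon_{\mathsf{C}}^\pm$ the functions in the definition of local Doeblin set; (iii) there exists $\mathsf{D}\in\mathcal{X}$ such that $\mathbb{E}\big[\ln^-\inf_{x\in\mathsf{D}}\delta_x\mathbf{L}\langle Y_0^{r-1}\rangle\mathbf{1}_{\mathsf{D}}\big]<\infty$. (A2) (i) $g(x,y)>0$ for all $(x,y)\in\mathsf{X}\times\mathsf{Y}$; (ii) $\mathbb{E}[\ln^+\|g\langle Y_0\rangle\|_\infty]<\infty$. For $r$ and $\mathsf{D}$ as in (A1), $\mathcal{M}(\mathsf{D},r)$ is the set of probability measures $\chi$ on $(\mathsf{X},\mathcal{X})$ such that $\mathbb{E}\big[\ln^-\chi\mathbf{L}\langle Y_0^{\ell-1}\rangle\mathbf{1}_{\mathsf{D}}\big]<\infty$ for all $\ell\in\{0,\dots,r\}$. *)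

(* Defs.v *)
From HB Require Import structures.
From mathcomp Require Import all_boot all_order all_algebra.
From mathcomp Require Import all_classical all_reals all_analysis.
From mathcomp Require Import measurable_realfun.

Set Implicit Arguments.
Unset Strict Implicit.
Unset Printing Implicit Defensive.

Import Order.TTheory GRing.Theory Num.Theory.
Import numFieldNormedType.Exports.

Local Open Scope classical_set_scope.
Local Open Scope ring_scope.
Local Open Scope ereal_scope.

Section Utils.
Context {R : realType}.

(* [lne 0 = -oo], hence [lnm 0 = +oo]. *)
Definition lnp (x : \bar R) : \bar R := maxe (lne x) 0.
Definition lnm (x : \bar R) : \bar R := maxe (- lne x) 0.

Definition supnorm {T : Type} (f : T -> \bar R) : \bar R :=
  ereal_sup (range (fun x => `|f x|)).

End Utils.

Definition countably_generated d (T : measurableType d) : Prop :=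
  exists2 G : set (set T), countable G & (@measurable d T) = <<s G>>.

Section Process.
Context {d d'} {Omega : measurableType d} {T : measurableType d'}.
Context {R : realType} (P : probability Omega R).

Definition strictly_stationary (Y : int -> Omega -> T) : Prop :=
  forall (n : nat) (t : n.-tuple int) (j : int) (A : set (n.-tuple T)),
    measurable A ->
    P [set w | A [tuple Y (tnth t i + j)%R w | i < n]] =
    P [set w | A [tuple Y (tnth t i) w | i < n]].

Definition path_measurable : set (set (int -> T)) :=
  <<s \bigcup_(k in [set: int])
        preimage_set_system [set: int -> T] (fun u => u k) measurable >>.

(* The shift of the path space is ergodic under the law of the process. *)
Definition ergodic_process (Y : int -> Omega -> T) : Prop :=
  forall A : set (int -> T), path_measurable A ->
    (fun (u : int -> T) (k : int) => u (k + 1)%R) @^-1` A = A ->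
    P [set w | A (fun k => Y k w)] = 0 \/ P [set w | A (fun k => Y k w)] = 1.

(* The block (Y_k, ..., Y_{k+n-1}). *)
Definition block (Y : int -> Omega -> T) (k : int) (n : nat) (w : Omega) :
    n.-tuple T :=
  [tuple Y (k + i%:Z)%R w | i < n].

End Process.

Record model {dX dY} (X : measurableType dX) (Y : measurableType dY)
    (R : realType) := Model {
  Q : R.-pker X ~> X;
  nu : {sigma_finite_measure set Y -> \bar R};
  g : X * Y -> R;
  measurable_g : measurable_fun [set: X * Y] g;
  g_gt0 : forall z, (0 < g z)%R;
  integral_g : forall x, \int[nu]_y (g (x, y))%:E = 1
}.

Section Kernels.
Context {dX dY} {X : measurableType dX} {Y : measurableType dY} {R : realType}.
Variable M : model X Y R.

(* [L_fun s x A] is L<s>(x, A) for a finite sequence s of observations; for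
   s = [::] it is the Dirac mass at x. *)
Fixpoint L_fun (s : seq Y) (x : X) (A : set X) : \bar R :=
  if s is y :: s' then \int[Q M x]_x' ((g M (x, y))%:E * L_fun s' x' A)
  else \d_x A.

Lemma g_ge0 z : (0 <= g M z)%R. Proof. exact/ltW/g_gt0. Qed.
#[local] Hint Resolve g_ge0 : core.

Lemma L_set0 s x : L_fun s x set0 = 0.
Proof.
elim: s x => [|y s IH] x /=; first by rewrite measure0.
by rewrite integral0_eq// => z _; rewrite IH mule0.
Qed.

Lemma L_ge0 s x A : 0 <= L_fun s x A.
Proof.
elim: s x => [|y s IH] x //=.
by apply: integral_ge0 => z _; rewrite mule_ge0// lee_fin.
Qed.
#[local] Hint Resolve L_ge0 : core.

Lemma measurable_L s A : measurable A -> measurable_fun [set: X] (L_fun s ^~ A).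
Proof.
move=> mA; elim: s => [|y s IH] /=.
  apply/measurable_EFinP; exact: measurable_indic.
rewrite (_ : (fun _ => _) =
  fun x => (g M (x, y))%:E * \int[Q M x]_x' L_fun s x' A); last first.
  by apply/funext => x; rewrite ge0_integralZl//= lee_fin.
apply: emeasurable_funM.
  apply/measurable_EFinP.
  by apply: (measurableT_comp (@measurable_g _ _ _ _ _ M)).
apply: (measurable_fun_integral_kernel (l := Q M)) => //.
exact: measurable_kernel.
Qed.
#[local] Hint Resolve measurable_L : core.

Lemma L_sigma_additive s x : semi_sigma_additive (L_fun s x).
Proof.
elim: s x => [|y s IH] x; first exact: measure_semi_sigma_additive.
move=> F mF tF mUF; rewrite [X in _ --> X](_ : _ =
  \int[Q M x]_x' (\sum_(n <oo) (g M (x, y))%:E * L_fun s x' (F n))); last first.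
  apply: eq_integral => x' _; rewrite nneseriesZl//.
  by congr (_ * _); apply/esym/cvg_lim => //; exact: IH.
have m n : measurable_fun setT (fun x' => (g M (x, y))%:E * L_fun s x' (F n)).
  by apply: emeasurable_funM => //; exact: measurable_L.
have p n x' : 0 <= (g M (x, y))%:E * L_fun s x' (F n).
  by rewrite mule_ge0// lee_fin.
apply/cvg_closeP; split.
  by apply: is_cvg_nneseries => n _ _; exact: integral_ge0.
by rewrite closeE// integral_nneseries.
Qed.

HB.instance Definition _ s x := isMeasure.Build _ _ R
  (L_fun s x) (L_set0 s x) (L_ge0 s x) (@L_sigma_additive s x).

Definition L (s : seq Y) : X -> {measure set X -> \bar R} := L_fun s.

HB.instance Definition _ s := isKernel.Build _ _ X X R (L s) (@measurable_L s).

Section comp.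
Variables (mu : {measure set X -> \bar R}) (s : seq Y).

(* The measure mu L<s>. *)
Definition muL (A : set X) : \bar R := \int[mu]_x L s x A.

Lemma muL_set0 : muL set0 = 0.
Proof. by rewrite /muL integral0_eq// => x _; rewrite measure0. Qed.

Lemma muL_ge0 A : 0 <= muL A. Proof. exact: integral_ge0. Qed.

Lemma muL_sigma_additive : semi_sigma_additive muL.
Proof.
move=> F mF tF mUF; rewrite [X in _ --> X](_ : _ =
  \int[mu]_x (\sum_(n <oo) L s x (F n))); last first.
  apply: eq_integral => x _.
  by apply/esym/cvg_lim => //; exact: measure_semi_sigma_additive.
apply/cvg_closeP; split.
  by apply: is_cvg_nneseries => n _ _; exact: integral_ge0.
rewrite closeE// integral_nneseries// => n.
exact: measurable_kernel.
Qed.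

HB.instance Definition _ := isMeasure.Build _ _ R
  muL muL_set0 muL_ge0 muL_sigma_additive.

End comp.

(* The predictor phi_chi<s>.  The total mass of chi L<s> is positive since
   g > 0; it can be infinite only for observations with sup_x g(x, y) = +oo
   for some y in s, and [mnormalize] then returns chi. *)
Definition predictor (chi : probability X R) (s : seq Y) : probability X R :=
  mnormalize (muL chi s) chi.

(* The asymptotic variance; s is y_0^{n-1}, so that [take k s] is y_0^{k-1} and
   [drop k s] is y_k^{n-1}. *)
Definition asymptotic_variance (chi : probability X R) (s : seq Y)
    (h : X -> R) : \bar R :=
  \sum_(0 <= k < (size s).+1)
    \int[predictor chi (take k s)]_x
      ((\int[L (drop k s) x]_z (h z)%:E
        - (\int[predictor chi s]_z (h z)%:E) * L (drop k s) x setT)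
       / muL (predictor chi (take k s)) (drop k s) setT) ^+ 2.

(* C is an r-local Doeblin set, with em and ep as its functions eps_C^-, eps_C^+
   (kept visible because A1 refers to them). *)
Definition local_doeblin_with (r : nat) (C : set X)
    (em ep : r.-tuple Y -> R) : Prop :=
  [/\ measurable C,
      forall z, (0 < em z)%R,
      forall z, (0 < ep z)%R &
      exists (mu : r.-tuple Y -> probability X R)
             (phi : r.-tuple Y -> X -> R),
        (forall z x, (0 < phi z x)%R) /\
        forall z, mu z C = 1 /\
          forall A x, measurable A -> C x ->
            (em z * phi z x)%:E * mu z A <= L z x (A `&` C) /\
            L z x (A `&` C) <= (ep z * phi z x)%:E * mu z A].

Section Assumptions.
Context {dO} {Omega : measurableType dO} (P : probability Omega R).
Variable Yp : int -> {RV P >-> Y}.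

(* Finiteness of the expectation of a nonnegative variable is stated as
   [P.-integrable], which includes its measurability: an infimum or supremum
   over an uncountable set need not be measurable. *)
Definition A1 (r : nat) (D : set X) : Prop :=
  [/\ strictly_stationary P Yp, ergodic_process P Yp, (0 < r)%N &
  exists K : set (r.-tuple Y),
  [/\ measurable K,
      ergodic_process P (fun n : int => block Yp (n * r%:Z)%R r) /\
        (2 / 3)%:E < P [set w | K (block Yp 0 r w)],
      forall eta : R, (0 < eta)%R ->
        exists (C : set X) (em ep : r.-tuple Y -> R),
          [/\ local_doeblin_with C em ep,
              forall z, K z ->
                ereal_sup [set L z x setT | x in ~` C]
                  <= eta%:E * supnorm (fun x => L z x setT) < +oo &
              0 < ereal_inf [set (em z / ep z)%:E | z in K]] &
      measurable D /\
        P.-integrable setT (fun w =>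
          lnm (ereal_inf [set L (block Yp 0 r w) x D | x in D]))]].

Definition A2 : Prop :=
  (forall x y, (0 < g M (x, y))%R) /\
  P.-integrable setT (fun w => lnp (supnorm (fun x => (g M (x, Yp 0 w))%:E))).

Definition initial_class (D : set X) (r : nat) : set (probability X R) :=
  [set chi | forall l, (l <= r)%N ->
     P.-integrable setT (fun w => lnm (muL chi (block Yp 0 l w) D))].

End Assumptions.

End Kernels.

(* Main.v *)
From HB Require Import structures.
Require Import Defs.
From mathcomp Require Import all_boot all_order all_algebra.
From mathcomp Require Import all_classical all_reals all_analysis.
From mathcomp Require Import measurable_realfun.
From mathcomp Require Import ring lra zify.
Import Order.TTheory GRing.Theory Num.Theory.
Import numFieldNormedType.Exports.
Local Open Scope classical_set_scope.
Local Open Scope ring_scope.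
Set Implicit Arguments.
Unset Strict Implicit.
Unset Printing Implicit Defensive.

(** The proof works with one trajectory of observations at a time and shows
    that, outside an event of small probability, the asymptotic variance is
    bounded by a constant that does not depend on the time [n].

    Write [U = L<y_k^(n-1)> h], [V = L<y_k^(n-1)> 1], and let [p_k] be the total
    mass of [chi L<y_0^(k-1)>]. After the normalizing constants are cleared, the
    [k]-th term of the variance is [p_k / p_n ^ 4] times the integral, against
    [chi L<y_0^(k-1)>], of the square of
    [x |-> U x * p_n - (chi L<y_0^(n-1)> h) * V x]
    ([variance_term]), and this function is itself the integral over [x'] of the
    antisymmetric function [U x * V x' - V x * U x'].

    Pairs [(x, x')] are propagated by the product of the kernels of blocks of [r]
    observations. On a good block, two coordinates in the Doeblin set [C] are
    approximately exchangeable, so that an antisymmetric function loses a fixed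
    factor [1 - e ^ 2]; a coordinate outside [C] loses the factor
    [expR (- 2 th0)] of its mass. The frequency of the good blocks exceeds 5/8,
    so that pairs that avoid [C * C] cannot avoid it often enough, and the
    contraction wins ([pair_growth], [swap_bound], [contraction_bound]). This
    gives first that the mass of [D] under the predictor and the ratio
    [V x * p_k / p_n] are controlled up to a factor that grows arbitrarily slowly
    with the number [j] of blocks between [k] and [n] ([mass_D], [ratio_bound]),
    and then that the [k]-th term decays geometrically in [j]
    ([variance_bound]). The sum over [k] is then bounded
    ([asymptotic_variance_bound]).

    What has to be controlled along the trajectory are averages, over the blocks
    that end at time [n] and are read backwards, of a cost of the block and of
    the indicator of the good blocks. Stationarity moves the time [n] to [0],
    and the maximal ergodic inequality bounds the deviation of the averages,
    uniformly in their length, by a slowly growing linear term plus a constant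
    ([ergodic_upper], [block_ergodic]).

    The assumptions bound suprema over the state space, which need not be
    measurable in the observation and are only controlled at time [0], so that
    neither stationarity nor the ergodic theorem applies to them. They are
    replaced by essential suprema with respect to all the laws [chi Q^k]
    ([level], [nonnull]), which are measurable and smaller. The countably many
    null sets that are discarded in this way are avoided by an absorbing set of
    full measure, where the chain may be assumed to live ([absorbing_core],
    [observed_core]). *)

(** * Integration against mixtures *)

Section mixtures.
Local Open Scope ereal_scope.
Context {d d'} {T : measurableType d} {S : measurableType d'} {R : realType}.
Variables (mu : {measure set T -> \bar R}) (k : T -> {measure set S -> \bar R}).
Hypothesis mk : forall A, measurable A -> measurable_fun [set: T] (k ^~ A).
Variable m : {measure set S -> \bar R}.
Hypothesis mE : forall A, measurable A -> m A = \int[mu]_t k t A.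

Import HBNNSimple.

Lemma integral_mixture_nnsfun (f : {nnsfun S >-> R}) :
  \int[m]_x (f x)%:E = \int[mu]_t \int[k t]_x (f x)%:E.
Proof.
rewrite integralT_nnsfun sintegralE.
under [RHS]eq_integral do rewrite integralT_nnsfun sintegralE.
rewrite ge0_integral_fsum//.
- apply: eq_fsbigr => r; rewrite inE => -[x _ <-].
  rewrite ge0_integralZl//; last by rewrite lee_fin.
    by rewrite mE.
  exact: mk.
- by move=> r; apply: measurable_funeM; exact: mk.
- move=> r t _; have [r0|r0] := leP 0%R r; first by rewrite mule_ge0.
  by rewrite preimage_nnfun0// measure0 mule0.
Qed.

Lemma integral_mixture (f : S -> \bar R) : (forall x, 0 <= f x) ->
  measurable_fun [set: S] f -> \int[m]_x f x = \int[mu]_t \int[k t]_x f x.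
Proof.
move=> f0 mf; pose f_ := nnsfun_approx measurableT mf.
have f_0 n x : 0 <= (f_ n x)%:E by rewrite lee_fin.
have f_nd x : nondecreasing_seq (fun n => (f_ n x)%:E).
  by move=> a b ab; rewrite lee_fin; exact/lefP/nd_nnsfun_approx.
have mf_ n : measurable_fun setT (fun x => (f_ n x)%:E) by exact/measurable_EFinP.
have f_cvg x : f x = limn (fun n => (f_ n x)%:E).
  by apply/esym/cvg_lim => //; exact: cvg_nnsfun_approx.
have lim_ (n : {measure set S -> \bar R}) :
    \int[n]_x f x = limn (fun i => \int[n]_x (f_ i x)%:E).
  by rewrite -monotone_convergence//; apply: eq_integral => x _.
rewrite lim_; under [RHS]eq_integral do rewrite lim_.
rewrite monotone_convergence//.
- by congr (limn _); apply/funext => n; exact: integral_mixture_nnsfun.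
- move=> n; apply: measurable_fun_integral_kernel => //; exact: mf_.
- by move=> n t _; exact: integral_ge0.
- move=> t _ a b ab; apply: ge0_le_integral => //.
  by move=> x _; exact: f_nd.
Qed.

End mixtures.

Lemma integral_mrestr_indic {d} {T : measurableType d} {R : realType}
  (mu : {measure set T -> \bar R}) (C : set T) (mC : measurable C)
  (f : T -> \bar R) : (forall x, 0 <= f x)%E -> measurable_fun [set: T] f ->
  (\int[mrestr mu mC]_x f x = \int[mu]_x ((\1_C x)%:E * f x))%E.
Proof.
move=> f0 mf; pose k x : {measure set T -> \bar R} :=
  if x \in C then (\d_x : {measure set T -> \bar R}) else mzero.
have mk A : measurable A -> measurable_fun [set: T] (k ^~ A).
  move=> mA; have -> : k ^~ A = (fun x => (\1_(C `&` A) x)%:E).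
    apply/funext => x; rewrite /k indicE in_setI.
    by case: (x \in C) => /=; rewrite ?diracE.
  by apply/measurable_EFinP; apply: measurable_indic; exact: measurableI.
rewrite (integral_mixture (mu := mu) (k := k) (m := mrestr mu mC) mk)//.
  apply: eq_integral => x _; rewrite /k indicE; case: (x \in C) => /=.
    by rewrite integral_dirac// diracT !mul1e.
  by rewrite mul0e integral_measure_zero.
move=> A mA; rewrite -[LHS]/(mu (A `&` C)) setIC.
rewrite -[X in mu X]setIT -integral_indic//; last exact: measurableI.
apply: eq_integral => x _; rewrite /k indicE in_setI.
by case: (x \in C) => /=; rewrite ?diracE.
Qed.

(** * Bounded measurable functions *)

(** All the functions integrated along a fixed trajectory are bounded and
    all the measures are finite, so that real-valued integrals are linear and
    monotone without integrability side conditions. *)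
Definition bm {d} {T : measurableType d} {R : realType} (f : T -> R) :=
  measurable_fun [set: T] f /\ exists M, forall x, `|f x| <= M.

Section bounded_measurable.
Context {d} {T : measurableType d} {R : realType}.
Implicit Types f g : T -> R.

Lemma bm_cst (r : R) : bm (fun _ : T => r).
Proof. by split; [exact: measurable_cst|exists `|r|]. Qed.

Lemma bm_add f g : bm f -> bm g -> bm (fun x => f x + g x).
Proof.
move=> [mf [M hM]] [mg [N hN]]; split; first exact: measurable_funD.
by exists (M + N) => x; rewrite (le_trans (ler_normD _ _))// lerD.
Qed.

Lemma bm_mul f g : bm f -> bm g -> bm (fun x => f x * g x).
Proof.
move=> [mf [M hM]] [mg [N hN]]; split; first exact: measurable_funM.
by exists (M * N) => x; rewrite normrM ler_pM.
Qed.

Lemma bm_opp f : bm f -> bm (fun x => - f x).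
Proof.
move=> [mf [M hM]]; split; first exact: measurableT_comp.
by exists M => x; rewrite normrN.
Qed.

Lemma bm_sub f g : bm f -> bm g -> bm (fun x => f x - g x).
Proof. by move=> bf bg; apply: bm_add => //; exact: bm_opp. Qed.

Lemma bm_abs f : bm f -> bm (fun x => `|f x|).
Proof.
move=> [mf [M hM]]; split; first exact: measurableT_comp.
by exists M => x; rewrite normr_id.
Qed.

Lemma bm_max0 f : bm f -> bm (fun x => Num.max 0 (f x)).
Proof.
move=> [mf [M hM]]; split; first by apply: measurable_maxr.
exists M => x; rewrite ger0_norm ?le_max ?lexx//.
by rewrite ge_max (le_trans _ (hM x))//= (le_trans _ (hM x))// ler_norm.
Qed.

Lemma bm_indic (A : set T) : measurable A -> bm (\1_A : T -> R).
Proof.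
move=> mA; split; first exact: measurable_indic.
by exists 1 => x; rewrite indicE; case: (_ \in _); rewrite ?normr1 ?normr0.
Qed.

Lemma bm_if (b : set T) f g : measurable b -> bm f -> bm g ->
  bm (fun x => if x \in b then f x else g x).
Proof.
move=> mb bf bg.
have -> : (fun x => if x \in b then f x else g x) =
    (fun x => \1_b x * f x + (1 - \1_b x) * g x).
  apply/funext => x; rewrite indicE; case: (x \in b) => /=.
    by rewrite mul1r subrr mul0r addr0.
  by rewrite mul0r subr0 mul1r add0r.
have bi := bm_indic mb.
by apply: bm_add; apply: bm_mul => //; apply: bm_sub => //; exact: bm_cst.
Qed.

Lemma bm_comp d' (S : measurableType d') (h : S -> T) f :
  measurable_fun setT h -> bm f -> bm (fun x => f (h x)).
Proof.
move=> mh [mf [M hM]]; split; first exact: (measurableT_comp mf).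
by exists M => x.
Qed.

End bounded_measurable.

#[export] Hint Resolve bm_cst : core.

Section bounded_integrals.
Context {d} {T : measurableType d} {R : realType}.
Variable mu : {finite_measure set T -> \bar R}.
Implicit Types f g : T -> R.

Lemma bm_integrable f : bm f -> mu.-integrable setT (EFin \o f).
Proof.
move=> [mf [M hM]]; apply: measurable_bounded_integrable => //.
  by rewrite -ge0_fin_numE// fin_num_measure.
exists M; split; first exact: num_real.
by move=> y My x _ /=; apply: (le_trans (hM x)); exact: ltW.
Qed.

Lemma bm_Rint_le f g : bm f -> bm g -> (forall x, f x <= g x) ->
  \int[mu]_x f x <= \int[mu]_x g x.
Proof.
move=> bf bg fg.
by apply: le_Rintegral => //; exact: bm_integrable.
Qed.

Lemma bm_RintD f g : bm f -> bm g ->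
  \int[mu]_x (f x + g x) = \int[mu]_x f x + \int[mu]_x g x.
Proof. by move=> bf bg; rewrite RintegralD//; exact: bm_integrable. Qed.

Lemma bm_RintB f g : bm f -> bm g ->
  \int[mu]_x (f x - g x) = \int[mu]_x f x - \int[mu]_x g x.
Proof. by move=> bf bg; rewrite RintegralB//; exact: bm_integrable. Qed.

Lemma bm_RintZ (r : R) f : bm f ->
  \int[mu]_x (r * f x) = r * \int[mu]_x f x.
Proof. by move=> bf; rewrite RintegralZl//; exact: bm_integrable. Qed.

Lemma bm_RintZr (r : R) f : bm f ->
  \int[mu]_x (f x * r) = (\int[mu]_x f x) * r.
Proof. by move=> bf; rewrite RintegralZr//; exact: bm_integrable. Qed.

Lemma bm_Rint_cst (r : R) : \int[mu]_x r = r * fine (mu setT).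
Proof. by rewrite Rintegral_cst. Qed.

Lemma bm_Rint_norm f : bm f -> `|\int[mu]_x f x| <= \int[mu]_x `|f x|.
Proof. by move=> bf; apply: le_normr_Rintegral => //; exact: bm_integrable. Qed.

Lemma Rint_EFin f : bm f -> (\int[mu]_x f x)%:E = (\int[mu]_x (f x)%:E)%E.
Proof.
move=> bf; rewrite fineK//.
by apply: integrable_fin_num => //; exact: bm_integrable.
Qed.

Lemma Rint_ge0 f : (forall x, 0 <= f x) -> 0 <= \int[mu]_x f x.
Proof. by move=> f0; apply: Rintegral_ge0. Qed.

End bounded_integrals.

Section bounded_kernels.
Context {d d'} {T : measurableType d} {S : measurableType d'} {R : realType}.
Variable K : T -> {finite_measure set S -> \bar R}.
Hypothesis mK : forall A, measurable A -> measurable_fun [set: T] (K ^~ A).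
Variable b : R.
Hypothesis Kb : forall x, (K x setT <= b%:E)%E.

Lemma bm_kernel f : bm f -> bm (fun x => \int[K x]_y f y).
Proof.
move=> bf; have [mf [M hM]] := bf.
have b0 x : 0 <= fine (K x setT) by exact: fine_ge0.
have Kb' x : fine (K x setT) <= b.
  by rewrite -lee_fin fineK ?fin_num_measure.
have bfM : bm (fun y => f y + M) by apply: bm_add.
split; last first.
  exists (`|M| * b) => x.
  apply: (le_trans (bm_Rint_norm _ bf)).
  apply: (@le_trans _ _ (\int[K x]_y `|M|)).
    apply: bm_Rint_le => //; first exact: bm_abs.
    by move=> y; rewrite (le_trans (hM y))// ler_norm.
  by rewrite bm_Rint_cst ler_wpM2l.
have -> : (fun x => \int[K x]_y f y) =
    (fun x => fine (\int[K x]_y (f y + M)%:E)%E - M * fine (K x setT)).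
  apply/funext => x.
  rewrite -[fine (integral _ _ _)]/(\int[K x]_y (f y + M)).
  by rewrite bm_RintD// bm_Rint_cst addrK.
apply: measurable_funB.
  apply: measurableT_comp => //.
  apply: measurable_fun_integral_kernel => //.
    by move=> z; rewrite lee_fin -lerBlDr sub0r (lerNnormlW (hM z)).
  by apply/measurable_EFinP; exact: bfM.1.
apply: measurable_funM => //.
by apply: measurableT_comp => //; exact: mK.
Qed.

End bounded_kernels.

Section bounded_fubini.
Context {d d'} {T : measurableType d} {S : measurableType d'} {R : realType}.
Variables (mu : {finite_measure set T -> \bar R}).
Variables (nu : {finite_measure set S -> \bar R}).
Implicit Type F : T * S -> R.

Lemma bm_section1 F x : bm F -> bm (fun y => F (x, y)).
Proof. by move=> bF; apply: (bm_comp (h := pair x)) => //; exact: pair1_measurable. Qed.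

Lemma bm_section2 F y : bm F -> bm (fun x => F (x, y)).
Proof.
by move=> bF; apply: (bm_comp (h := fun x => (x, y))) => //; exact: pair2_measurable.
Qed.

Lemma prod_integrable F : bm F -> (mu \x nu)%E.-integrable setT (EFin \o F).
Proof.
move=> [mF [M hM]]; apply: measurable_bounded_integrable => //.
  have := product_measure1E mu nu measurableT measurableT.
  rewrite setXTT => e; apply: (@le_lt_trans _ _ (mu setT * nu setT)%E).
    by rewrite -e.
  by rewrite -ge0_fin_numE ?fin_numM ?fin_num_measure// mule_ge0.
exists M; split; first exact: num_real.
by move=> y My x _ /=; apply: (le_trans (hM x)); exact: ltW.
Qed.

Lemma bm_int2 F : bm F -> bm (fun x => \int[nu]_y F (x, y)).
Proof.
move=> bF; have [mF [M hM]] := bF; split.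
  apply: measurableT_comp => //.
  by apply: (measurable_fubini_F (f := EFin \o F)) => //; exact: prod_integrable.
exists (`|M| * fine (nu setT)) => x.
apply: (le_trans (bm_Rint_norm _ (bm_section1 x bF))).
rewrite -bm_Rint_cst; apply: bm_Rint_le => //.
  by apply: bm_abs; exact: bm_section1.
by move=> y; rewrite (le_trans (hM _))// ler_norm.
Qed.

Lemma bm_fubini F : bm F ->
  \int[mu]_x \int[nu]_y F (x, y) = \int[nu]_y \int[mu]_x F (x, y).
Proof.
move=> bF; have iF := prod_integrable bF; rewrite /Rintegral; congr fine.
transitivity (\int[mu]_x \int[nu]_y (EFin \o F) (x, y))%E.
  apply: eq_integral => x _; rewrite fineK//.
  by apply: integrable_fin_num => //; apply: bm_integrable; exact: bm_section1.
rewrite Fubini//.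
apply: eq_integral => y _; rewrite fineK//.
by apply: integrable_fin_num => //; apply: (bm_integrable mu (bm_section2 y bF)).
Qed.

End bounded_fubini.

(** * Iterated kernels and growth of functions of pairs *)

Section iterated_kernels.
Context {d} {X : measurableType d} {R : realType}.
Variables (K : nat -> X -> {finite_measure set X -> \bar R}) (a : nat -> R).
Variables (kap : nat -> bool) (C : set X).
Hypothesis mK :
  forall i A, measurable A -> measurable_fun [set: X] (K i ^~ A).
Hypothesis Ka : forall i x, (K i x setT <= (expR (a i))%:E)%E.
Hypothesis a_ge0 : forall i, 0 <= a i.
Hypothesis mC : measurable C.
Implicit Types f g : X -> R.

(** Blocks are indexed backwards from the final time: [W i t f] applies the
    blocks [i + t - 1], ..., [i] in the order of time, hence the index [i + t']
    of the kernel that acts first. *)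
Fixpoint W i t f : X -> R :=
  if t is t'.+1 then fun x => \int[K (i + t') x]_y W i t' f y else f.

(** [W], with an extra factor [s] for every visit of the complement of [C] at
    the beginning of a good block. *)
Fixpoint gam (s : R) i t f : X -> R :=
  if t is t'.+1 then fun x =>
    (if x \in C then 1 else if kap (i + t') then s else 1) *
    \int[K (i + t') x]_y gam s i t' f y
  else f.

Definition asum (b : nat -> R) i t := \sum_(l < t) b (i + l)%N.
Definition ksum i t := asum (fun l => (kap l)%:R) i t.

Lemma asumS b i t : asum b i t.+1 = asum b i t + b (i + t)%N.
Proof. by rewrite /asum big_ord_recr. Qed.

Lemma asum0 b i : asum b i 0 = 0.
Proof. by rewrite /asum big_ord0. Qed.

Lemma bm_K i f : bm f -> bm (fun x => \int[K i x]_y f y).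
Proof. by move=> bf; exact: (bm_kernel (mK i) (Ka i)). Qed.

Lemma W_bm i t f : bm f -> bm (W i t f).
Proof. by move=> bf; elim: t => [//|t IH] /=; exact: bm_K. Qed.

Lemma W_ge0 i t f : (forall x, 0 <= f x) -> forall x, 0 <= W i t f x.
Proof. by move=> f0; elim: t => [//|t IH] x /=; exact: Rint_ge0. Qed.

Lemma W_le i t f g : bm f -> bm g -> (forall x, f x <= g x) ->
  forall x, W i t f x <= W i t g x.
Proof.
move=> bf bg fg; elim: t => [//|t IH] x /=.
by apply: bm_Rint_le => //; exact: W_bm.
Qed.

Lemma W_scale i t r f : bm f -> forall x, W i t (fun y => r * f y) x = r * W i t f x.
Proof.
move=> bf; elim: t => [//|t IH] x /=.
rewrite -bm_RintZ; last exact: W_bm.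
by congr Rintegral; apply/funext => y; exact: IH.
Qed.

Lemma W_sub i t f g : bm f -> bm g ->
  forall x, W i t (fun y => f y - g y) x = W i t f x - W i t g x.
Proof.
move=> bf bg; elim: t => [//|t IH] x /=.
rewrite -bm_RintB; try exact: W_bm.
by congr Rintegral; apply/funext => y; exact: IH.
Qed.

Lemma W_add i t f g : bm f -> bm g ->
  forall x, W i t (fun y => f y + g y) x = W i t f x + W i t g x.
Proof.
move=> bf bg; elim: t => [//|t IH] x /=.
rewrite -bm_RintD; try exact: W_bm.
by congr Rintegral; apply/funext => y; exact: IH.
Qed.

Lemma W_comp i t1 t2 f : W i (t1 + t2) f = W (i + t1) t2 (W i t1 f).
Proof.
elim: t2 => [|t2 IH]; first by rewrite addn0.
by rewrite addnS /= IH addnA.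
Qed.

Lemma W_one i t x : W i t (fun=> 1) x <= expR (asum a i t).
Proof.
elim: t x => [|t IH] x /=; first by rewrite asum0 expR0.
apply: (@le_trans _ _ (\int[K (i + t) x]_y expR (asum a i t))).
  by apply: bm_Rint_le => //; exact: W_bm.
rewrite bm_Rint_cst asumS expRD ler_wpM2l ?expR_ge0//.
by rewrite -lee_fin fineK ?fin_num_measure.
Qed.

Lemma W_bound i t f (c : R) : bm f -> (forall x, f x <= c) -> 0 <= c ->
  forall x, W i t f x <= c * expR (asum a i t).
Proof.
move=> bf fc c0 x; apply: (le_trans (W_le _ _ bf (bm_cst c) fc x)).
have := W_scale i t c (bm_cst 1) x.
under [X in W _ _ X _]eq_fun do rewrite mulr1.
by move=> ->; rewrite ler_wpM2l// W_one.
Qed.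

Section gam.
Variable s : R.
Hypothesis s1 : 1 <= s.

Let s0 : 0 <= s. Proof. exact: le_trans s1. Qed.

Definition gw i (x : X) : R := if x \in C then 1 else if kap i then s else 1.

Lemma gw_bm i : bm (gw i).
Proof. by rewrite /gw; apply: bm_if => //; case: (kap i). Qed.

Lemma gw_ge1 i x : 1 <= gw i x.
Proof. by rewrite /gw; case: ifP => //; case: ifP. Qed.

Lemma gw_ge0 i x : 0 <= gw i x. Proof. exact: le_trans (gw_ge1 i x). Qed.

Lemma gam_bm i t f : bm f -> bm (gam s i t f).
Proof.
move=> bf; elim: t => [//|t IH] /=.
by apply: bm_mul; [exact: gw_bm|exact: bm_K].
Qed.

Lemma gam_ge0 i t f : (forall x, 0 <= f x) -> forall x, 0 <= gam s i t f x.
Proof.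
move=> f0; elim: t => [//|t IH] x /=.
by rewrite mulr_ge0 ?gw_ge0 ?Rint_ge0.
Qed.

End gam.

(** The extra factor [expR th] off [C * C] pays for the steps where the pair
    cannot be contracted. *)
Definition psi (th : R) (p : X * X) : R := if p \in C `*` C then 1 else expR th.

Lemma psi_bm th : bm (psi th).
Proof. by apply: bm_if => //; exact: measurableX. Qed.

Section pair_growth.
Variables (i : nat) (F : nat -> X * X -> R) (B th : R) (f : X -> R).
Hypothesis bF : forall t, bm (F t).
Hypothesis F0 : forall t p, 0 <= F t p.
Hypothesis B0 : 0 <= B.
Hypothesis th0 : 0 <= th.
Hypothesis bf : bm f.
Hypothesis f0 : forall x, 0 <= f x.
Hypothesis Finit : forall p, F 0%N p <= B * (f p.1 * f p.2).
Hypothesis Fgen : forall t x x',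
  F t.+1 (x, x') <= \int[K (i + t)%N x]_y \int[K (i + t)%N x']_y' F t (y, y').
Hypothesis Fcpl : forall t x x', kap (i + t)%N -> C x -> C x' ->
  F t.+1 (x, x') <= expR (- th) *
    \int[K (i + t)%N x]_y \int[K (i + t)%N x']_y' (psi th (y, y') * F t (y, y')).

Lemma psi_ge1 p : 1 <= psi th p.
Proof. by rewrite /psi; case: ifP => // _; rewrite -expR0 ler_expR. Qed.

Lemma psi_ge0 p : 0 <= psi th p.
Proof. exact: le_trans (psi_ge1 p). Qed.

Lemma psi_le p : psi th p <= expR th.
Proof. by rewrite /psi; case: ifP => // _; rewrite -[leLHS]expR0 ler_expR. Qed.

(** At a good block, a pair in [C * C] gains the factor [expR (- th)]; any
    other pair costs [expR th], but one of its coordinates is then outside [C]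
    and contributes the factor [expR (2 th)] to its weight [gam], which
    leaves [expR (- th)] again. A block that is not good costs at most the factor
    [expR th]. The good blocks count with one sign and the other ones with the
    opposite sign, hence the exponent [2 * ksum i t - t]. *)
Lemma pair_growth t x x' : psi th (x, x') * F t (x, x') <=
  B * expR (th - th * (2 * ksum i t - t%:R)) *
  (gam (expR (th *+ 2)) i t f x * gam (expR (th *+ 2)) i t f x').
Proof.
have s1 : 1 <= expR (th *+ 2) by rewrite -expR0 ler_expR mulrn_wge0.
elim: t x x' => [|t IH] x x'.
  rewrite /ksum asum0 mulr0 subrr mulr0 subr0 /= (mulrC B) -mulrA.
  by apply: ler_pM => //; [exact: psi_ge0|exact: psi_le].
set k := (i + t)%N; set E := expR (th - th * (2 * ksum i t - t%:R)).
set G := gam _ i t f in IH *.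
have bG : bm G by exact: gam_bm.
have G0 y : 0 <= G y by exact: gam_ge0.
have bpF : bm (fun p => psi th p * F t p) by apply: bm_mul => //; exact: psi_bm.
set P := \int[K k x]_y \int[K k x']_y' (psi th (y, y') * F t (y, y')).
set J := fun x => \int[K k x]_y G y.
have J0 y : 0 <= J y by exact: Rint_ge0.
have E0 : 0 <= B * E by rewrite mulr_ge0// expR_ge0.
have HP : P <= B * E * (J x * J x').
  apply: (@le_trans _ _ (\int[K k x]_y \int[K k x']_y' (B * E * (G y * G y')))).
    apply: bm_Rint_le.
    - exact: (bm_int2 (K k x) (K k x') bpF).
    - apply: (bm_int2 (K k x) (K k x') (F := fun p => B * E * (G p.1 * G p.2))).
      apply: bm_mul => //; apply: bm_mul.
        by apply: bm_comp => //; exact: measurable_fst.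
      by apply: bm_comp => //; exact: measurable_snd.
    - move=> y; apply: bm_Rint_le.
      + exact: (bm_section1 y bpF).
      + by do 2 apply: bm_mul => //.
      + by move=> y'; exact: IH.
  rewrite le_eqVlt; apply/orP; left; apply/eqP.
  transitivity (\int[K k x]_y (B * E * (G y * J x'))).
    congr Rintegral; apply/funext => y.
    rewrite bm_RintZ; last by apply: bm_mul.
    by rewrite bm_RintZ.
  rewrite bm_RintZ; last by apply: bm_mul.
  by rewrite bm_RintZr.
have FP : F t.+1 (x, x') <= P.
  apply: (le_trans (Fgen _ _ _)); apply: bm_Rint_le.
  - exact: (bm_int2 (K k x) (K k x') (bF t)).
  - exact: (bm_int2 (K k x) (K k x') bpF).
  - move=> y; apply: bm_Rint_le.
    + exact: (bm_section1 y (bF t)).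
    + exact: (bm_section1 y bpF).
    + by move=> y'; rewrite ler_peMl// psi_ge1.
rewrite /ksum asumS -/(ksum i t) /= -/k -/(gw _ _ _) -/(gw _ _ x') -/(J x) -/(J x').
have JJ : 0 <= J x * J x' by rewrite mulr_ge0.
have EJ : 0 <= B * E * (J x * J x') by rewrite mulr_ge0.
have Estep (c : bool) : expR (th - th * (2 * (ksum i t + c%:R) - t.+1%:R)) =
    E * expR (if c then - th else th).
  rewrite /E -expRD; congr expR; rewrite -natr1.
  by case: c; rewrite /=; ring.
rewrite Estep.
have -> : B * (E * expR (if kap k then - th else th)) *
   (gw (expR (th *+ 2)) k x * J x * (gw (expR (th *+ 2)) k x' * J x')) =
   (B * E * (J x * J x')) *
   ((gw (expR (th *+ 2)) k x * gw (expR (th *+ 2)) k x') *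
    expR (if kap k then - th else th)) by ring.
case: (boolP (kap k)) => kk; last first.
  rewrite /gw (negbTE kk) !if_same mulr1 mul1r mulrC.
  by apply: ler_pM => //; [exact: psi_ge0|exact: le_trans HP|exact: psi_le].
have [inC|outC] := boolP ((x, x') \in C `*` C).
  move: (inC); rewrite inE => -[/= Cx Cx'].
  rewrite /psi inC mul1r /gw !mem_set// !mul1r mulrC.
  apply: (le_trans (Fcpl kk Cx Cx')).
  by rewrite ler_wpM2l// expR_ge0.
(* Some coordinate is outside [C], and its weight pays for [psi] and for the
   missing contraction. *)
rewrite {1}/psi (negbTE outC) mulrC.
apply: ler_pM => //; first exact: le_trans HP.
suff H : expR (th *+ 2) <= gw (expR (th *+ 2)) k x * gw (expR (th *+ 2)) k x'.
  have -> : expR th = expR (th *+ 2) * expR (- th).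
    by rewrite -expRD; congr expR; ring.
  by rewrite ler_wpM2r// expR_ge0.
have [xC|xC] := boolP (x \in C); last first.
  rewrite {1}/gw (negbTE xC) kk ler_peMr ?expR_ge0//; exact: gw_ge1.
have [xC'|xC'] := boolP (x' \in C).
  by case/negP: outC; rewrite inE; split; rewrite /= -inE.
by rewrite {2}/gw (negbTE xC') kk ler_peMl ?expR_ge0//; exact: gw_ge1.
Qed.

End pair_growth.

Section gam_bounds.
Variable f : X -> R.
Hypothesis bf : bm f.
Hypothesis f0 : forall x, 0 <= f x.

(** [gam (expR th)] weighs a path by [expR (th * v)], with [v] its number of
    visits outside [C]. The paths with [v <= q] weigh at most [expR (th * q)],
    and those with [v >= q] satisfy [th * v <= th1 * v + (th - th1) * q].
    The induction shifts [q] by one at each visit, which is why [q] is real. *)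
Lemma gam_interp (th th1 : R) i t (q : R) x : 0 <= th <= th1 ->
  gam (expR th) i t f x <=
  expR (th * q) * W i t f x + expR ((th - th1) * q) * gam (expR th1) i t f x.
Proof.
move=> /andP[h0 h1].
have s1 : 1 <= expR th by rewrite -expR0 ler_expR.
have s2 : 1 <= expR th1 by rewrite -expR0 ler_expR (le_trans h0).
elim: t q x => [|t IH] q x /=.
  rewrite -mulrDl ler_peMl//.
  have [q0|q0] := leP 0 q.
    by rewrite (@le_trans _ _ (expR (th * q)))// ?lerDl ?expR_ge0// -expR0 ler_expR mulr_ge0.
  rewrite (@le_trans _ _ (expR ((th - th1) * q)))// ?lerDr ?expR_ge0//.
  by rewrite -expR0 ler_expR; apply: mulr_le0; [rewrite subr_le0|exact: ltW].
set k := (i + t)%N.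
have H q' : \int[K k x]_y gam (expR th) i t f y <=
    expR (th * q') * (\int[K k x]_y W i t f y) +
    expR ((th - th1) * q') * (\int[K k x]_y gam (expR th1) i t f y).
  have b1 : bm (W i t f) by exact: W_bm.
  have b2 : bm (gam (expR th1) i t f) by exact: gam_bm.
  rewrite -!bm_RintZ// -bm_RintD; try by apply: bm_mul.
  apply: bm_Rint_le; first exact: gam_bm.
    by apply: bm_add; apply: bm_mul.
  by move=> y; exact: IH.
case: ifP => [_|_]; first by rewrite !mul1r; exact: H.
case: ifP => [_|_]; last by rewrite !mul1r; exact: H.
apply: (le_trans (ler_wpM2l (expR_ge0 _) (H (q - 1)))).
rewrite mulrDr !mulrA -!expRD.
have -> : th + th * (q - 1) = th * q by ring.
by have -> : th + (th - th1) * (q - 1) = (th - th1) * q + th1 by ring.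
Qed.

End gam_bounds.

(** The weight of a visit outside [C] is compensated by the small mass of the
    kernel there. *)
Lemma gam_bound (th c : R) i t f : 0 <= th -> bm f ->
  (forall j x, kap j -> x \notin C -> (K j x setT <= (expR (- th))%:E)%E) ->
  0 <= c -> (forall x, f x <= c) ->
  forall x, gam (expR th) i t f x <= c * expR (asum a i t).
Proof.
move=> h0 bf hout c0 fc.
have s1 : 1 <= expR th by rewrite -expR0 ler_expR.
elim: t => [|t IH] x /=; first by rewrite asum0 expR0 mulr1.
set k := (i + t)%N.
have H : \int[K k x]_y gam (expR th) i t f y <=
    c * expR (asum a i t) * fine (K k x setT).
  rewrite -bm_Rint_cst; apply: bm_Rint_le => //; exact: gam_bm.
have ce : 0 <= c * expR (asum a i t) by rewrite mulr_ge0 ?expR_ge0.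
have Hk : fine (K k x setT) <= expR (a k).
  by rewrite -lee_fin fineK ?fin_num_measure.
rewrite asumS expRD mulrA -/k.
have H1 : \int[K k x]_y gam (expR th) i t f y <=
    c * expR (asum a i t) * expR (a k).
  by apply: (le_trans H); rewrite ler_wpM2l.
case: ifPn => [_|xC]; first by rewrite mul1r.
case: ifPn => [kk|_]; last by rewrite mul1r.
apply: (le_trans (ler_wpM2l (expR_ge0 _) H)).
rewrite mulrCA ler_wpM2l//.
apply: (@le_trans _ _ (expR th * expR (- th))).
  rewrite ler_wpM2l ?expR_ge0// -lee_fin fineK ?fin_num_measure//; exact: hout.
by rewrite -expRD subrr ler_expR.
Qed.

End iterated_kernels.

(** * Doeblin kernels on pairs *)

Section double_integrals.
Context {d} {X : measurableType d} {R : realType}.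
Variables m1 m2 : {finite_measure set X -> \bar R}.
Implicit Types F G : X * X -> R.

Definition dint F := \int[m1]_x \int[m2]_y F (x, y).

Lemma dint_le F G : bm F -> bm G -> (forall p, F p <= G p) -> dint F <= dint G.
Proof.
move=> bF bG FG; apply: bm_Rint_le; try exact: (bm_int2 m1).
by move=> x; apply: bm_Rint_le => //; exact: bm_section1.
Qed.

Lemma dint_ge0 F : (forall p, 0 <= F p) -> 0 <= dint F.
Proof. by move=> F0; apply: Rint_ge0 => x; exact: Rint_ge0. Qed.

Lemma dintD F G : bm F -> bm G -> dint (fun p => F p + G p) = dint F + dint G.
Proof.
move=> bF bG; rewrite /dint -bm_RintD; try exact: (bm_int2 m1).
by congr Rintegral; apply/funext => x; rewrite bm_RintD//; exact: bm_section1.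
Qed.

Lemma dintZ r F : bm F -> dint (fun p => r * F p) = r * dint F.
Proof.
move=> bF; rewrite /dint -bm_RintZ; try exact: (bm_int2 m1).
by congr Rintegral; apply/funext => x; rewrite bm_RintZ//; exact: bm_section1.
Qed.

Lemma dintB F G : bm F -> bm G -> dint (fun p => F p - G p) = dint F - dint G.
Proof.
move=> bF bG; rewrite /dint -bm_RintB; try exact: (bm_int2 m1).
by congr Rintegral; apply/funext => x; rewrite bm_RintB//; exact: bm_section1.
Qed.

Lemma dint_norm F : bm F -> `|dint F| <= dint (fun p => `|F p|).
Proof.
move=> bF; rewrite ler_norml; apply/andP; split; last first.
  by apply: dint_le => //; [exact: bm_abs|move=> p; exact: ler_norm].
rewrite -mulN1r -dintZ; last exact: bm_abs.
apply: dint_le => //; first by apply: bm_mul => //; exact: bm_abs.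
by move=> p; rewrite mulN1r lerNl ler_normr lexx orbT.
Qed.

Lemma dint_prod (f g : X -> R) : bm f -> bm g ->
  dint (fun p => f p.1 * g p.2) = (\int[m1]_x f x) * (\int[m2]_x g x).
Proof.
move=> bf bg; rewrite /dint -bm_RintZr//.
by congr Rintegral; apply/funext => x /=; rewrite bm_RintZ.
Qed.

Lemma bm_tensor (f g : X -> R) : bm f -> bm g ->
  bm (fun p : X * X => f p.1 * g p.2).
Proof.
move=> bf bg; apply: bm_mul.
  by apply: bm_comp => //; exact: measurable_fst.
by apply: bm_comp => //; exact: measurable_snd.
Qed.

End double_integrals.

Lemma contract_arith {R : realFieldType} (c p1 p2 D rho : R) :
  0 <= c <= 1 -> c * D <= p1 <= D -> c * D <= p2 <= D ->
  0 <= p1 -> 0 <= p2 -> 1 - c <= rho -> `|p1 - p2| <= rho * (p1 + p2).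
Proof.
move=> /andP[c0 c1] /andP[l1 u1] /andP[l2 u2] p10 p20 hrho.
have h1 : c * p1 <= p2 by apply: le_trans l2; rewrite ler_wpM2l.
have h2 : c * p2 <= p1 by apply: le_trans l1; rewrite ler_wpM2l.
apply: (@le_trans _ _ ((1 - c) * (p1 + p2))); last first.
  by rewrite ler_wpM2r// addr_ge0.
have q1 : c * p1 <= p1 by rewrite ler_piMl.
have q2 : c * p2 <= p2 by rewrite ler_piMl.
by rewrite mulrBl mul1r mulrDr ler_norml; apply/andP; split; lra.
Qed.

(** The upper constant of the local Doeblin condition is absorbed in [phi]. *)
Definition doeblin {d} {X : measurableType d} {R : realType} (e : R)
    (C : set X) (k : X -> {finite_measure set X -> \bar R}) :=
  exists (mu : probability X R) (phi : X -> R), (forall x, 0 < phi x) /\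
    forall x A, C x -> measurable A ->
      ((e * phi x)%:E * mu A <= k x (A `&` C))%E /\
      (k x (A `&` C) <= (phi x)%:E * mu A)%E.

Section doeblin_integrals.
Context {d} {X : measurableType d} {R : realType}.
Variables (e : R) (C : set X) (k : X -> {finite_measure set X -> \bar R}).
Hypothesis e01 : 0 < e <= 1.
Hypothesis mC : measurable C.
Variables (mu : probability X R) (phi : X -> R).
Hypothesis phi0 : forall x, 0 < phi x.
Hypothesis kmu : forall x A, C x -> measurable A ->
      ((e * phi x)%:E * mu A <= k x (A `&` C))%E /\
      (k x (A `&` C) <= (phi x)%:E * mu A)%E.

Let e0 : 0 < e. Proof. by case/andP: e01. Qed.

Let e2 : 0 <= e ^+ 2 <= 1.
Proof.
apply/andP; split; first exact: exprn_ge0 (ltW e0).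
by apply: exprn_ile1; case/andP: e01 => // /ltW.
Qed.

Lemma doeblin_fun x f : C x -> bm f -> (forall y, 0 <= f y) ->
  e * phi x * \int[mu]_y f y <= \int[k x]_y (\1_C y * f y) <=
  phi x * \int[mu]_y f y.
Proof.
move=> Cx bf f0.
have mf : measurable_fun setT (EFin \o f) by apply/measurable_EFinP; exact: bf.1.
have f0' y : (0 <= (EFin \o f) y)%E by rewrite lee_fin.
have bCf : bm (fun y => \1_C y * f y) by apply: bm_mul => //; exact: bm_indic.
have ep0 : 0 <= e * phi x by rewrite mulr_ge0// ltW.
have p0 : 0 <= phi x by exact: ltW.
have CfE : ((\int[k x]_y (\1_C y * f y))%:E = \int[mrestr (k x) mC]_y (f y)%:E)%E.
  by rewrite Rint_EFin// (integral_mrestr_indic (k x) mC).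
apply/andP; split.
  rewrite -lee_fin CfE EFinM Rint_EFin// -[X in (X%:E * _)%E]/((NngNum ep0)%:num).
  rewrite -ge0_integral_mscale//; last by move=> y _; exact: f0'.
  by apply: ge0_le_measure_integral => // A mA; exact: (kmu Cx mA).1.
rewrite -lee_fin CfE EFinM Rint_EFin// -[X in (X%:E * _)%E]/((NngNum p0)%:num).
rewrite -ge0_integral_mscale//; last by move=> y _; exact: f0'.
by apply: ge0_le_measure_integral => // A mA; exact: (kmu Cx mA).2.
Qed.

(** Both kernels are comparable to the same measure [mu] on [C]; exchanging
    the two starting points costs a factor [e] for each of them. *)
Lemma doeblin_swap x x' u v : C x -> C x' -> bm u -> bm v ->
  (forall y, 0 <= u y) -> (forall y, 0 <= v y) ->
  e ^+ 2 * ((\int[k x]_y (\1_C y * u y)) * (\int[k x']_y (\1_C y * v y))) <=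
  (\int[k x]_y (\1_C y * v y)) * (\int[k x']_y (\1_C y * u y)).
Proof.
move=> Cx Cx' bu bv u0 v0.
have [ul1 uu1] := andP (doeblin_fun Cx bu u0).
have [ul2 uu2] := andP (doeblin_fun Cx' bu u0).
have [vl1 vu1] := andP (doeblin_fun Cx bv v0).
have [vl2 vu2] := andP (doeblin_fun Cx' bv v0).
have C0 (y : X) : 0 <= \1_C y :> R by rewrite indicE.
have U0 : 0 <= \int[mu]_y u y by exact: Rint_ge0.
have V0 : 0 <= \int[mu]_y v y by exact: Rint_ge0.
have p0 := ltW (phi0 x); have p0' := ltW (phi0 x'); have e0' := ltW e0.
apply: (@le_trans _ _ ((e * phi x * \int[mu]_y v y) * (e * phi x' * \int[mu]_y u y))).
  have -> : e * phi x * (\int[mu]_y v y) * (e * phi x' * (\int[mu]_y u y)) =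
    e ^+ 2 * ((phi x * \int[mu]_y u y) * (phi x' * \int[mu]_y v y)) by ring.
  rewrite ler_wpM2l ?exprn_ge0//; apply: ler_pM => //;
    by apply: Rint_ge0 => y; rewrite mulr_ge0.
by apply: ler_pM => //; rewrite !mulr_ge0.
Qed.

Lemma doeblin_dint x x' (F : X * X -> R) : C x -> C x' -> bm F ->
  (forall p, 0 <= F p) ->
  e ^+ 2 * (phi x * phi x') * dint mu mu F <=
  dint (k x) (k x') (fun p => \1_C p.1 * \1_C p.2 * F p) <=
  phi x * phi x' * dint mu mu F.
Proof.
move=> Cx Cx' bF F0; rewrite /dint /=.
have bs y : bm (fun y' => F (y, y')) by exact: bm_section1.
have C0 (y : X) : 0 <= \1_C y :> R by rewrite indicE.
have bC : bm (\1_C : X -> R) by exact: bm_indic.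
set G := fun y => \int[k x']_y' (\1_C y' * F (y, y')).
have bG : bm G.
  apply: (bm_int2 (k x) (k x') (F := fun p => \1_C p.2 * F p)).
  by apply: bm_mul => //; apply: (bm_comp _ bC); exact: measurable_snd.
have -> : \int[k x]_y \int[k x']_y' (\1_C y * \1_C y' * F (y, y')) =
    \int[k x]_y (\1_C y * G y).
  congr Rintegral; apply/funext => y; rewrite /G -bm_RintZ; last by apply: bm_mul.
  by congr Rintegral; apply/funext => y'; rewrite mulrA.
set H := fun y => \int[mu]_y' F (y, y').
have bH : bm H by exact: (bm_int2 mu mu).
have GH y : e * phi x' * H y <= G y <= phi x' * H y by exact: doeblin_fun.
have G0 y : 0 <= G y by apply: Rint_ge0 => y'; rewrite mulr_ge0.
have /andP[l u] := doeblin_fun Cx bG G0.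
have p0 := ltW (phi0 x); have p0' := ltW (phi0 x'); have e0' := ltW e0.
apply/andP; split.
  apply: le_trans l.
  have -> : e ^+ 2 * (phi x * phi x') * \int[mu]_y H y =
     e * phi x * ((e * phi x') * \int[mu]_y H y) by ring.
  rewrite ler_wpM2l ?mulr_ge0// -bm_RintZ//; apply: bm_Rint_le => //.
    exact: bm_mul.
  by move=> y; case/andP: (GH y).
apply: (le_trans u); rewrite -mulrA ler_wpM2l// -bm_RintZ//.
apply: bm_Rint_le => //; first exact: bm_mul.
by move=> y; case/andP: (GH y).
Qed.

(** The positive and the negative part of an antisymmetric function are
    exchanged by the flip of the coordinates, and hence have the same integral
    [I] against [mu * mu]. Their integrals against the kernels both lie between
    [e ^ 2 * I] and [I], up to the same factor, and the cancellation is at least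
    a fraction [e ^ 2] of the total. *)
Lemma doeblin_contract x x' (H : X * X -> R) (rho : R) : C x -> C x' -> bm H ->
  (forall y y', H (y', y) = - H (y, y')) -> 1 - e ^+ 2 <= rho ->
  `|dint (k x) (k x') (fun p => \1_C p.1 * \1_C p.2 * H p)| <=
  rho * dint (k x) (k x') (fun p => \1_C p.1 * \1_C p.2 * `|H p|).
Proof.
move=> Cx Cx' bH aH hrho.
pose P p := Num.max 0 (H p); pose Ps (p : X * X) := P (p.2, p.1).
have bP : bm P by exact: bm_max0.
have bPs : bm Ps.
  apply: (bm_comp _ bP); apply: measurable_fun_pair; first exact: measurable_snd.
  exact: measurable_fst.
have P0 p : 0 <= P p by rewrite /P le_max lexx.
have bC1 : bm (fun p : X * X => \1_C p.1 * \1_C p.2 : R).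
  by apply: bm_tensor; exact: bm_indic.
pose p1 := dint (k x) (k x') (fun p => \1_C p.1 * \1_C p.2 * P p).
pose p2 := dint (k x) (k x') (fun p => \1_C p.1 * \1_C p.2 * Ps p).
have HP p : H p = P p - Ps p.
  case: p => y y'; rewrite /Ps /P /= (aH y y').
  case: (leP 0 (H (y, y'))) => h.
    by rewrite max_l ?oppr_le0// subr0.
  by rewrite max_r ?oppr_ge0 ?ltW// sub0r opprK.
have HA p : `|H p| = P p + Ps p.
  case: p => y y'; rewrite /Ps /P /= (aH y y').
  case: (leP 0 (H (y, y'))) => h.
    by rewrite max_l ?oppr_le0// addr0 ger0_norm.
  by rewrite max_r ?oppr_ge0 ?ltW// add0r ltr0_norm.
have -> : dint (k x) (k x') (fun p => \1_C p.1 * \1_C p.2 * H p) = p1 - p2.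
  rewrite -dintB; try exact: bm_mul.
  by congr dint; apply/funext => p; rewrite HP mulrBr.
have -> : dint (k x) (k x') (fun p => \1_C p.1 * \1_C p.2 * `|H p|) = p1 + p2.
  rewrite -dintD; try exact: bm_mul.
  by congr dint; apply/funext => p; rewrite HA mulrDr.
have PP : dint mu mu Ps = dint mu mu P.
  exact/esym/(bm_fubini mu mu bP).
have lu1 := doeblin_dint Cx Cx' bP P0.
have lu2 : e ^+ 2 * (phi x * phi x') * dint mu mu P <= p2 <=
    phi x * phi x' * dint mu mu P.
  by rewrite -PP; exact: (doeblin_dint Cx Cx' bPs (fun p => P0 _)).
have C0 (y : X) : 0 <= \1_C y :> R by rewrite indicE.
have p10 : 0 <= p1.
  apply: dint_ge0 => p; apply: mulr_ge0; last exact: P0.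
  by apply: mulr_ge0; exact: C0.
have p20 : 0 <= p2.
  apply: dint_ge0 => p; apply: mulr_ge0; last exact: P0.
  by apply: mulr_ge0; exact: C0.
rewrite -mulrA in lu1; rewrite -mulrA in lu2.
exact: (contract_arith e2 lu1 lu2 p10 p20 hrho).
Qed.

End doeblin_integrals.

(** * Approximate exchange and contraction *)

Section pair_bounds.
Context {d} {X : measurableType d} {R : realType}.
Variables (K : nat -> X -> {finite_measure set X -> \bar R}) (a : nat -> R).
Variables (kap : nat -> bool) (C : set X).
Hypothesis mK :
  forall i A, measurable A -> measurable_fun [set: X] (K i ^~ A).
Hypothesis Ka : forall i x, (K i x setT <= (expR (a i))%:E)%E.
Hypothesis a_ge0 : forall i, 0 <= a i.
Hypothesis mC : measurable C.
Variable e : R.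
Hypothesis e01 : 0 < e <= 1.
Hypothesis hD : forall i, kap i -> doeblin e C (K i).
Implicit Types f g : X -> R.

Let e2 : 0 <= e ^+ 2 <= 1.
Proof.
case/andP: e01 => e0 e1; apply/andP; split; first exact: exprn_ge0 (ltW e0).
exact: exprn_ile1 (ltW e0) e1.
Qed.

Let C0 (y : X) : 0 <= \1_C y :> R. Proof. by rewrite indicE. Qed.

Let bC : bm (\1_C : X -> R). Proof. exact: bm_indic. Qed.

Let CC : X * X -> R := fun p => \1_C p.1 * \1_C p.2.

Let bCC : bm CC. Proof. exact: bm_tensor. Qed.

Let CC0 p : 0 <= CC p. Proof. by apply: mulr_ge0; exact: C0. Qed.

Let CC1 p : CC p <= 1.
Proof.
by rewrite /CC !indicE -natrM lern1; case: (_ \in _); case: (_ \in _).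
Qed.

(** Contraction only acts on the part of the pair that remains in [C * C]; the
    weight [psi] restores the loss on the other part. *)
Let psiE th p : expR (- th) * psi C th p = expR (- th) * CC p + (1 - CC p).
Proof.
case: p => y y'; rewrite /psi /CC /= !indicE.
have -> : ((y, y') \in C `*` C) = (y \in C) && (y' \in C).
  by apply/idP/andP => [|[]]; rewrite !inE.
case: (y \in C); case: (y' \in C); rewrite /= ?(mulr1, mulr0, mul0r, subrr, addr0, subr0, add0r)//;
  by rewrite -expRD addNr expR0.
Qed.

(** The starting points [x] and [x'] can be exchanged up to the factor [e ^ 2]
    and an error that is small when the good blocks are frequent: the
    positive part of [e ^ 2 * u x * v x' - v x * u x'] has the growth required
    by [pair_growth], since it integrates to something nonpositive over
    [C * C]. *)
Lemma swap_bound (th B1 B2 : R) i t f1 f2 : 0 <= th -> bm f1 -> bm f2 ->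
  (forall x, 0 <= f1 x <= B1) -> (forall x, 0 <= f2 x <= B2) ->
  (forall j x, kap j -> x \notin C -> (K j x setT <= (expR (- (th *+ 2)))%:E)%E) ->
  forall x x', e ^+ 2 * (W K i t f1 x * W K i t f2 x') <=
    W K i t f2 x * W K i t f1 x' +
    B1 * B2 * expR (th - th * (2 * ksum kap i t - t%:R) + asum a i t *+ 2).
Proof.
move=> th0 b1 b2 h1 h2 hout x x'.
have h10 y : 0 <= f1 y by case/andP: (h1 y).
have h20 y : 0 <= f2 y by case/andP: (h2 y).
have B10 : 0 <= B1 by case/andP: (h1 x) => u v; exact: le_trans v.
have B20 : 0 <= B2 by case/andP: (h2 x) => u v; exact: le_trans v.
pose u t := W K i t f1; pose v t := W K i t f2.
have bu s : bm (u s) by exact: (W_bm mK Ka).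
have bv s : bm (v s) by exact: (W_bm mK Ka).
have u0 s y : 0 <= u s y by exact: W_ge0.
have v0 s y : 0 <= v s y by exact: W_ge0.
pose H s (p : X * X) := e ^+ 2 * (u s p.1 * v s p.2) - v s p.1 * u s p.2.
have bH s : bm (H s).
  by apply: bm_sub; [apply: bm_mul => //|]; exact: bm_tensor.
pose F s p := Num.max 0 (H s p).
have bF s : bm (F s) by exact: bm_max0.
have F0 s p : 0 <= F s p by rewrite /F le_max lexx.
have HF s p : H s p <= F s p by rewrite /F le_max lexx orbT.
have HS s y y' : H s.+1 (y, y') = dint (K (i + s)%N y) (K (i + s)%N y') (H s).
  rewrite /H dintB; first last.
  - exact: bm_tensor.
  - by apply: bm_mul => //; exact: bm_tensor.
  by rewrite dintZ ?dint_prod//; exact: bm_tensor.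
have B0 : 0 <= B1 * B2 by exact: mulr_ge0.
have Finit p : F 0%N p <= B1 * B2 * (1 * 1).
  rewrite /F ge_max !mulr1 B0/= /H /u /v /=.
  apply: (@le_trans _ _ (f1 p.1 * f2 p.2)).
    rewrite lerBlDr (@le_trans _ _ (f1 p.1 * f2 p.2))// ?lerDl ?mulr_ge0//.
    by rewrite ler_piMl ?mulr_ge0//; case/andP: e2.
  by apply: ler_pM => //; [case/andP: (h1 p.1)|case/andP: (h2 p.2)].
have Fgen s y y' : F s.+1 (y, y') <=
    \int[K (i + s)%N y]_z \int[K (i + s)%N y']_z' F s (z, z').
  rewrite {1}/F ge_max; apply/andP; split.
    by apply: Rint_ge0 => z; apply: Rint_ge0.
  by rewrite HS; apply: dint_le.
have Fcpl s y y' : kap (i + s)%N -> C y -> C y' -> F s.+1 (y, y') <=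
    expR (- th) *
    \int[K (i + s)%N y]_z \int[K (i + s)%N y']_z' (psi C th (z, z') * F s (z, z')).
  move=> kk Cy Cy'; rewrite -[X in _ * X]/(dint (K (i + s)%N y) (K (i + s)%N y')
    (fun p => psi C th p * F s p)).
  have bpF : bm (fun p => psi C th p * F s p) by apply: bm_mul => //; exact: psi_bm.
  rewrite -dintZ// {1}/F ge_max; apply/andP; split.
    apply: dint_ge0 => p; rewrite mulr_ge0 ?expR_ge0// mulr_ge0//.
    by rewrite /psi; case: ifP => // _; exact: expR_ge0.
  have -> : H s.+1 (y, y') =
      dint (K (i + s)%N y) (K (i + s)%N y') (fun p => CC p * H s p) +
      dint (K (i + s)%N y) (K (i + s)%N y') (fun p => (1 - CC p) * H s p).
    rewrite -dintD; try by apply: bm_mul => //; apply: bm_sub.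
    by rewrite HS; congr dint; apply/funext => p; rewrite -mulrDl addrC subrK mul1r.
  have [mu [phi [phi0 kmu]]] := hD kk.
  have b1C : bm (fun p => 1 - CC p) by exact: bm_sub.
  have cu : bm (fun z => \1_C z * u s z) by exact: bm_mul.
  have cv : bm (fun z => \1_C z * v s z) by exact: bm_mul.
  have h : dint (K (i + s)%N y) (K (i + s)%N y') (fun p => CC p * H s p) <= 0.
    have -> : (fun p => CC p * H s p) = (fun p : X * X =>
       e ^+ 2 * ((\1_C p.1 * u s p.1) * (\1_C p.2 * v s p.2)) -
       (\1_C p.1 * v s p.1) * (\1_C p.2 * u s p.2)).
      by apply/funext => p; rewrite /CC /H; ring.
    have t1 : bm (fun p : X * X => (\1_C p.1 * u s p.1) * (\1_C p.2 * v s p.2)).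
      exact: (bm_tensor cu cv).
    have t2 : bm (fun p : X * X => (\1_C p.1 * v s p.1) * (\1_C p.2 * u s p.2)).
      exact: (bm_tensor cv cu).
    rewrite dintB//; last by apply: bm_mul.
    rewrite dintZ// (dint_prod _ _ cu cv) (dint_prod _ _ cv cu) subr_le0.
    exact: (doeblin_swap e01 mC phi0 kmu Cy Cy' (bu s) (bv s)).
  apply: (le_trans (lerD h (lexx _))); rewrite add0r.
  apply: dint_le => [||p]; [exact: bm_mul|exact: bm_mul|].
  rewrite mulrA psiE; apply: (@le_trans _ _ ((1 - CC p) * F s p)).
    by rewrite ler_wpM2l// subr_ge0.
  by rewrite ler_wpM2r// lerDr mulr_ge0 ?expR_ge0.
have bone : bm (fun _ : X => 1 : R) by [].
have := pair_growth mK Ka mC bF F0 B0 th0 bone (fun=> ler01) Finit Fgen Fcpl t x x'.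
have gb y : gam K kap C (expR (th *+ 2)) i t (fun=> 1) y <= expR (asum a i t).
  rewrite -[leRHS]mul1r.
  by apply: (gam_bound mK Ka a_ge0 mC) => //; rewrite mulrn_wge0.
have g0 y : 0 <= gam K kap C (expR (th *+ 2)) i t (fun=> 1) y.
  by apply: gam_ge0 => //; rewrite -expR0 ler_expR mulrn_wge0.
move=> hF; rewrite -lerBlDl.
apply: (@le_trans _ _ (F t (x, x'))); first exact: (HF t (x, x')).
apply: (@le_trans _ _ (psi C th (x, x') * F t (x, x'))).
  by rewrite ler_peMl//; exact: psi_ge1.
apply: (le_trans hF); rewrite [expR (_ + asum _ _ _ *+ 2)]expRD [leRHS]mulrA.
apply: ler_wpM2l; first by apply: mulr_ge0 => //; exact: expR_ge0.
by rewrite [asum a i t *+ 2]mulr2n [leRHS]expRD; apply: ler_pM.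
Qed.

(** [pair_growth] applied to the absolute value of the antisymmetric function
    [u x * v x' - v x * u x']. *)
Lemma contraction_bound (th B : R) i t f1 f2 f : 0 <= th ->
  1 - e ^+ 2 <= expR (- th) -> 0 <= B ->
  bm f1 -> bm f2 -> bm f -> (forall x, 0 <= f x) ->
  (forall x x', `|f1 x * f2 x' - f2 x * f1 x'| <= B * (f x * f x')) ->
  forall x x', `|W K i t f1 x * W K i t f2 x' - W K i t f2 x * W K i t f1 x'| <=
    B * expR (th - th * (2 * ksum kap i t - t%:R)) *
    (gam K kap C (expR (th *+ 2)) i t f x * gam K kap C (expR (th *+ 2)) i t f x').
Proof.
move=> th0 hth B0 b1 b2 bf f0 hB x x'.
pose u t := W K i t f1; pose v t := W K i t f2.
have bu s : bm (u s) by exact: (W_bm mK Ka).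
have bv s : bm (v s) by exact: (W_bm mK Ka).
pose H s (p : X * X) := u s p.1 * v s p.2 - v s p.1 * u s p.2.
have bH s : bm (H s) by apply: bm_sub; exact: bm_tensor.
pose F s p := `|H s p|.
have bF s : bm (F s) by exact: bm_abs.
have F0 s p : 0 <= F s p by exact: normr_ge0.
have HS s y y' : H s.+1 (y, y') = dint (K (i + s)%N y) (K (i + s)%N y') (H s).
  by rewrite /H dintB ?dint_prod//; exact: bm_tensor.
have Finit p : F 0%N p <= B * (f p.1 * f p.2) by exact: hB.
have Fgen s y y' : F s.+1 (y, y') <=
    \int[K (i + s)%N y]_z \int[K (i + s)%N y']_z' F s (z, z').
  by rewrite {1}/F HS; exact: dint_norm.
have Fcpl s y y' : kap (i + s)%N -> C y -> C y' -> F s.+1 (y, y') <=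
    expR (- th) *
    \int[K (i + s)%N y]_z \int[K (i + s)%N y']_z' (psi C th (z, z') * F s (z, z')).
  move=> kk Cy Cy'; rewrite -[X in _ * X]/(dint (K (i + s)%N y) (K (i + s)%N y')
    (fun p => psi C th p * F s p)).
  have bpF : bm (fun p => psi C th p * F s p) by apply: bm_mul => //; exact: psi_bm.
  have b1C : bm (fun p => 1 - CC p) by exact: bm_sub.
  have bCF : bm (fun p => CC p * F s p) by exact: bm_mul.
  have b1F : bm (fun p => (1 - CC p) * F s p) by exact: bm_mul.
  have b1H : bm (fun p => (1 - CC p) * H s p) by exact: bm_mul.
  have bCH : bm (fun p => CC p * H s p) by exact: bm_mul.
  rewrite -dintZ//.
  have -> : (fun p => expR (- th) * (psi C th p * F s p)) =
     (fun p => expR (- th) * (CC p * F s p) + (1 - CC p) * F s p).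
    by apply/funext => p; rewrite mulrA psiE; ring.
  rewrite dintD//; last exact: bm_mul.
  rewrite dintZ// {1}/F HS.
  have -> : dint (K (i + s)%N y) (K (i + s)%N y') (H s) =
      dint (K (i + s)%N y) (K (i + s)%N y') (fun p => CC p * H s p) +
      dint (K (i + s)%N y) (K (i + s)%N y') (fun p => (1 - CC p) * H s p).
    rewrite -dintD//.
    by congr dint; apply/funext => p; rewrite -mulrDl addrC subrK mul1r.
  apply: (le_trans (ler_normD _ _)); apply: lerD.
    have [mu [phi [phi0 kmu]]] := hD kk.
    apply: (doeblin_contract e01 mC phi0 kmu Cy Cy' (bH s)) => // z z'.
    by rewrite /H /=; ring.
  apply: (le_trans (dint_norm _ _ b1H)); apply: dint_le => [||p]; [exact: bm_abs|exact: b1F|].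
  by rewrite normrM ger0_norm// subr_ge0.
have hF := pair_growth mK Ka mC bF F0 B0 th0 bf f0 Finit Fgen Fcpl t x x'.
apply: le_trans hF; rewrite -[leLHS]/(F t (x, x')).
by rewrite ler_peMl//; exact: psi_ge1.
Qed.

End pair_bounds.

(** * Forgetting along one trajectory *)

Lemma sub_split j t J : (j + t <= J)%N -> (J - j = t + (J - (j + t)))%N.
Proof. lia. Qed.

Lemma sub_decr j T J n : (10 <= T)%N -> (j + T <= J)%N -> (J - j < n.+1)%N ->
  (J - (j + T) < n)%N.
Proof. lia. Qed.

Lemma sub_short j T J : (j <= J)%N -> (J < j + T)%N ->
  (J - j <= T)%N /\ (j + (J - j) <= j + T)%N.
Proof. lia. Qed.

Section deterministic.
Context {d} {X : measurableType d} {R : realType}.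
Variables (K : nat -> X -> {finite_measure set X -> \bar R}) (a dd : nat -> R).
Variables (kap : nat -> bool) (C D : set X) (e th0 : R) (x0 : X).
Hypothesis mK :
  forall i A, measurable A -> measurable_fun [set: X] (K i ^~ A).
Hypothesis Ka : forall i x, (K i x setT <= (expR (a i))%:E)%E.
Hypothesis a_ge0 : forall i, 0 <= a i.
Hypothesis d_ge0 : forall i, 0 <= dd i.
Hypothesis mC : measurable C.
Hypothesis mD : measurable D.
Hypothesis Dx0 : D x0.
Hypothesis e01 : 0 < e <= 1.
Hypothesis hD : forall i, kap i -> doeblin e C (K i).
Hypothesis hout : forall j x, kap j -> x \notin C ->
  (K j x setT <= (expR (- (th0 *+ 2)))%:E)%E.
Hypothesis Kd : forall i x, D x -> ((expR (- dd i))%:E <= K i x D)%E.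

Variables (E delta c : R) (n0 q2 : nat).
Hypotheses (E0 : 0 <= E) (delta0 : 0 <= delta) (c0 : 0 <= c).
Hypothesis q2_gt0 : (0 < q2)%N.
Hypothesis n0_ge10 : (10 <= n0)%N.
Hypothesis hn0c : 100 * c <= n0%:R.
Hypothesis hn0e : expR (- n0%:R) <= e ^+ 2 / 2.
Hypothesis hdelta : 100 * delta * (q2%:R + 1) <= 1.
Hypothesis hth0 : 70 * E + 110 <= th0.
Hypothesis hS : forall i t,
  asum a i t + asum dd i t <= E * t%:R + delta * (i + t)%:R + c.
Hypothesis hk : forall i t,
  5 / 8 * t%:R - delta * (i + t)%:R - c <= ksum kap i t.

Let th00 : 0 <= th0.
Proof. by apply: le_trans hth0; apply: addr_ge0 => //; apply: mulr_ge0. Qed.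

(** The length of the window that is used at stage [j]. It is long enough for
    the frequency of good blocks to be effective in the window despite the error
    [delta * (i + t) + c], and [q2] is chosen so large that a factor
    exponential in [lag j] is negligible with respect to the gain in [j]. *)
Definition lag j : nat := (j %/ q2 + n0)%N.

Lemma lag_ge j : (j <= q2 * lag j)%N.
Proof.
rewrite /lag mulnDr (leq_trans (ltnW (ltn_ceil j q2_gt0)))//.
rewrite mulSn mulnC addnC leq_add2l.
by rewrite -[leqLHS]muln1 leq_mul2l (leq_trans _ n0_ge10)// orbT.
Qed.

Lemma lag_shift j : (lag (j + lag j) <= 3 * lag j)%N.
Proof.
have h1 := leq_divDl q2 j (lag j).
have h2 := leq_div (lag j) q2.
have h3 : (j %/ q2 + n0 = lag j)%N by [].
rewrite -[leqLHS]/((j + lag j) %/ q2 + n0)%N.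
move: (lag j) (_ %/ _)%N (_ %/ _)%N (_ %/ _)%N h1 h2 h3 n0_ge10 => l u v w.
by clear; lia.
Qed.

Lemma lag_mono i j : (i <= j)%N -> (lag i <= lag j)%N.
Proof. by move=> ij; rewrite /lag leq_add2r leq_div2r. Qed.

Lemma lag_ge10 j : (10 <= lag j)%N.
Proof. by rewrite /lag (leq_trans n0_ge10)// leq_addl. Qed.

Lemma lag_gen0 j : (n0 <= lag j)%N. Proof. exact: leq_addl. Qed.

Let Tr j : R := (lag j)%:R.

Lemma asum_ge0 (b : nat -> R) i t : (forall l, 0 <= b l) -> 0 <= asum b i t.
Proof. by move=> b0; apply: sumr_ge0. Qed.

Lemma window_err i t j : (i + t <= j + lag j)%N ->
  delta * (i + t)%:R + c <= Tr j / 50.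
Proof.
move=> h.
have h1 : (i + t)%:R <= (q2%:R + 1) * Tr j.
  rewrite /Tr -[1]/(1%:R) -natrD -natrM ler_nat mulnDl mul1n.
  by rewrite (leq_trans h)// leq_add2r lag_ge.
have h2 : delta * (i + t)%:R <= delta * ((q2%:R + 1) * Tr j) by rewrite ler_wpM2l.
have T0 : 0 <= Tr j by exact: ler0n.
have h3 : 100 * (delta * ((q2%:R + 1) * Tr j)) <= Tr j.
  have := ler_wpM2r T0 hdelta; rewrite mul1r.
  by have -> : 100 * delta * (q2%:R + 1) * Tr j =
     100 * (delta * ((q2%:R + 1) * Tr j)) by ring.
have h4 : n0%:R <= Tr j by rewrite ler_nat lag_gen0.
have h5 := hn0c; lra.
Qed.

Lemma window_sum i t j : (t <= lag j)%N -> (i + t <= j + lag j)%N ->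
  asum a i t + asum dd i t <= (E + 1) * Tr j.
Proof.
move=> tj h; apply: (le_trans (hS i t)).
have h1 := window_err h.
have h2 : E * t%:R <= E * Tr j by rewrite ler_wpM2l// ler_nat.
have T0 : 0 <= Tr j by exact: ler0n.
lra.
Qed.

(** The error term of [swap_bound]: the mass of the pairs of paths that are
    not coupled in a window. *)
Definition unc i t := expR (th0 - th0 * (2 * ksum kap i t - t%:R) + asum a i t *+ 2).

(** The good blocks are at least a fraction 5/8 of the window up to the error,
    so that [2 * ksum - t] is at least [t / 5]; this wins against the masses of
    the kernels since [th0] is large. *)
Lemma unc_le i j : (i + lag j <= j + lag j)%N ->
  unc i (lag j) <= expR ((- (th0 / 10) + 2 * (E + 1)) * Tr j).
Proof.
move=> h; rewrite ler_expR.
have h1 := window_err h; have h2 := hk i (lag j).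
have h3 := window_sum (leqnn _) h.
have h4 := asum_ge0 i (lag j) d_ge0.
have T0 : 10 <= Tr j by rewrite /Tr ler_nat lag_ge10.
have h0 := th00.
set k := ksum _ _ _ in h2 *; rewrite -/(Tr j) in h2 *.
have h5 : Tr j / 5 <= 2 * k - Tr j by lra.
have h6 : th0 * (Tr j / 5) <= th0 * (2 * k - Tr j) by rewrite ler_wpM2l.
have h7 : th0 * 10 <= th0 * Tr j by rewrite ler_wpM2l.
rewrite mulr2n; lra.
Qed.

Let bD : bm (\1_D : X -> R). Proof. exact: bm_indic. Qed.
Let D01 (x : X) : 0 <= (\1_D x : R) <= 1.
Proof. by rewrite indicE; case: (_ \in _); rewrite /= lexx ler01. Qed.
Let bone : bm (fun _ : X => 1 : R). Proof. by []. Qed.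

(** One step returns to [D] with mass [expR (- dd i)], so that staying in [D]
    during the whole window gives a lower bound. *)
Lemma W_lower i t (f : X -> R) b : bm f -> 0 <= b ->
  (forall x, b * \1_D x <= f x) ->
  forall x, b * expR (- asum dd i t) * \1_D x <= W K i t f x.
Proof.
move=> bf b0 hf; have f0 x : 0 <= f x.
  by apply: le_trans (hf x); rewrite mulr_ge0//; case/andP: (D01 x).
elim: t => [|t IH] x; first by rewrite asum0 oppr0 expR0 mulr1; exact: hf.
rewrite indicE; case: (boolP (x \in D)) => [|_]; last first.
  by rewrite mulr0; apply: Rint_ge0 => y; exact: W_ge0.
rewrite inE => Dx; rewrite mulr1 /=.
apply: (@le_trans _ _ (\int[K (i + t)%N x]_y (b * expR (- asum dd i t) * \1_D y))); last first.
  by apply: bm_Rint_le => //; [exact: bm_mul|exact: (W_bm mK Ka)].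
rewrite bm_RintZ// asumS opprD expRD mulrA ler_wpM2l ?mulr_ge0 ?expR_ge0//.
rewrite -lee_fin Rint_EFin// integral_indic// setIT; exact: Kd.
Qed.

Section initial.
Variables (m : {finite_measure set X -> \bar R}) (J : nat).
Hypothesis minit : \int[m]_x 1 <= expR c * \int[m]_x (\1_D x).
Hypothesis mpos : 0 < \int[m]_x (\1_D x : R).

(** With [m] the initial law at the first of [J] blocks, this is the
    unnormalized predictor before the last [j] blocks, applied to [f]. *)
Definition mint j f := \int[m]_x W K j (J - j) f x.

Lemma mint_le j f g : bm f -> bm g -> (forall x, f x <= g x) -> mint j f <= mint j g.
Proof.
move=> bf bg fg; apply: bm_Rint_le; try exact: (W_bm mK Ka).
exact: (W_le mK Ka).
Qed.

Lemma mint_ge0 j f : (forall x, 0 <= f x) -> 0 <= mint j f.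
Proof. by move=> f0; apply: Rint_ge0 => x; exact: W_ge0. Qed.

Lemma mintZ j r f : bm f -> mint j (fun x => r * f x) = r * mint j f.
Proof.
move=> bf; rewrite /mint -bm_RintZ; last exact: (W_bm mK Ka).
by congr Rintegral; apply/funext => x; exact: (W_scale mK Ka).
Qed.

Lemma mintZr j r f : bm f -> mint j (fun x => f x * r) = mint j f * r.
Proof. by move=> bf; under eq_fun do rewrite mulrC; rewrite mintZ// mulrC. Qed.

Lemma mintD j f g : bm f -> bm g ->
  mint j (fun x => f x + g x) = mint j f + mint j g.
Proof.
move=> bf bg; rewrite /mint -bm_RintD; try exact: (W_bm mK Ka).
by congr Rintegral; apply/funext => x; exact: (W_add mK Ka).
Qed.

Lemma mintB j f g : bm f -> bm g ->
  mint j (fun x => f x - g x) = mint j f - mint j g.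
Proof.
move=> bf bg; rewrite /mint -bm_RintB; try exact: (W_bm mK Ka).
by congr Rintegral; apply/funext => x; exact: (W_sub mK Ka).
Qed.

Lemma mint_cst j r : mint j (fun=> r) = r * mint j (fun=> 1).
Proof. by rewrite -mintZ//; congr mint; apply/funext => x; rewrite mulr1. Qed.

Lemma mint_W j t f : (j + t <= J)%N -> mint j f = mint (j + t) (W K j t f).
Proof.
move=> jtJ; rewrite /mint; rewrite (sub_split jtJ).
by rewrite W_comp.
Qed.

Lemma mint_norm j f : bm f -> `|mint j f| <= mint j (fun x => `|f x|).
Proof.
move=> bf; have ba := bm_abs bf.
rewrite ler_norml; apply/andP; split; last by apply: mint_le => // x; exact: ler_norm.
rewrite -mulN1r -mintZ//; apply: mint_le => //; first exact: bm_mul.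
by move=> x; rewrite mulN1r lerNl ler_normr lexx orbT.
Qed.

Lemma mint_lower j t f b : (j + t <= J)%N -> bm f -> 0 <= b ->
  (forall x, b * \1_D x <= f x) ->
  b * expR (- asum dd j t) * mint (j + t) \1_D <= mint j f.
Proof.
move=> jtJ bf b0 hf; rewrite (mint_W f jtJ) -mintZ//.
apply: mint_le; [exact: bm_mul|exact: (W_bm mK Ka)|].
exact: W_lower.
Qed.

Lemma mintJ f : mint J f = \int[m]_x f x. Proof. by rewrite /mint subnn. Qed.

Lemma mint_D_gt0 j : (j <= J)%N -> 0 < mint j \1_D.
Proof.
move=> jJ.
have jtJ : (j + (J - j) <= J)%N by rewrite subnKC.
have := @mint_lower j (J - j) \1_D 1 jtJ bD ler01.
rewrite subnKC// mintJ mul1r => H.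
by apply: lt_le_trans (H _); [rewrite mulr_gt0 ?expR_gt0|move=> x; rewrite mul1r].
Qed.

Lemma mint_1_gt0 j : (j <= J)%N -> 0 < mint j (fun=> 1).
Proof.
move=> jJ; apply: (lt_le_trans (mint_D_gt0 jJ)); by apply: mint_le => // x; case/andP: (D01 x).
Qed.

Lemma half_arith (p s u v : R) : 0 <= p -> 0 <= s ->
  s * p <= u + v * p -> v <= s / 2 -> s / 2 * p <= u.
Proof. by move=> p0 s0 h hv; have := ler_wpM2r p0 hv; lra. Qed.

(** Strong induction on the number of blocks before stage [j]. By [swap_bound]
    from the point [x0] of [D], the ratio of the mass of [D] to the total mass
    is, up to a factor, at least what it is for the chain started [lag j] blocks
    earlier at [x0], except for the mass of uncoupled pairs. The latter is
    compared with the total mass through the induction hypothesis, at the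
    earlier stage [j + lag j], whose window is at most three times longer. When
    fewer than [lag j] blocks are left, the bounds on the initial law are
    used. *)
Lemma mass_D j : (j <= J)%N ->
  mint j (fun=> 1) <= expR ((E + 2) * Tr j) * mint j \1_D.
Proof.
have [n hn] := ubnP (J - j); elim: n j hn => // n IH j hn jJ.
have P0 := mint_1_gt0 jJ; have Pd0 := mint_D_gt0 jJ.
have hE0 := E0; have hc0 := c0; have hnc := hn0c.
have T0 : 10 <= Tr j by rewrite /Tr ler_nat lag_ge10.
(* Either the window reaches the initial law, or the induction hypothesis
   applies at the other end of the window. *)
have [hJ|hJ] := ltnP J (j + lag j).
  have jtJ : (j + (J - j) <= J)%N by rewrite subnKC.
  have hs : asum a j (J - j) + asum dd j (J - j) <= (E + 1) * Tr j.
    by have [? ?] := sub_short jJ hJ; exact: window_sum.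
  have l := @mint_lower j (J - j) \1_D 1 jtJ bD ler01.
  rewrite subnKC// mintJ mul1r in l.
  have {}l : expR (- asum dd j (J - j)) * \int[m]_x (\1_D x) <= mint j \1_D.
    by apply: l => x; rewrite mul1r.
  have u : mint j (fun=> 1) <= expR (asum a j (J - j)) * \int[m]_x 1.
    rewrite (mint_W _ jtJ) subnKC// mintJ -bm_RintZ//.
    apply: bm_Rint_le; [exact: (W_bm mK Ka)|exact: bm_mul|].
    by move=> x; rewrite mulr1; exact: (W_one mK Ka).
  apply: (le_trans u).
  apply: (@le_trans _ _ (expR (asum a j (J - j)) *
      (expR c * (expR (asum dd j (J - j)) * mint j \1_D)))).
    rewrite ler_wpM2l ?expR_ge0// (le_trans minit)// ler_wpM2l ?expR_ge0//.
    rewrite -ler_pdivrMl ?expR_gt0//.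
    by rewrite -expRN.
  rewrite !mulrA -!expRD ler_wpM2r ?(ltW Pd0)// ler_expR.
  have : n0%:R <= Tr j by rewrite /Tr ler_nat lag_gen0.
  lra.
have IHj : mint (j + lag j) (fun=> 1) <=
    expR ((E + 2) * Tr (j + lag j)) * mint (j + lag j) \1_D.
  by apply: IH => //; exact: (sub_decr (lag_ge10 j)).
set T := lag j in hJ IHj *; set j' := (j + T)%N in hJ IHj *.
(* The exponent lost at the earlier stage is three times that of the window,
   which [th0 >= 70 * E + 110] dominates. *)
have T3 : Tr j' <= 3 * Tr j by rewrite /Tr -natrM ler_nat lag_shift.
have hs : asum a j T + asum dd j T <= (E + 1) * Tr j by exact: window_sum.
set as_ := asum a j T in hs *; set ds := asum dd j T in hs *.
have as0 : 0 <= as_ by exact: asum_ge0.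
have ds0 : 0 <= ds by exact: asum_ge0.
have e20 : 0 <= e ^+ 2 by rewrite exprn_ge0// ltW//; case/andP: e01.
set w := W K j T \1_D x0.
have wl : expR (- ds) <= w.
  have := @W_lower j T \1_D 1 bD ler01 _ x0; rewrite mul1r indicE mem_set// mulr1.
  by apply => x; rewrite mul1r.
have w1u : W K j T (fun=> 1) x0 <= expR as_ by exact: (W_one mK Ka).
have sw x : e ^+ 2 * (W K j T (fun=> 1) x * w) <=
   W K j T \1_D x * expR as_ + unc j T.
  have := @swap_bound _ _ _ K a kap C mK Ka a_ge0 mC e e01 hD th0 1 1 j T
    (fun=> 1) \1_D th00 bone bD _ D01 hout x x0.
  rewrite !mul1r => H; apply: (le_trans (H _)); first by move=> ?; rewrite ler01 lexx.
  rewrite lerD2r ler_wpM2l//; apply: W_ge0 => y; by case/andP: (D01 y).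
have sw2 : e ^+ 2 * w * mint j (fun=> 1) <=
    mint j \1_D * expR as_ + unc j T * mint j' (fun=> 1).
  rewrite !(mint_W _ hJ) -mintZ; last exact: (W_bm mK Ka).
  rewrite -mintZr; last exact: (W_bm mK Ka).
  rewrite -[unc j T * _]mint_cst -mintD//; last first.
    by apply: bm_mul => //; exact: (W_bm mK Ka).
  apply: mint_le; [apply: bm_mul => //; exact: (W_bm mK Ka)| |].
    by apply: bm_add => //; apply: bm_mul => //; exact: (W_bm mK Ka).
  by move=> x; rewrite -mulrA [w * _]mulrC; exact: sw.
have P' : mint j' (fun=> 1) <= expR ((E + 2) * (3 * Tr j) + ds) * mint j (fun=> 1).
  apply: (le_trans IHj).
  have l := @mint_lower j T (fun=> 1) 1 hJ bone ler01.
  have {}l : expR (- ds) * mint j' \1_D <= mint j (fun=> 1).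
    rewrite -[expR _]mul1r; apply: l => x; rewrite mul1r; by case/andP: (D01 x).
  apply: (@le_trans _ _ (expR ((E + 2) * (3 * Tr j)) * mint j' \1_D)).
    rewrite ler_wpM2r ?(ltW (mint_D_gt0 hJ))// ler_expR ler_wpM2l//; lra.
  rewrite expRD -mulrA ler_wpM2l ?expR_ge0// -ler_pdivrMl ?expR_gt0//.
  by rewrite -expRN.
have U := unc_le (leqnn (j + lag j)); rewrite -/T in U.
have hn0T : n0%:R <= Tr j by rewrite /Tr ler_nat lag_gen0.
have eT : expR (- Tr j) <= e ^+ 2 / 2.
  by apply: le_trans hn0e; rewrite ler_expR; lra.
have main : e ^+ 2 * expR (- ds) / 2 * mint j (fun=> 1) <= mint j \1_D * expR as_.
  apply: (@half_arith _ _ _ (expR ((- (th0 / 10) + 2 * (E + 1)) * Tr j) *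
     expR ((E + 2) * (3 * Tr j) + ds))); [exact: ltW|by rewrite mulr_ge0 ?expR_ge0| |].
    apply: (@le_trans _ _ (e ^+ 2 * w * mint j (fun=> 1))).
      by rewrite ler_wpM2r ?(ltW P0)// ler_wpM2l.
    apply: (le_trans sw2); rewrite lerD2l -mulrA.
    by apply: ler_pM => //; [exact: expR_ge0|exact: mint_ge0].
  have -> : e ^+ 2 * expR (- ds) / 2 = e ^+ 2 / 2 * expR (- ds) by ring.
  apply: (@le_trans _ _ (expR (- Tr j) * expR (- ds))); last first.
    by rewrite ler_wpM2r// expR_ge0.
  rewrite -!expRD ler_expR.
  have : th0 * Tr j >= (70 * E + 110) * Tr j by rewrite ler_wpM2r// ler0n.
  by lra.
have eT' : expR (- Tr j) * expR (- ds) * mint j (fun=> 1) <= mint j \1_D * expR as_.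
  apply: le_trans main; rewrite ler_wpM2r ?(ltW P0)//.
  by rewrite [leRHS]mulrAC ler_wpM2r ?expR_ge0.
have eT'' : expR (- (as_ + Tr j + ds)) * mint j (fun=> 1) <= mint j \1_D.
  rewrite -(@ler_pM2r _ (expR as_)) ?expR_gt0//; apply: le_trans eT'.
  by rewrite mulrAC -!expRD le_eqVlt; apply/orP; left; apply/eqP; congr (expR _ * _); ring.
apply: (@le_trans _ _ (expR (as_ + Tr j + ds) *
   (expR (- (as_ + Tr j + ds)) * mint j (fun=> 1)))).
  by rewrite mulrA -expRD subrr expR0 mul1r.
apply: ler_pM => //; rewrite ?expR_ge0 ?mulr_ge0 ?expR_ge0 ?(ltW P0)//.
by rewrite ler_expR; lra.
Qed.

Section terminal.
Variable f : X -> R.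
Hypothesis bf : bm f.
Hypothesis f0c : forall x, 0 <= f x <= expR c.
Hypothesis fD : forall x, expR (- c) * \1_D x <= f x.

Let f0 x : 0 <= f x. Proof. by case/andP: (f0c x). Qed.

Lemma mint0_lower j : (j <= J)%N ->
  mint j (fun=> 1) <= expR ((E + 2) * Tr j + asum dd 0 j + c) * mint 0 f.
Proof.
move=> jJ.
have l := @mint_lower 0 j f (expR (- c)) jJ bf (expR_ge0 _) fD.
rewrite add0n in l; apply: (le_trans (mass_D jJ)).
apply: (@le_trans _ _ (expR ((E + 2) * Tr j) * (expR (asum dd 0 j + c) *
   (expR (- c) * expR (- asum dd 0 j) * mint j \1_D)))).
  rewrite -expRD mulrA -!expRD mulrA -expRD.
  by rewrite (_ : _ + _ + _ = (E + 2) * Tr j)//; ring.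
rewrite -[X in expR X * mint 0 f]addrA [in leRHS](expRD ((E + 2) * Tr j)) -[leRHS]mulrA.
by do 2 (apply: ler_wpM2l; first exact: expR_ge0).
Qed.

Lemma mint0_gt0 : 0 < mint 0 f.
Proof.
have := mint0_lower (leq0n J); have := mint_1_gt0 (leq0n J).
move=> h1 h2; have := lt_le_trans h1 h2.
by rewrite pmulr_rgt0// expR_gt0.
Qed.

(** The same argument in the other direction of time, by strong induction on
    [j]: [swap_bound] over the window of length [lag j] compares the starting
    point [x] with the points charged by the predictor, and the induction
    hypothesis bounds the uncoupled part. When [j] is at most [lag j], the crude
    bounds suffice. *)
Lemma ratio_bound j : (j <= J)%N -> forall x,
  W K 0 j f x * mint j (fun=> 1) <= expR ((2 * E + 4) * Tr j) * mint 0 f.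
Proof.
have [n hn] := ubnP j; elim: n j hn => // n IH j hn jJ x.
have P0 := mint_1_gt0 jJ; have F0 := mint0_gt0.
have hE0 := E0; have hc0 := c0; have hnc := hn0c; have hth := hth0.
have T0 : 10 <= Tr j by rewrite /Tr ler_nat lag_ge10.
have hn0T : n0%:R <= Tr j by rewrite /Tr ler_nat lag_gen0.
have e20 : 0 <= e ^+ 2 by rewrite exprn_ge0// ltW//; case/andP: e01.
have W0 : 0 <= W K 0 j f x by exact: W_ge0.
have [jT|Tj] := leqP j (lag j).
  have hs : asum a 0 j + asum dd 0 j <= (E + 1) * Tr j.
    by apply: window_sum => //; rewrite add0n leq_addr.
  have u : W K 0 j f x <= expR c * expR (asum a 0 j).
    by apply: (W_bound mK Ka) => // y; case/andP: (f0c y).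
  apply: (@le_trans _ _ (expR c * expR (asum a 0 j) *
     (expR ((E + 2) * Tr j + asum dd 0 j + c) * mint 0 f))).
    by apply: ler_pM => //; [exact: ltW|exact: mint0_lower].
  rewrite mulrA -!expRD ler_wpM2r ?(ltW F0)// ler_expR.
  lra.
set T := lag j in Tj *; set i := (j - T)%N.
have ij : (i + T = j)%N by rewrite /i subnK// ltnW.
have iJ : (i <= J)%N by rewrite (leq_trans _ jJ)// leq_subr.
have iTJ : (i + T <= J)%N by rewrite ij.
have M0 := mint_1_gt0 iJ.
have hs : asum a i T + asum dd i T <= (E + 1) * Tr j.
  by apply: window_sum => //; rewrite ij leq_addr.
set as_ := asum a i T in hs *; set ds := asum dd i T in hs *.
have as0 : 0 <= as_ by exact: asum_ge0.
have ds0 : 0 <= ds by exact: asum_ge0.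
pose g := W K 0 i f.
have bg : bm g by exact: (W_bm mK Ka).
have g0 y : 0 <= g y by exact: W_ge0.
have Wg y : W K 0 j f y = W K i T g y.
  by rewrite -ij addnC -[X in W K 0 X f]addnC W_comp add0n.
pose B1 := expR ((2 * E + 4) * Tr j) * mint 0 f / mint i (fun=> 1).
have B10 : 0 <= B1 by rewrite /B1 divr_ge0 ?mulr_ge0 ?expR_ge0 ?(ltW F0) ?(ltW M0).
have gB y : 0 <= g y <= B1.
  rewrite g0/= /B1 ler_pdivlMr//.
  have iltn : (i < n)%N.
    rewrite -ltnS; apply: leq_trans hn; rewrite ltnS -ij -addn1 leq_add2l.
    by rewrite (leq_trans _ (lag_ge10 j)).
  apply: (le_trans (IH i iltn iJ y)); rewrite ler_wpM2r ?(ltW F0)// ler_expR.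
  by rewrite ler_wpM2l ?ler_nat ?lag_mono// ?leq_subr//; lra.
have sw x' : e ^+ 2 * (W K i T g x * W K i T (fun=> 1) x') <=
   W K i T (fun=> 1) x * W K i T g x' + B1 * unc i T.
  have := @swap_bound _ _ _ K a kap C mK Ka a_ge0 mC e e01 hD th0 B1 1 i T
    g (fun=> 1) th00 bg bone gB _ hout x x'.
  by rewrite mulr1; apply => y; rewrite ler01 lexx.
have sw2 : e ^+ 2 * W K i T g x * mint i (fun=> 1) <=
    expR as_ * mint 0 f + B1 * unc i T * mint j (fun=> 1).
  rewrite (mint_W (fun=> 1) iTJ) (@mint_W 0 j f)// add0n ij.
  rewrite -mintZ; last exact: (W_bm mK Ka).
  rewrite -mintZ; last exact: (W_bm mK Ka).
  rewrite -[B1 * _ * _]mint_cst -mintD//; last first.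
    by apply: bm_mul => //; exact: (W_bm mK Ka).
  apply: mint_le; [apply: bm_mul => //; exact: (W_bm mK Ka)| |].
    by apply: bm_add => //; apply: bm_mul => //; exact: (W_bm mK Ka).
  move=> x'; rewrite -mulrA Wg; apply: (le_trans (sw x')); rewrite lerD2r.
  by rewrite ler_wpM2r ?W_ge0//; exact: (W_one mK Ka).
have r1 : mint j (fun=> 1) <= expR ((E + 2) * Tr j + ds) * mint i (fun=> 1).
  have l := @mint_lower i T (fun=> 1) 1 iTJ bone ler01.
  have {}l : expR (- ds) * mint j \1_D <= mint i (fun=> 1).
    rewrite -[expR _]mul1r -ij; apply: l => y; rewrite mul1r; by case/andP: (D01 y).
  apply: (le_trans (mass_D jJ)).
  rewrite expRD -mulrA ler_wpM2l ?expR_ge0// -ler_pdivrMl ?expR_gt0//.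
  by rewrite -expRN.
have U : unc i T <= expR ((- (th0 / 10) + 2 * (E + 1)) * Tr j).
  by apply: unc_le; rewrite ij leq_addr.
have eT : expR (- Tr j) <= e ^+ 2 / 2.
  by apply: le_trans hn0e; rewrite ler_expR; lra.
set w := W K i T g x in sw2 *; rewrite Wg -/w in W0 *.
have B1E : B1 = expR ((2 * E + 4) * Tr j) * mint 0 f / mint i (fun=> 1) by [].
clearbody B1 w; clear gB B10.
set Mi := mint i (fun=> 1) in M0 B1E sw2 r1 *; set Mj := mint j _ in P0 sw2 r1 *.
set Z := mint 0 f in F0 B1E sw2 *; clearbody Mi Mj Z.
set rr := expR ((E + 2) * Tr j + ds) in r1.
have key : e ^+ 2 * w * Mj <= expR as_ * Z * rr +
     expR ((2 * E + 4) * Tr j) * Z * unc i T * rr ^+ 2.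
  have k1 : Mj / Mi <= rr by rewrite ler_pdivrMr.
  have k0 : 0 <= Mj / Mi by rewrite divr_ge0 ?ltW.
  have -> : e ^+ 2 * w * Mj = (e ^+ 2 * w * Mi) * (Mj / Mi).
    by field; rewrite gt_eqF.
  apply: (le_trans (ler_wpM2r k0 sw2)); rewrite mulrDl; apply: lerD.
    by rewrite ler_wpM2l// mulr_ge0 ?expR_ge0// ltW.
  have -> : B1 * unc i T * Mj * (Mj / Mi) =
     (expR ((2 * E + 4) * Tr j) * Z * unc i T) * (Mj / Mi) ^+ 2.
    by rewrite B1E; field; rewrite gt_eqF.
  rewrite ler_wpM2l ?mulr_ge0 ?expR_ge0 ?(ltW F0)//.
  by rewrite ler_sqr// nnegrE// expR_ge0.
have Q0 : 0 <= expR ((2 * E + 4) * Tr j) * Z by rewrite mulr_ge0 ?expR_ge0// ltW.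
have k1 : expR as_ * Z * rr <= e ^+ 2 / 2 * (expR ((2 * E + 4) * Tr j) * Z).
  apply: (@le_trans _ _ (expR (- Tr j) * (expR ((2 * E + 4) * Tr j) * Z))).
    rewrite mulrAC /rr mulrA -!expRD ler_wpM2r ?(ltW F0)// ler_expR; lra.
  by rewrite ler_wpM2r.
have k2 : expR ((2 * E + 4) * Tr j) * Z * unc i T * rr ^+ 2 <=
    e ^+ 2 / 2 * (expR ((2 * E + 4) * Tr j) * Z).
  rewrite -mulrA mulrC ler_wpM2r//.
  apply: le_trans eT; apply: (le_trans (ler_wpM2r _ U)).
    by rewrite exprn_ge0// expR_ge0.
  rewrite /rr expr2 -!expRD ler_expR.
  have : th0 * Tr j >= (70 * E + 110) * Tr j by rewrite ler_wpM2r// ler0n.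
  lra.
have k3 : e ^+ 2 * (w * Mj) <= e ^+ 2 * (expR ((2 * E + 4) * Tr j) * Z).
  by rewrite mulrA; lra.
rewrite ler_pM2l// in k3; by rewrite exprn_gt0//; case/andP: e01.
Qed.

Variables (h : X -> R) (H vth : R).
Hypothesis bh : bm h.
Hypothesis H0 : 0 <= H.
Hypothesis hH : forall x, `|h x| <= H * f x.
Hypothesis vth01 : 0 <= vth <= 1.
Hypothesis hvth : 1 - e ^+ 2 <= expR (- vth).
Hypothesis hq2 : 16 * (2 * E + 4) <= vth * q2%:R.

(** [gam_interp] with the threshold [q = j / 64] of visits outside [C]: below
    it the weight is small, and above it the factor [expR (2 * (vth - th0) * q)]
    beats the masses of the kernels. *)
Lemma mint_gam_le j : (j <= J)%N ->
  mint j (gam K kap C (expR (vth *+ 2)) 0 j f) <=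
  expR (vth * j%:R / 32) * (1 + expR ((E + 3) * n0%:R)) * mint 0 f.
Proof.
move=> jJ; have M0 := mint0_gt0; have Mj := mint_1_gt0 jJ.
have hE0 := E0; have hc0 := c0; have hnc := hn0c; have hth := hth0.
have /andP[v0 v1] := vth01; have hd := hdelta; have hd0 := delta0.
pose q : R := j%:R / 64.
have vle : 0 <= vth *+ 2 <= th0 *+ 2 by rewrite !mulr2n; apply/andP; split; lra.
have s2 : 1 <= expR (th0 *+ 2) by rewrite -expR0 ler_expR mulrn_wge0.
have bW : bm (W K 0 j f) by exact: (W_bm mK Ka).
have bG : bm (gam K kap C (expR (th0 *+ 2)) 0 j f) by exact: (gam_bm kap mK Ka mC).
have gb x : gam K kap C (expR (th0 *+ 2)) 0 j f x <= expR c * expR (asum a 0 j).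
  by apply: (gam_bound mK Ka a_ge0 mC) => //; [rewrite mulrn_wge0|move=> y; case/andP: (f0c y)].
apply: (@le_trans _ _ (mint j (fun x => expR ((vth *+ 2) * q) * W K 0 j f x +
    expR ((vth *+ 2 - th0 *+ 2) * q) * (expR c * expR (asum a 0 j))))).
  apply: mint_le; [exact: (gam_bm kap mK Ka mC)| |].
    by apply: bm_add => //; exact: bm_mul.
  move=> x; apply: (le_trans (gam_interp kap mK Ka mC bf f0 0 j q x vle)).
  by rewrite lerD2l ler_wpM2l// expR_ge0.
rewrite mintD//; last exact: bm_mul.
rewrite mintZ// -[mint j (W _ _ _ _)]/(mint (0 + j) _) -mint_W//.
rewrite mint_cst.
have -> : vth *+ 2 * q = vth * j%:R / 32 by rewrite /q mulr2n; field.
rewrite [leRHS]mulrAC [leRHS]mulrDr mulr1 lerD2l -!expRD.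
apply: (le_trans (ler_wpM2l (expR_ge0 _) (mint0_lower jJ))).
rewrite mulrA [leRHS]mulrAC -!expRD ler_wpM2r ?(ltW M0)// ler_expR.
have hs := hS 0 j; rewrite add0n in hs.
have d1 : 100 * delta <= 1.
  apply: le_trans hd; rewrite ler_peMr//; first by rewrite mulr_ge0.
  by rewrite lerDr.
have j0 : 0 <= (j%:R : R) by exact: ler0n.
have dj : delta * j%:R <= j%:R by rewrite ler_piMl//; lra.
have Tj : Tr j <= j%:R + n0%:R.
  by rewrite /Tr /lag natrD lerD2r ler_nat leq_div.
have ETj : (E + 2) * Tr j <= (E + 2) * (j%:R + n0%:R) by rewrite ler_wpM2l//; lra.
have thj : (70 * E + 110) * j%:R <= th0 * j%:R by rewrite ler_wpM2r.
have Ej : 0 <= E * j%:R by rewrite mulr_ge0.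
rewrite /q !mulr2n; lra.
Qed.

(** The function that is squared has two bounds: a crude one, proportional to
    [V = W K 0 j f], and the one given by contraction, proportional to the
    weighted [G = gam f]. Their product is integrated, with [ratio_bound] used
    for [V] so that only integrals of [G] remain. *)
Lemma variance_bound j : (j <= J)%N ->
  mint j (fun=> 1) *
  mint j (fun x => (W K 0 j h x * mint 0 f - mint 0 h * W K 0 j f x) ^+ 2) <=
  4 * H ^+ 2 * expR (vth * (1 + 2 * c) + (2 * E + 4) * n0%:R) *
    (1 + expR ((E + 3) * n0%:R)) ^+ 2 * expR (- (vth / 16 * j%:R)) * mint 0 f ^+ 4.
Proof.
move=> jJ; have M0 := mint0_gt0; have Mj := mint_1_gt0 jJ.
have hE0 := E0; have hc0 := c0; have hnc := hn0c; have hth := hth0.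
have /andP[v0 v1] := vth01; have hd := hdelta; have hd0 := delta0.
set Om := expR (vth - vth * (2 * ksum kap 0 j - j%:R)).
set G := gam K kap C (expR (vth *+ 2)) 0 j f.
set U := W K 0 j h; set V := W K 0 j f.
have bU : bm U by exact: (W_bm mK Ka).
have bV : bm V by exact: (W_bm mK Ka).
have bG : bm G by exact: (gam_bm kap mK Ka mC).
have V0 x : 0 <= V x by exact: W_ge0.
have G0 x : 0 <= G x.
  by apply: gam_ge0 => //; rewrite -expR0 ler_expR mulrn_wge0.
have MV : mint 0 f = mint j V by rewrite (mint_W f (t := j))// add0n.
have MU : mint 0 h = mint j U by rewrite (mint_W h (t := j))// add0n.
have HM : `|mint 0 h| <= H * mint 0 f.
  rewrite -mintZ//; apply: (le_trans (mint_norm _ bh)).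
  by apply: mint_le => //; [exact: bm_abs|exact: bm_mul].
have HU x : `|U x| <= H * V x.
  rewrite /U /V -(W_scale mK Ka)// ler_norml; apply/andP; split.
    rewrite -mulN1r -(W_scale mK Ka); last exact: bm_mul.
    apply: (W_le mK Ka) => //; first by apply: bm_mul => //; exact: bm_mul.
    by move=> y; rewrite mulN1r; have := hH y; rewrite ler_norml => /andP[].
  apply: (W_le mK Ka) => //; first exact: bm_mul.
  by move=> y; have := hH y; rewrite ler_norml => /andP[].
set Dl := fun x => U x * mint 0 f - mint 0 h * V x.
have bDl : bm Dl by apply: bm_sub; exact: bm_mul.
have D1 x : `|Dl x| <= 2 * H * V x * mint 0 f.
  apply: (le_trans (ler_normB _ _)); rewrite !normrM (ger0_norm (V0 x)) (gtr0_norm M0).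
  have -> : 2 * H * V x * mint 0 f = H * V x * mint 0 f + H * mint 0 f * V x by ring.
  by apply: lerD; [rewrite ler_wpM2r// ltW|rewrite ler_wpM2r].
(* [Dl x] is the integral over [x'] of an antisymmetric function of the pair. *)
have D2 x : `|Dl x| <= 2 * H * Om * G x * mint j G.
  rewrite /Dl MU MV -mintZ// -mintZr// -mintB; try exact: bm_mul.
  have bb : bm (fun x' => U x * V x' - U x' * V x).
    by apply: bm_sub; exact: bm_mul.
  apply: (le_trans (mint_norm _ bb)); rewrite -mintZ//.
  apply: mint_le; [exact: bm_abs|exact: bm_mul|move=> x'].
  have HB y y' : `|h y * f y' - f y * h y'| <= 2 * H * (f y * f y').
    apply: (le_trans (ler_normB _ _)); rewrite !normrM !(ger0_norm (f0 _)).
    have -> : 2 * H * (f y * f y') = H * f y * f y' + f y * (H * f y') by ring.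
    by apply: lerD; [rewrite ler_wpM2r|rewrite ler_wpM2l].
  have H20 : 0 <= 2 * H by rewrite mulr_ge0.
  have := @contraction_bound _ _ _ K a kap C mK Ka mC e e01 hD vth (2 * H) 0 j
    h f f v0 hvth H20 bh bf bf f0 HB x x'.
  rewrite -/U -/V -/G -/Om [U x' * V x]mulrC => Hc; apply: (le_trans Hc).
  by rewrite mulrA.
have Vb x : V x <= expR ((2 * E + 4) * Tr j) * mint 0 f / mint j (fun=> 1).
  by rewrite ler_pdivlMr//; exact: ratio_bound.
rewrite -[X in _ * X <= _]/(mint j (fun x => Dl x ^+ 2)).
clearbody Dl; set Mj' := mint j (fun=> 1) in Mj Vb *.
set Z := mint 0 f in M0 D1 Vb *.
set MG := mint j G in D2.
have MG0 : 0 <= MG by exact: mint_ge0.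
have Om0 : 0 <= Om by exact: expR_ge0.
have D3 x : Dl x ^+ 2 <=
    (4 * H ^+ 2 * Om * (expR ((2 * E + 4) * Tr j) * Z / Mj') * Z * MG) * G x.
  rewrite -real_normK ?num_real// expr2.
  apply: (@le_trans _ _ ((2 * H * V x * Z) * (2 * H * Om * G x * MG))).
    by apply: ler_pM.
  have -> : 2 * H * V x * Z * (2 * H * Om * G x * MG) =
    (4 * H ^+ 2 * Om * Z * MG * G x) * V x by ring.
  have -> : 4 * H ^+ 2 * Om * (expR ((2 * E + 4) * Tr j) * Z / Mj') * Z * MG * G x =
    (4 * H ^+ 2 * Om * Z * MG * G x) * (expR ((2 * E + 4) * Tr j) * Z / Mj') by ring.
  by rewrite ler_wpM2l// !mulr_ge0 ?exprn_ge0// ltW.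
have D4 : mint j (fun x => Dl x ^+ 2) <=
    (4 * H ^+ 2 * Om * (expR ((2 * E + 4) * Tr j) * Z / Mj') * Z * MG) * MG.
  rewrite -mintZ//; apply: mint_le => //; last exact: bm_mul.
  by under eq_fun do rewrite expr2; exact: bm_mul.
have MGb := mint_gam_le jJ; rewrite -/G -/MG -/Z in MGb.
apply: (le_trans (ler_wpM2l (ltW Mj) D4)).
set A := 1 + expR _ in MGb *.
have A0 : 0 <= A by rewrite addr_ge0 ?expR_ge0.
set T2 := expR ((2 * E + 4) * Tr j).
have -> : Mj' * (4 * H ^+ 2 * Om * (T2 * Z / Mj') * Z * MG * MG) =
    4 * H ^+ 2 * Om * T2 * Z ^+ 2 * MG ^+ 2 by field; rewrite gt_eqF.
have Z0 : 0 <= Z by exact: ltW.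
apply: (@le_trans _ _ (4 * H ^+ 2 * Om * T2 * Z ^+ 2 * (expR (vth * j%:R / 32) * A * Z) ^+ 2)).
  apply: ler_wpM2l; first by rewrite !mulr_ge0 ?exprn_ge0 ?expR_ge0.
  by rewrite ler_sqr// nnegrE// !mulr_ge0// expR_ge0.
have -> : 4 * H ^+ 2 * Om * T2 * Z ^+ 2 * (expR (vth * j%:R / 32) * A * Z) ^+ 2 =
  (4 * H ^+ 2 * A ^+ 2 * Z ^+ 4) * (Om * T2 * (expR (vth * j%:R / 32) * expR (vth * j%:R / 32))).
  by ring.
have -> : 4 * H ^+ 2 * expR (vth * (1 + 2 * c) + (2 * E + 4) * n0%:R) * A ^+ 2 *
  expR (- (vth / 16 * j%:R)) * Z ^+ 4 =
  (4 * H ^+ 2 * A ^+ 2 * Z ^+ 4) *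
  (expR (vth * (1 + 2 * c) + (2 * E + 4) * n0%:R) * expR (- (vth / 16 * j%:R))) by ring.
apply: ler_wpM2l; first by rewrite !mulr_ge0 ?exprn_ge0.
rewrite /Om /T2 -!expRD ler_expR.
have hkj := hk 0 j; rewrite add0n in hkj.
have j0 : 0 <= (j%:R : R) by exact: ler0n.
have d1 : 100 * delta <= 1.
  apply: le_trans hd; rewrite ler_peMr//; first by rewrite mulr_ge0.
  by rewrite lerDr.
have dj : 100 * (delta * j%:R) <= j%:R by rewrite mulrA ler_piMl.
have k1 : j%:R / 5 - 2 * c <= 2 * ksum kap 0 j - j%:R by lra.
have k2 := ler_wpM2l v0 k1.
have q0 : 0 < (q2%:R : R) by rewrite ltr0n.
have T1 : q2%:R * Tr j <= j%:R + q2%:R * n0%:R.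
  rewrite /Tr /lag -!natrM -natrD ler_nat mulnDr leq_add2r mulnC.
  exact: leq_trunc_div.
have T3 : (2 * E + 4) * (Tr j - n0%:R) <= vth / 16 * j%:R.
  have [tn|tn] := leP 0 (Tr j - n0%:R); last first.
    apply: (@le_trans _ _ 0); last by rewrite mulr_ge0// divr_ge0.
    by rewrite mulr_ge0_le0 ?ltW//; lra.
  have t1 := ler_wpM2r tn hq2.
  have t2 : vth * (q2%:R * (Tr j - n0%:R)) <= vth * j%:R by rewrite ler_wpM2l//; lra.
  lra.
have vj : 0 <= vth * j%:R by rewrite mulr_ge0.
lra.
Qed.

End terminal.
End initial.
End deterministic.

(** * A one-sided ergodic theorem *)

Lemma measurable_superlevel {d} {T : measurableType d} {R : realType}
  (f : T -> R) (c : R) : measurable_fun [set: T] f -> measurable [set x | c < f x].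
Proof.
move=> mf; rewrite -preimage_itvoy -[X in measurable X]setTI.
exact: (mf measurableT _ (measurable_itv _)).
Qed.

Section maximal_ergodic.
Context {d} {T : measurableType d} {R : realType} (P : probability T R).
Variable th : T -> T.
Hypothesis mth : measurable_fun [set: T] th.
Hypothesis Pth : forall A, measurable A -> P (th @^-1` A) = P A.

Definition orbit_sum (f : T -> R) n x := \sum_(i < n) f (iter i th x).

(** The maximum of [0] and of the first [n] orbit sums, in the recursive form
    on which the maximal inequality rests. *)
Fixpoint orbit_max (f : T -> R) n x : R :=
  if n is n'.+1 then Num.max 0 (f x + orbit_max f n' (th x)) else 0.

Lemma orbit_sumS f n x : orbit_sum f n.+1 x = f x + orbit_sum f n (th x).
Proof.
rewrite /orbit_sum big_ord_recl; congr (_ + _).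
by apply: eq_bigr => i _; rewrite -iterSr.
Qed.

Lemma orbit_max_ge0 f n x : 0 <= orbit_max f n x.
Proof. by case: n => //= n; rewrite le_max lexx. Qed.

Lemma orbit_sum_le_max f n x : orbit_sum f n x <= orbit_max f n x.
Proof.
elim: n x => [x|n IH x]; first by rewrite /orbit_sum big_ord0.
by rewrite orbit_sumS /= le_max lerD2l IH orbT.
Qed.

Lemma orbit_max_nd f x : nondecreasing_seq (orbit_max f ^~ x).
Proof.
apply/nondecreasing_seqP => n; elim: n x => [x|n IH x] /=.
  by rewrite le_max lexx.
by rewrite ge_max !le_max lexx/= lerD2l IH orbT.
Qed.

Lemma integral_preserving (f : T -> \bar R) : measurable_fun [set: T] f ->
  (forall x, 0 <= f x)%E -> (\int[P]_x f (th x) = \int[P]_x f x)%E.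
Proof.
move=> mf f0.
have := ge0_integral_pushforward mth P measurableT mf (fun x _ => f0 x).
rewrite preimage_setT => <-.
by apply: eq_measure_integral => A mA _; exact: Pth.
Qed.

Section maximal_inequality.
Variable f : T -> R.
Hypothesis intf : P.-integrable setT (EFin \o f).

Let mf : measurable_fun [set: T] f.
Proof. by apply/measurable_EFinP; exact: measurable_int intf. Qed.

Lemma measurable_orbit_max n : measurable_fun [set: T] (orbit_max f n).
Proof.
elim: n => [|n IH] /=; first exact: measurable_cst.
apply: measurable_maxr => //; apply: measurable_funD => //.
exact: measurableT_comp IH mth.
Qed.

Lemma integrable_orbit_max n : P.-integrable setT (EFin \o orbit_max f n).
Proof.
elim: n => [|n IH]; first exact: integrable0.
have iM : P.-integrable setT (EFin \o (fun x => orbit_max f n (th x))).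
  apply/integrableP; split.
    by apply/measurable_EFinP; exact: measurableT_comp (measurable_orbit_max n) mth.
  have /integrableP[_] := IH.
  rewrite -(integral_preserving (f := fun x => `|(EFin \o orbit_max f n) x|%E))//.
  by apply/measurableT_comp => //; apply/measurable_EFinP; exact: measurable_orbit_max.
apply: (@le_integrable _ _ _ P setT measurableT _
  (fun x => (EFin \o f) x + (EFin \o (fun x => orbit_max f n (th x))) x)%E).
- by apply/measurable_EFinP; exact: (measurable_orbit_max n.+1).
- move=> x _ /=; rewrite lee_fin ger0_norm ?le_max ?lexx//.
  by rewrite ge_max normr_ge0/= ler_norm.
- exact: integrableD.
Qed.

(** On the event, [f] is [orbit_max f n - orbit_max f (n - 1) \o th]; outside
    it this difference is nonpositive; and the integral of the difference is
    nonnegative since [th] preserves [P] and [orbit_max f] increases with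
    [n]. *)
Lemma maximal_ergodic n :
  (0 <= \int[P]_x (f x * \1_[set x | (0 < orbit_max f n x)%R] x)%:E)%E.
Proof.
have mA : measurable [set x | 0 < orbit_max f n x].
  exact: measurable_superlevel (measurable_orbit_max n).
case: n mA => [|n] mA.
  apply: integral_ge0 => x _; rewrite indicE memNset ?mulr0//=.
  by rewrite ltxx.
pose M1 := orbit_max f n.+1; pose M0 := orbit_max f n.
have i1 : P.-integrable setT (EFin \o M1) by exact: integrable_orbit_max.
have i0 : P.-integrable setT (EFin \o M0) by exact: integrable_orbit_max.
have m0 : measurable_fun setT (EFin \o M0) by exact: (measurable_int P).
have e0 : (\int[P]_x (M0 (th x))%:E = \int[P]_x (M0 x)%:E)%E.
  by apply: (integral_preserving m0) => x; rewrite lee_fin; exact: orbit_max_ge0.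
have i0t : P.-integrable setT (fun x => (M0 (th x))%:E).
  apply/integrableP; split; first exact: (measurableT_comp m0).
  have /integrableP[_] := i0.
  rewrite -(integral_preserving (f := fun x => `|(EFin \o M0) x|%E))//.
  exact: measurableT_comp.
have ifA : P.-integrable setT (fun x => (f x * \1_[set x | 0 < M1 x] x)%:E).
  apply: le_integrable intf => //.
    by apply/measurable_EFinP; apply: measurable_funM => //; exact: measurable_indic.
  move=> x _ /=; rewrite lee_fin normrM ler_piMr// indicE.
  by case: (_ \in _); rewrite ?normr1 ?normr0.
apply: (@le_trans _ _ (\int[P]_x ((M1 x)%:E - (M0 (th x))%:E))%E).
  rewrite integralB// e0 sube_ge0; last first.
    by apply/orP; left; exact: integrable_fin_num.
  apply: le_integral => // x _; rewrite lee_fin.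
  exact: (orbit_max_nd f x (leqnSn n)).
apply: le_integral => //; first exact: integrableB.
move=> x _; rewrite -EFinB lee_fin indicE.
have M00 : 0 <= M0 (th x) by exact: orbit_max_ge0.
case: (boolP (x \in _)) => [|/negP]; rewrite inE /= -/(M1 x) => h.
  rewrite mulr1 lerBlDr; move: h; rewrite /M1 /= lt_max ltxx/= => h.
  by rewrite max_r // ltW.
have : M1 x <= 0 by rewrite leNgt; apply/negP.
by rewrite mulr0; lra.
Qed.

Lemma mean_ge0 : P (\bigcup_n [set x | 0 < orbit_max f n x]) = 1%E ->
  (0 <= \int[P]_x (f x)%:E)%E.
Proof.
move=> PA; set A := fun n => [set x | 0 < orbit_max f n x].
have mA n : measurable (A n).
  exact: measurable_superlevel (measurable_orbit_max n).
have mU : measurable (\bigcup_n A n) by exact: bigcup_measurable.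
have [|||||_ _ cv] := @dominated_convergence _ T R P setT measurableT
  (fun n x => (f x * \1_(A n) x)%:E) (EFin \o f) (fun x => `|(f x)%:E|%E).
- by move=> n; apply/measurable_EFinP; apply: measurable_funM => //; exact: measurable_indic.
- exact/measurable_EFinP.
- exists (~` \bigcup_n A n); split.
  + exact: measurableC.
  + transitivity (1 - P (\bigcup_n A n))%E; first exact: probability_setC.
    by rewrite PA subee.
  + move=> x /= hx Ux; apply: hx => _; have [n _ An] := Ux.
    apply: cvg_near_cst; near=> k.
    rewrite indicE mem_set ?mulr1//= /A /=.
    apply: lt_le_trans An (orbit_max_nd f x _).
    by near: k; exact: nbhs_infty_ge.
- exact: integrable_abse.
- apply: aeW => x n _ /=; rewrite lee_fin normrM ler_piMr// indicE.
  by case: (_ \in _); rewrite ?normr1 ?normr0.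
- apply: (@closed_cvg _ _ _ eventually_filter _ (fun x : \bar R => (0 <= x)%E)) cv.
  + exact: closed_ereal_le_ereal.
  + by apply: nearW => n; exact: maximal_ergodic.
Unshelve. all: by end_near.
Qed.

End maximal_inequality.

Section ergodic_upper_bound.
Hypothesis Perg : forall A, measurable A -> th @^-1` A = A -> P A = 0%E \/ P A = 1%E.

(** The event that the orbit sums are unbounded is invariant, and has not
    probability one by the maximal inequality and the negative mean. It has thus
    probability zero, and is the limit of the events considered here. *)
Lemma ergodic_bounded (f : T -> R) : P.-integrable setT (EFin \o f) ->
  (\int[P]_x (f x)%:E < 0)%E -> forall eps : R, 0 < eps ->
  exists2 c : nat, measurable [set x | exists n, c%:R < orbit_max f n x] &
    (P [set x | exists n, (c%:R < orbit_max f n x)%R] <= eps%:E)%E.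
Proof.
move=> intf neg eps eps0.
pose F (c : nat) := [set x | exists n, c%:R < orbit_max f n x].
have mF c : measurable (F c).
  have -> : F c = \bigcup_n [set x | c%:R < orbit_max f n x].
    by apply/seteqP; split => x [n]; [exists n|exists n].
  apply: bigcup_measurable => n _.
  exact: measurable_superlevel (measurable_orbit_max intf n).
have mI : measurable (\bigcap_c F c) by exact: bigcap_measurable.
(* Dropping or adding one term changes the orbit sums by a finite amount. *)
have inv : th @^-1` (\bigcap_c F c) = \bigcap_c F c.
  apply/seteqP; split => x /= Fx c _.
    pose k := Num.bound `|c%:R - f x|.
    have [n kn] := Fx k I; exists n.+1 => /=.
    rewrite lt_max -ltrBlDl; apply/orP; right; apply: lt_trans kn.
    exact: le_lt_trans (ler_norm _) (archi_boundP (normr_ge0 _)).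
  pose k := Num.bound `|c%:R + f x|.
  have [n] := Fx (maxn k c) I; case: n => [|n] /=.
    by rewrite ltNge ler0n.
  rewrite lt_max ltNge ler0n/= => kn; exists n.
  rewrite -ltrBlDl in kn; apply: le_lt_trans kn.
  rewrite lerBrDl.
  have h1 : c%:R + f x <= k%:R.
    exact: le_trans (ler_norm _) (ltW (archi_boundP (normr_ge0 _))).
  by rewrite addrC (le_trans h1)// ler_nat leq_maxl.
have P0 : P (\bigcap_c F c) = 0%E.
  have [//|P1] := Perg mI inv.
  suff : (0 <= \int[P]_x (f x)%:E)%E by rewrite leNgt neg.
  apply: mean_ge0 => //; apply/eqP; rewrite eq_le probability_le1/=; last first.
    apply: bigcup_measurable => n _.
    exact: measurable_superlevel (measurable_orbit_max intf n).
  rewrite -P1; apply: le_measure; rewrite ?inE//.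
    apply: bigcup_measurable => n _.
    exact: measurable_superlevel (measurable_orbit_max intf n).
  by move=> x Fx; have [n] := Fx 0%N I; exists n.
have ni : nonincreasing_seq F.
  apply/nonincreasing_seqP => n; apply/subsetPset => x [k]; exists k.
  by rewrite (le_lt_trans _ p)// ler_nat.
have F0 : (P (F 0%N) < +oo)%E by rewrite (le_lt_trans (probability_le1 _ _)) ?ltry.
have cv : P \o F @ \oo --> P (\bigcap_c F c).
  exact: (nonincreasing_cvg_mu F0 mF mI ni).
rewrite P0 in cv.
have /fine_cvgP[_ /cvgrPdist_lt /(_ _ eps0)] := cv.
move=> [N _ HN]; exists N; first exact: mF.
have := HN N (leqnn N); rewrite /= sub0r normrN ger0_norm ?fine_ge0// => /ltW.
by rewrite -lee_fin fineK// fin_num_measure.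
Qed.

(** [ergodic_bounded] for [f] minus a number slightly larger than its mean. *)
Lemma ergodic_upper (f : T -> R) (delta eps : R) :
  P.-integrable setT (EFin \o f) -> 0 < delta -> 0 < eps ->
  exists (c : R) (B : set T), [/\ 0 <= c, measurable B, (P B <= eps%:E)%E &
    forall x, ~ B x -> forall n,
      orbit_sum f n x <= (\int[P]_x f x + delta) * n%:R + c].
Proof.
move=> intf delta0 eps0; set mean := \int[P]_x f x.
pose g x := f x - (mean + delta).
have intc : P.-integrable setT (EFin \o cst (mean + delta)).
  exact: finite_measure_integrable_cst.
have intg : P.-integrable setT (EFin \o g) by exact: (integrableB _ intf intc).
have neg : (\int[P]_x (g x)%:E < 0)%E.
  have -> : (\int[P]_x (g x)%:E = (\int[P]_x g x)%:E)%E.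
    by rewrite /Rintegral fineK//; exact: integrable_fin_num.
  rewrite RintegralB// -/mean Rintegral_cst//.
  have -> : (mean + delta) * fine (P setT) = mean + delta.
    transitivity ((mean + delta) * fine (1%:E : \bar R)); last exact: mulr1.
    by congr (_ * fine _); exact: probability_setT.
  by rewrite lte_fin; lra.
have [c mB PB] := ergodic_bounded intg neg eps0.
exists c%:R, [set x | exists n, c%:R < orbit_max g n x]; split => //.
move=> x nB n; rewrite -lerBlDl.
have -> : orbit_sum f n x - (mean + delta) * n%:R = orbit_sum g n x.
  rewrite /orbit_sum /g sumrB; congr (_ - _).
  by rewrite sumr_const card_ord mulr_natr.
apply: (le_trans (orbit_sum_le_max _ _ _)).
by rewrite leNgt; apply/negP => h; apply: nB; exists n.
Qed.

End ergodic_upper_bound.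

End maximal_ergodic.

(** * Stationarity and ergodicity on the path space *)

Section path_space.
Context {d} {T : measurableType d}.

Definition coord_sets : set (set (int -> T)) :=
  \bigcup_(k in [set: int])
    preimage_set_system [set: int -> T] (fun u => u k) measurable.

Local Notation paths := (g_sigma_algebraType coord_sets).

Lemma measurable_coord (k : int) : measurable_fun [set: paths] (fun u : paths => u k).
Proof.
move=> _ A mA; rewrite setTI; apply: sub_sigma_algebra; exists k => //.
by exists A => //; rewrite setTI.
Qed.

Lemma measurable_paths d' (S : measurableType d') (f : S -> paths) :
  (forall k, measurable_fun [set: S] (fun x => f x k)) -> measurable_fun [set: S] f.
Proof.
move=> mf; apply: (measurability (coord_sets : set (set paths))) => // _ [_ [k _ [A mA <-]] <-].
by rewrite !setTI; have := mf k measurableT A mA; rewrite setTI.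
Qed.

Definition cylinder (s : seq (int * set T)) : set paths :=
  [set u | forall p, p \in s -> p.2 (u p.1)].

Definition cylinders : set (set paths) :=
  [set C | exists2 s, (forall p, p \in s -> measurable p.2) & C = cylinder s].

Lemma cylinder_cat s1 s2 : cylinder (s1 ++ s2) = cylinder s1 `&` cylinder s2.
Proof.
apply/seteqP; split=> u.
  by move=> h; split=> p ps; apply: h; rewrite mem_cat ps// orbT.
by move=> [h1 h2] p; rewrite mem_cat => /orP[/h1|/h2].
Qed.

Lemma measurable_cylinder s : (forall p, p \in s -> measurable p.2) ->
  measurable (cylinder s).
Proof.
elim: s => [|p s IH] ms.
  rewrite (_ : cylinder [::] = setT); first exact: measurableT.
  by apply/seteqP; split.
rewrite -cat1s cylinder_cat; apply: measurableI; last first.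
  by apply: IH => q qs; apply: ms; rewrite inE qs orbT.
rewrite (_ : cylinder [:: p] = (fun u : paths => u p.1) @^-1` p.2).
  have := measurable_coord p.1 measurableT (ms p (mem_head _ _)).
  by rewrite setTI.
apply/seteqP; split => u /=; first by move=> /(_ p (mem_head _ _)).
by move=> pu q; rewrite inE => /eqP ->.
Qed.

Lemma cylinders_generate : @measurable _ paths = <<s cylinders >>.
Proof.
apply/seteqP; split.
  apply: smallest_sub; first exact: smallest_sigma_algebra.
  move=> _ [k _ [A mA <-]]; rewrite setTI; apply: sub_sigma_algebra.
  exists [:: (k, A)]; first by move=> p; rewrite inE => /eqP ->.
  apply/seteqP; split => u /=.
    by move=> Au p; rewrite inE => /eqP ->.
  by move=> /(_ (k, A) (mem_head _ _)).
apply: smallest_sub; first exact: sigma_algebra_measurable.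
by move=> _ [s ms ->]; exact: measurable_cylinder.
Qed.

(** Cylinders are a pi-system that generates the sigma-algebra. *)
Lemma paths_measure_unique {R : realType} (m1 m2 : probability paths R) :
  (forall s, (forall p, p \in s -> measurable p.2) ->
     m1 (cylinder s) = m2 (cylinder s)) ->
  forall A : set paths, measurable A -> m1 A = m2 A.
Proof.
move=> m12 A mA; apply: (measure_unique cylinders (fun=> setT)) => //.
- exact: cylinders_generate.
- move=> _ _ [s1 ms1 ->] [s2 ms2 ->]; exists (s1 ++ s2).
    by move=> p; rewrite mem_cat => /orP[/ms1|/ms2].
  by rewrite cylinder_cat.
- move=> _; exists [::] => //; apply/seteqP; split => //.
- by apply/seteqP; split => // u _; exists 0%N.
- by move=> _ [s ms ->]; exact: m12.
- by move=> _; exact: le_lt_trans (probability_le1 m1 measurableT) (ltry _).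
Qed.

End path_space.
Notation paths T := (g_sigma_algebraType (@coord_sets _ T)).

Section stationarity.
Context {d d'} {Omega : measurableType d} {T : measurableType d'}.
Context {R : realType} (P : probability Omega R) (Yp : int -> {RV P >-> T}).

Definition shifted (j : int) (w : Omega) : paths T := fun k => Yp (k + j) w.

Lemma measurable_shifted j : measurable_fun [set: Omega] (shifted j).
Proof. by apply: measurable_paths => k; exact: measurable_funPT. Qed.

HB.instance Definition _ j :=
  isMeasurableFun.Build _ _ _ _ (shifted j) (measurable_shifted j).

Lemma stationary_paths : strictly_stationary P Yp ->
  forall (j : int) (A : set (paths T)), measurable A ->
    P (shifted j @^-1` A) = P (shifted 0 @^-1` A).
Proof.
move=> hs j A mA.
rewrite -[LHS]/(distribution P (shifted j) A) -[RHS]/(distribution P (shifted 0) A).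
apply: paths_measure_unique => // s ms.
pose t := [tuple (tnth (in_tuple s) i).1 | i < size s].
pose B := [set v : (size s).-tuple T | forall i, (tnth (in_tuple s) i).2 (tnth v i)].
have mB : measurable B.
  have -> : B = \bigcap_(i in [set: 'I_(size s)])
      ((fun v : (size s).-tuple T => tnth v i) @^-1` (tnth (in_tuple s) i).2).
    by apply/seteqP; split => [v Bv i _|v Bv i]; [exact: Bv|exact: (Bv i Logic.I)].
  apply: fin_bigcap_measurable => // i _.
  have := @measurable_tnth _ T (size s) i measurableT (tnth (in_tuple s) i).2.
  rewrite setTI; apply; apply: ms; exact: mem_tnth.
have E k : shifted k @^-1` cylinder s =
    [set w | B [tuple Yp (tnth t i + k) w | i < size s]].
  apply/seteqP; split => w /=.
    move=> h i; rewrite tnth_mktuple /t tnth_mktuple.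
    by apply: (h (tnth (in_tuple s) i)); exact: mem_tnth.
  move=> h p ps.
  have /tnthP[i ->] : p \in in_tuple s by [].
  by have := h i; rewrite tnth_mktuple /t tnth_mktuple.
rewrite -[LHS]/(P (shifted j @^-1` cylinder s)).
rewrite -[RHS]/(P (shifted 0 @^-1` cylinder s)).
rewrite !E (hs _ t j B mB); congr (P _); apply/funext => w /=.
by congr B; apply: eq_mktuple => i; rewrite addr0.
Qed.

End stationarity.

Section block_ergodicity.
Context {d d'} {Omega : measurableType d} {T : measurableType d'}.
Context {R : realType} (P : probability Omega R) (Yp : int -> {RV P >-> T}).
Variable r : nat.
Hypothesis stat : strictly_stationary P Yp.
Hypothesis erg : ergodic_process P (fun n : int => block Yp (n * r%:Z)%R r).

Lemma measurable_block k n : measurable_fun [set: Omega] (block Yp k n).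
Proof.
apply/measurable_fun_tnthP => i.
rewrite (_ : _ \o _ = Yp (k + i%:Z)); first exact: measurable_funPT.
by apply/funext => w; rewrite /= tnth_mktuple.
Qed.

Definition block_path (u : paths T) : paths (r.-tuple T) :=
  fun n : int => [tuple u (n * r%:Z + i%:Z) | i < r].

Lemma measurable_block_path : measurable_fun [set: paths T] block_path.
Proof.
apply: measurable_paths => k; apply/measurable_fun_tnthP => i.
rewrite (_ : _ \o _ = fun u : paths T => u (k * r%:Z + i%:Z)).
  exact: measurable_coord.
by apply/funext => w; rewrite /= tnth_mktuple.
Qed.

Definition blocks (w : Omega) : paths (r.-tuple T) :=
  block_path (shifted Yp 0 w).

Lemma measurable_blocks : measurable_fun [set: Omega] blocks.
Proof. exact: (measurableT_comp measurable_block_path (measurable_shifted Yp 0)). Qed.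

HB.instance Definition _ := isMeasurableFun.Build _ _ _ _ blocks measurable_blocks.

(** The blocks are read backwards in time, from the final time of the
    observations. *)
Definition back (v : paths (r.-tuple T)) : paths (r.-tuple T) := fun k => v (k - 1).

Lemma measurable_back : measurable_fun setT back.
Proof. by apply: measurable_paths => k; exact: measurable_coord. Qed.

Lemma iter_back n v k : iter n back v k = v (k - n%:Z).
Proof.
elim: n k => [|n IH] k; first by rewrite subr0.
by rewrite iterS /back IH; congr v; rewrite -addn1 PoszD; ring.
Qed.

Lemma back_preserving (A : set (paths (r.-tuple T))) : measurable A ->
  distribution P blocks (back @^-1` A) = distribution P blocks A.
Proof.
move=> mA.
have mB : measurable (block_path @^-1` A).
  by have := measurable_block_path measurableT mA; rewrite setTI.
rewrite -[RHS]/(P (shifted Yp 0 @^-1` (block_path @^-1` A))).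
rewrite -(stationary_paths stat (- r%:Z) mB).
congr (P _); apply/funext => w; rewrite /preimage /=; congr A.
apply/funext => k; apply: eq_mktuple => i; rewrite /shifted.
by congr (Yp _ w); ring.
Qed.

(** Sets invariant under the shift are invariant under its inverse. *)
Lemma back_ergodic (A : set (paths (r.-tuple T))) : measurable A ->
  back @^-1` A = A ->
  distribution P blocks A = 0%E \/ distribution P blocks A = 1%E.
Proof.
move=> mA invA.
have E : blocks @^-1` A = [set w | A (fun k => block Yp (k * r%:Z) r w)].
  apply/funext => w; rewrite /preimage /=; congr A; apply/funext => k.
  by apply: eq_mktuple => i; rewrite /shifted addr0.
rewrite -[distribution _ _ _]/(P (blocks @^-1` A)) E; apply: erg => //.
rewrite -[in LHS]invA; apply/funext => v; rewrite /preimage /=; congr A.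
by apply/funext => k; rewrite /back; congr v; ring.
Qed.

(** The event [B] depends on the anchor [N], but neither its probability bound
    nor [c] does: it is the event for [N = 0] moved by stationarity. *)
Lemma block_ergodic_upper (f : r.-tuple T -> R) (delta eps : R) :
  measurable_fun setT f ->
  P.-integrable setT (fun w => (f (block Yp 0 r w))%:E) ->
  0 < delta -> 0 < eps ->
  exists c : R, 0 <= c /\ forall N : int, exists B : set Omega,
    [/\ measurable B, (P B <= eps%:E)%E &
      forall w, ~ B w -> forall n : nat,
        \sum_(i < n) f (block Yp (N - (i.+1 * r)%:Z) r w) <=
        (\int[P]_w f (block Yp 0 r w) + delta) * n%:R + c].
Proof.
move=> mf intf delta0 eps0.
pose F (v : paths (r.-tuple T)) := f (v (- 1)).
have mF : measurable_fun setT F by exact: (measurableT_comp mf (measurable_coord _)).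
pose f0 w := f (block Yp 0 r w); pose f1 w := F (blocks w).
have mf0 : measurable_fun setT f0 by exact: (measurableT_comp mf (@measurable_block 0 r)).
have mf1 : measurable_fun setT f1 by exact: (measurableT_comp mF measurable_blocks).
have mev k : measurable_fun setT (fun u : paths T => [tuple u (k + i%:Z) | i < r]).
  apply/measurable_fun_tnthP => i.
  rewrite (_ : _ \o _ = fun u : paths T => u (k + i%:Z)); first exact: measurable_coord.
  by apply/funext => w; rewrite /= tnth_mktuple.
have lawE (G : R -> \bar R) : measurable_fun setT G -> (forall x, 0 <= G x)%E ->
    (\int[P]_w G (f1 w) = \int[P]_w G (f0 w))%E.
  move=> mG G0; pose H (u : paths T) := G (f [tuple u (0 + i%:Z) | i < r]).
  have mH : measurable_fun setT H by apply: (measurableT_comp mG); exact: (measurableT_comp mf).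
  transitivity (\int[distribution P (shifted Yp (- r%:Z))]_u H u)%E.
    rewrite ge0_integral_distribution; [|exact: mH|by move=> u; exact: G0].
  apply: eq_integral => w _ /=.
    rewrite /H /f1 /F /blocks /block_path /shifted; congr (G (f _)).
    by apply: eq_mktuple => i; congr (Yp _ w); ring.
  transitivity (\int[distribution P (shifted Yp 0)]_u H u)%E.
    by apply: eq_measure_integral => A mA _; exact: (stationary_paths stat).
  rewrite ge0_integral_distribution; [|exact: mH|by move=> u; exact: G0].
  apply: eq_integral => w _ /=.
  rewrite /H /f0 /block /shifted; congr (G (f _)).
  by apply: eq_mktuple => i; congr (Yp _ w); ring.
have i0 : P.-integrable setT (EFin \o f0) by [].
have i1 : P.-integrable setT (EFin \o f1).
  apply/integrableP; split; first exact/measurable_EFinP.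
  rewrite (lawE (fun x => `|x%:E|%E))//; last by apply: measurableT_comp => //; exact/measurable_EFinP.
  by have /integrableP[] := i0.
have meanE : \int[distribution P blocks]_v F v = \int[P]_w f (block Yp 0 r w).
  rewrite /Rintegral; congr fine.
  rewrite integral_distribution//; last exact/measurable_EFinP.
  pose H (u : paths T) := (f [tuple u (0 + i%:Z) | i < r])%:E.
  have mH : measurable_fun setT H by apply/measurable_EFinP; exact: (measurableT_comp mf).
  have H1 : H \o shifted Yp (- r%:Z) = EFin \o f1.
    apply/funext => w; rewrite /H /f1 /F /blocks /block_path /shifted /=; congr (f _)%:E.
    by apply: eq_mktuple => i; congr (Yp _ w); ring.
  have H0 : H \o shifted Yp 0 = EFin \o f0.
    apply/funext => w; rewrite /H /f0 /block /shifted /=; congr (f _)%:E.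
    by apply: eq_mktuple => i; congr (Yp _ w); ring.
  transitivity (\int[distribution P (shifted Yp (- r%:Z))]_u H u)%E.
    by rewrite integral_distribution ?H1.
  transitivity (\int[distribution P (shifted Yp 0)]_u H u)%E.
    by apply: eq_measure_integral => A mA _; exact: (stationary_paths stat).
  by rewrite integral_distribution ?H0.
have iF : (distribution P blocks).-integrable setT (EFin \o F).
  by apply: integrable_pushforward => //; exact/measurable_EFinP.
have [c [B [c0 mB PB HB]]] := ergodic_upper measurable_back back_preserving
   back_ergodic iF delta0 eps0.
exists c; split => // N.
have mBB : measurable (block_path @^-1` B).
  by have := measurable_block_path measurableT mB; rewrite setTI.
exists (shifted Yp N @^-1` (block_path @^-1` B)); split.
- by have := measurable_shifted Yp N measurableT mBB; rewrite setTI.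
- by rewrite (stationary_paths stat).
- move=> w nB n; have := HB (block_path (shifted Yp N w)) nB n.
  rewrite meanE /orbit_sum; apply: le_trans; rewrite le_eqVlt; apply/orP; left.
  apply/eqP; apply: eq_bigr => i _; rewrite /F iter_back /block_path.
  congr f; apply: eq_mktuple => l; rewrite /shifted; congr (Yp _ w).
  by rewrite PoszM -addn1 PoszD; ring.
Qed.

End block_ergodicity.

(** * The kernels of the model and their null sets *)

Section model_kernels.
Local Open Scope ereal_scope.
Context {dX dY} {X : measurableType dX} {Y : measurableType dY} {R : realType}.
Variable M : model X Y R.
Implicit Types (s : seq Y) (x : X) (f : X -> \bar R).

Lemma g_nng z : (0 <= g M z)%R. Proof. exact/ltW/g_gt0. Qed.

Lemma L_consE y s x A : L M (y :: s) x A =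
  \int[Q M x]_x' ((g M (x, y))%:E * L M s x' A).
Proof. by []. Qed.

Lemma L_nilE x A : L M [::] x A = \d_x A. Proof. by []. Qed.

Lemma measurable_LA s A : measurable A -> measurable_fun [set: X] (L M s ^~ A).
Proof. exact: measurable_L. Qed.

Lemma measurable_intL s f : (forall x, 0 <= f x) -> measurable_fun [set: X] f ->
  measurable_fun [set: X] (fun x => \int[L M s x]_z f z).
Proof.
by move=> f0 mf; apply: measurable_fun_integral_kernel => // A mA; exact: measurable_LA.
Qed.

Lemma integral_L_nil x f : measurable_fun [set: X] f ->
  \int[L M [::] x]_z f z = f x.
Proof.
move=> mf; transitivity (\int[\d_x]_z f z); first by apply: eq_measure_integral.
by rewrite integral_dirac// diracT mul1e.
Qed.

(** The kernel of [y :: s] is the mixture under [Q M x] of the kernels of [s],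
    scaled by [g M (x, y)]. *)
Lemma integral_L_cons y s x f : (forall x, 0 <= f x) -> measurable_fun [set: X] f ->
  \int[L M (y :: s) x]_z f z =
  (g M (x, y))%:E * \int[Q M x]_x' \int[L M s x']_z f z.
Proof.
move=> f0 mf; pose c : {nonneg R} := NngNum (g_nng (x, y)).
rewrite (integral_mixture (mu := Q M x) (k := fun x' => mscale c (L M s x')))//.
- rewrite -ge0_integralZl//.
  + by apply: eq_integral => x' _; rewrite ge0_integral_mscale.
  + exact: measurable_intL.
  + by move=> x' _; exact: integral_ge0.
  + by rewrite lee_fin g_nng.
- by move=> A mA; apply: measurable_funeM; exact: measurable_LA.
Qed.

Lemma integral_L_cat s1 s2 x f : (forall x, 0 <= f x) -> measurable_fun [set: X] f ->
  \int[L M (s1 ++ s2) x]_z f z = \int[L M s1 x]_x' \int[L M s2 x']_z f z.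
Proof.
move=> f0 mf; elim: s1 x => [|y s1 IH] x.
  by rewrite integral_L_nil//; exact: measurable_intL.
rewrite cat_cons integral_L_cons// integral_L_cons; last 2 first.
- by move=> x'; exact: integral_ge0.
- exact: measurable_intL.
by congr (_ * _); apply: eq_integral => x' _; exact: IH.
Qed.

Lemma L_cat s1 s2 x A : measurable A ->
  L M (s1 ++ s2) x A = \int[L M s1 x]_x' L M s2 x' A.
Proof.
move=> mA; have mi : measurable_fun [set: X] (EFin \o \1_A : X -> \bar R).
  by apply/measurable_EFinP; exact: measurable_indic.
have := @integral_L_cat s1 s2 x (EFin \o \1_A) _ mi.
rewrite integral_indic// setIT => -> => [|x']; last by rewrite lee_fin.
by apply: eq_integral => x' _; rewrite integral_indic// setIT.
Qed.

Lemma integral_muL (mu : {measure set X -> \bar R}) s f :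
  (forall x, 0 <= f x) -> measurable_fun [set: X] f ->
  \int[muL M mu s]_z f z = \int[mu]_x \int[L M s x]_z f z.
Proof.
move=> f0 mf; apply: (integral_mixture (mu := mu) (k := L M s)) => //.
by move=> A mA; exact: measurable_LA.
Qed.

Lemma muL_cat (mu : {measure set X -> \bar R}) s1 s2 A : measurable A ->
  muL M mu (s1 ++ s2) A = \int[muL M mu s1]_x L M s2 x A.
Proof.
move=> mA; rewrite integral_muL//; last exact: measurable_LA.
by apply: eq_integral => x _; rewrite -L_cat.
Qed.

Section image.
Variable mu : probability X R.

Definition muQ (A : set X) := \int[mu]_x Q M x A.

Let muQ0 : muQ set0 = 0.
Proof. by apply: integral0_eq => x _; rewrite measure0. Qed.

Let muQ_ge0 A : 0 <= muQ A. Proof. exact: integral_ge0. Qed.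

Let muQ_sigma_additive : semi_sigma_additive muQ.
Proof.
move=> F mF tF mUF; rewrite [X in _ --> X](_ : _ =
  \int[mu]_x (\sum_(n <oo) Q M x (F n))); last first.
  apply: eq_integral => x _.
  by apply/esym/cvg_lim => //; exact: measure_semi_sigma_additive.
apply/cvg_closeP; split.
  by apply: is_cvg_nneseries => n _ _; exact: integral_ge0.
rewrite closeE// integral_nneseries// => n.
exact: measurable_kernel.
Qed.

HB.instance Definition _ := isMeasure.Build _ _ R
  muQ muQ0 muQ_ge0 muQ_sigma_additive.

Let muQT : muQ setT = 1.
Proof.
transitivity (\int[mu]_x (cst 1 x)).
  by apply: eq_integral => x _; exact: prob_kernel.
by rewrite integral_cst// mul1e; exact: probability_setT.
Qed.

HB.instance Definition _ := Measure_isProbability.Build _ _ R muQ muQT.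

End image.

Section absorbing.
Variable chi : probability X R.

(** The law of the state at time [k]. *)
Definition lam k : probability X R := iter k (fun mu : probability X R => muQ mu) chi.

(** Negligible at all times. The kernels of the model are absolutely
    continuous with respect to the iterates of [Q], so that such a set is not
    seen by any predictor. *)
Definition null (N : set X) := measurable N /\ forall k, lam k N = 0.

Lemma null_bigcup (N : nat -> set X) : (forall i, null (N i)) -> null (\bigcup_i N i).
Proof.
move=> nN; split; first by apply: bigcup_measurable => i _; exact: (nN i).1.
move=> k; apply/eqP; rewrite eq_le measure_ge0 andbT.
have h := @measure_sigma_subadditive _ _ _ (lam k) (\bigcup_i N i) N
  (fun i => (nN i).1) _ (@subset_refl _ _).
apply: (le_trans (h _)); first by apply: bigcup_measurable => i _; exact: (nN i).1.
by rewrite eseries0// => i _ _; exact: (nN i).2.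
Qed.

Lemma null_setU N1 N2 : null N1 -> null N2 -> null (N1 `|` N2).
Proof.
move=> [m1 n1] [m2 n2]; split; first exact: measurableU.
move=> k; apply/eqP; rewrite eq_le measure_ge0 andbT.
apply: (le_trans (measureU2 _ m1 m2)).
by apply: adde_le0; rewrite le_eqVlt; apply/orP; left; apply/eqP; [exact: n1|exact: n2].
Qed.

Lemma null_sub N1 N2 : measurable N1 -> N1 `<=` N2 -> null N2 -> null N1.
Proof.
move=> m1 s12 [m2 n2]; split => // k; apply/eqP; rewrite eq_le measure_ge0 andbT.
apply: (@le_trans _ _ (lam k N2)); last by rewrite le_eqVlt; apply/orP; left; apply/eqP.
by rewrite le_measure ?inE.
Qed.

Lemma null_preQ N : null N -> null [set x | Q M x N != 0].
Proof.
move=> [mN nN]; have mQN : measurable_fun [set: X] (Q M ^~ N) by exact: measurable_kernel.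
have mS : measurable [set x | Q M x N != 0].
  have -> : [set x | Q M x N != 0] = (Q M ^~ N) @^-1` (~` [set 0]).
    by apply/seteqP; split => x /=; [move/eqP|move/eqP].
  have := mQN measurableT (~` [set 0]); rewrite setTI; apply.
  by apply: measurableC; exact: emeasurable_set1.
split => // k.
have : \int[lam k]_x `|Q M x N| = 0.
  by under eq_integral do rewrite gee0_abs//; exact: (nN k.+1).
move/(ae_eq_integral_abs _ measurableT mQN) => [B [mB B0 BS]].
apply/eqP; rewrite eq_le measure_ge0 andbT.
apply: (@le_trans _ _ (lam k B)); last by rewrite le_eqVlt; apply/orP; left; apply/eqP.
rewrite le_measure ?inE//.
by move=> x /eqP QN; apply: BS => /(_ Logic.I).
Qed.

(** Remove from the state space the null set, then the points from which it
    is reached in one step with positive probability, and so on; each of these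
    sets is null by [null_preQ]. *)
Lemma absorbing_core N : null N -> exists X0 : set X,
  [/\ measurable X0, X0 `<=` ~` N, null (~` X0) &
      forall x, X0 x -> Q M x (~` X0) = 0].
Proof.
move=> nN.
pose F i := iter i (fun B : set X => B `|` [set x | Q M x B != 0]) N.
have nF i : null (F i).
  by elim: i => [//|i IH]; rewrite /F iterS -/(F i); apply: null_setU => //; exact: null_preQ.
have [mU nU] := null_bigcup nF.
exists (~` \bigcup_i F i); split; rewrite ?setCK//.
- exact: measurableC.
- by apply: subsetC => x Nx; exists 0%N.
- move=> x /= hx; apply/eqP; rewrite eq_le measure_ge0 andbT.
  have h := @measure_sigma_subadditive _ _ _ (Q M x) (\bigcup_i F i) F
    (fun i => (nF i).1) mU (@subset_refl _ _).
  apply: (le_trans h); rewrite eseries0// => i _ _.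
  apply/eqP; apply/negPn/negP => Qx; apply: hx; exists i.+1 => //.
  by rewrite /F iterS; right.
Qed.

Section on_core.
Variable X0 : set X.
Hypothesis mX0 : measurable X0.
Hypothesis nX0 : null (~` X0).
Hypothesis absX0 : forall x, X0 x -> Q M x (~` X0) = 0.

Lemma ae_eq_int_core (mu : {measure set X -> \bar R}) f1 f2 :
  mu (~` X0) = 0 -> (forall x, 0 <= f1 x) -> (forall x, 0 <= f2 x) ->
  measurable_fun [set: X] f1 -> measurable_fun [set: X] f2 ->
  (forall x, X0 x -> f1 x = f2 x) -> \int[mu]_x f1 x = \int[mu]_x f2 x.
Proof.
move=> mu0 f10 f20 m1 m2 f12; apply: ge0_ae_eq_integral => //.
exists (~` X0); split => //; first exact: measurableC.
by apply: subsetC => x X0x _; exact: f12.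
Qed.

Lemma L_core s x : X0 x -> L M s x (~` X0) = 0.
Proof.
elim: s x => [|y s IH] x X0x.
  by rewrite L_nilE diracE memNset.
rewrite L_consE.
rewrite (ae_eq_int_core (f2 := fun=> 0) (absX0 X0x))//.
- by rewrite integral0.
- by move=> x'; rewrite mule_ge0// lee_fin g_nng.
- by apply: measurable_funeM; apply: measurable_LA; exact: measurableC.
- by move=> x' X0x'; rewrite IH// mule0.
Qed.

Lemma chi_core : chi (~` X0) = 0. Proof. exact: (nX0.2 0%N). Qed.

Lemma muL_core s : muL M chi s (~` X0) = 0.
Proof.
rewrite /muL (ae_eq_int_core (f2 := fun=> 0) chi_core)//.
- by rewrite integral0.
- by apply: measurable_LA; exact: measurableC.
- by move=> x X0x; exact: L_core.
Qed.

Lemma L_mass_le s (b : seq R) x : X0 x -> size b = size s ->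
  (forall i y0, (i < size s)%N -> forall z, X0 z ->
    (g M (z, nth y0 s i) <= expR (nth 0%R b i))%R) ->
  L M s x setT <= (expR (\sum_(c <- b) c)%R)%:E.
Proof.
elim: s b x => [|y s IH] [|c b] x //= X0x.
  have -> : L M [::] x setT = 1 by exact: diracT.
  by rewrite big_nil expR0.
move=> [sb] hb; rewrite big_cons expRD EFinM.
rewrite -[leLHS]/(\int[Q M x]_x' ((g M (x, y))%:E * L M s x' setT)).
have gc : (g M (x, y) <= expR c)%R by exact: (hb 0%N y (ltn0Sn _) x X0x).
pose F x' := if x' \in X0 then L M s x' setT else 0.
have mF : measurable_fun [set: X] F.
  apply: measurable_fun_if => //.
    by apply: (measurable_fun_bool true); rewrite setTI preimage_mem_true.
  by apply: measurable_funTS; exact: measurable_LA.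
have mL : measurable_fun [set: X] (fun x' => (g M (x, y))%:E * L M s x' setT).
  by apply: measurable_funeM; exact: measurable_LA.
have F0 x' : 0 <= F x' by rewrite /F; case: ifP.
rewrite (ae_eq_int_core (f2 := fun x' => (g M (x, y))%:E * F x') (absX0 X0x))//.
- rewrite ge0_integralZl//; last by rewrite lee_fin g_nng.
  apply: lee_pmul; rewrite ?lee_fin ?g_nng//; first exact: integral_ge0.
  apply: (@le_trans _ _ (\int[Q M x]_x' (expR (\sum_(c0 <- b) c0)%R)%:E)).
    apply: ge0_le_integral => //.
    move=> x' _; rewrite /F; case: ifPn => [|_]; last exact: expR_ge0.
    rewrite inE => X0x'; apply: IH => // i y0 si z X0z.
    exact: (hb i.+1 y0).
  rewrite integral_cst//.
  have -> : Q M x setT = 1 by exact: prob_kernel.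
  by rewrite mule1.
- by move=> x'; rewrite mule_ge0// lee_fin g_nng.
- by move=> x'; rewrite mule_ge0// lee_fin g_nng.
- exact: measurable_funeM.
- by move=> x' X0x'; rewrite /F mem_set.
Qed.

End on_core.
End absorbing.
End model_kernels.

(** * Restricting a kernel to finite measures *)

Section killed.
Local Open Scope ereal_scope.
Context {d} {T : Type} {X : measurableType d} {R : realType}.
Variables (k : T -> {measure set X -> \bar R}) (E : set T) (b : R).

(** The kernels of the model have a finite mass only on the absorbing set.
    Replacing them by zero elsewhere gives finite measures everywhere without
    changing the integrals that matter. *)
Let killed_measure x : {measure set X -> \bar R} :=
  if `[< E x /\ k x setT <= b%:E >] then k x else mzero.

Definition killed x : set X -> \bar R := killed_measure x.

HB.instance Definition _ x := Measure.on (killed x).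

Lemma killedE x A : E x -> k x setT <= b%:E -> killed x A = k x A.
Proof. by move=> Ex kb; rewrite /killed /killed_measure asboolT. Qed.

Lemma killedN x A : ~ (E x /\ k x setT <= b%:E) -> killed x A = 0.
Proof. by move=> nEx; rewrite /killed /killed_measure asboolF. Qed.

Lemma killed0 x A : ~ E x -> killed x A = 0.
Proof. by move=> nEx; apply: killedN => -[]. Qed.

Let killed_finite x : fin_num_fun (killed x).
Proof.
apply: lty_fin_num_fun.
have [[Ex kb]|h] := pselect (E x /\ k x setT <= b%:E).
  apply: le_lt_trans (ltry b).
  by move: (kb); rewrite -(killedE setT Ex kb).
apply: (@le_lt_trans _ _ 0); last exact: ltry.
by rewrite le_eqVlt; apply/orP; left; apply/eqP; exact: killedN.
Qed.

HB.instance Definition _ x :=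
  Measure_isFinite.Build _ _ _ (killed x) (killed_finite x).

Definition kill : T -> {finite_measure set X -> \bar R} := killed.

Lemma kill_mass x : (0 <= b)%R -> kill x setT <= b%:E.
Proof.
move=> b0; have [[Ex kb]|h] := pselect (E x /\ k x setT <= b%:E).
  by move: (kb); rewrite -(killedE setT Ex kb).
apply: (@le_trans _ _ 0); last by rewrite lee_fin.
by rewrite le_eqVlt; apply/orP; left; apply/eqP; exact: killedN.
Qed.

Lemma integral_kill x f : E x -> k x setT <= b%:E ->
  \int[kill x]_z f z = \int[k x]_z f z.
Proof.
by move=> Ex kb; apply: (eq_measure_integral (k x)) => A _ _; exact: killedE.
Qed.

Lemma Rintegral_kill0 x (f : X -> R) : ~ E x -> (\int[kill x]_z f z = 0)%R.
Proof.
move=> nEx; rewrite /Rintegral (eq_measure_integral mzero).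
  by rewrite integral_measure_zero.
by move=> A _ _; rewrite /kill /= killed0.
Qed.

End killed.

Section killed_kernel.
Local Open Scope ereal_scope.
Context {d d'} {T : measurableType d'} {X : measurableType d} {R : realType}.
Variables (k : T -> {measure set X -> \bar R}) (E : set T) (b : R).
Hypothesis mk : forall A, measurable A -> measurable_fun [set: T] (k ^~ A).
Hypothesis mE : measurable E.

Lemma measurable_kill A : measurable A -> measurable_fun [set: T] (kill k E b ^~ A).
Proof.
move=> mA; pose G := E `&` [set x | k x setT <= b%:E].
have mG : measurable G.
  apply: measurableI => //.
  have := mk measurableT measurableT (emeasurable_itv `]-oo, b%:E]).
  by rewrite setTI; congr measurable; apply/seteqP; split => x /=; rewrite in_itv.
have -> : kill k E b ^~ A = (fun x => if x \in G then k x A else 0).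
  apply/funext => x; case: ifPn => [|/negP]; rewrite inE.
    by move=> [Ex kb]; exact: killedE.
  by move=> nG; exact: killedN.
apply: measurable_fun_if => //.
  by apply: (measurable_fun_bool true); rewrite setTI preimage_mem_true.
by apply: measurable_funTS; exact: mk.
Qed.

End killed_kernel.

(** * The model along a fixed trajectory *)

Lemma bm_nneg {d} {T : measurableType d} {R : realType} (f : T -> R) : bm f ->
  exists B : R, forall x, 0 <= f x + B.
Proof.
by move=> [_ [B hB]]; exists B => x; rewrite -lerBlDr sub0r (lerNnormlW (hB x)).
Qed.

Section trajectory.
Context {dX dY} {X : measurableType dX} {Y : measurableType dY} {R : realType}.
Variables (M : model X Y R) (chi : probability X R) (y : int -> Y) (X0 : set X).
Hypothesis mX0 : measurable X0.
Hypothesis nX0 : null M chi (~` X0).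
Hypothesis absX0 : forall x, X0 x -> Q M x (~` X0) = 0%E.
Variable ag : int -> R.
Hypothesis hg : forall l z, X0 z -> g M (z, y l) <= expR (ag l).
Implicit Types (f : X -> R) (k : int) (n : nat).

Definition obs k n : seq Y := [seq y (k + i%:Z) | i <- iota 0 n].
(** The logarithmic upper bound on the mass of the kernel of the block. *)
Definition asg k n : R := \sum_(b <- [seq ag (k + i%:Z) | i <- iota 0 n]) b.

Lemma size_obs k n : size (obs k n) = n.
Proof. by rewrite size_map size_iota. Qed.

Lemma obs_cat k n1 n2 : obs k (n1 + n2) = obs k n1 ++ obs (k + n1%:Z) n2.
Proof.
rewrite /obs iotaD map_cat add0n; congr (_ ++ _).
rewrite -{1}[n1]addn0 iotaDl -map_comp; apply: eq_map => i /=.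
by rewrite PoszD addrA.
Qed.

Lemma asg_cat k n1 n2 : asg k (n1 + n2) = asg k n1 + asg (k + n1%:Z) n2.
Proof.
rewrite /asg iotaD map_cat add0n big_cat; congr (_ + _).
rewrite -{1}[n1]addn0 iotaDl -map_comp; apply: congr_big => //; apply: eq_map => i /=.
by rewrite PoszD addrA.
Qed.

Lemma asgE k n : asg k n = \sum_(i < n) ag (k + i%:Z).
Proof. by rewrite /asg big_map -[n in iota 0 n]subn0 big_mkord. Qed.

Lemma L_obs_mass k n x : X0 x -> (L M (obs k n) x setT <= (expR (asg k n))%:E)%E.
Proof.
move=> X0x; apply: (L_mass_le (X0 := X0) mX0 absX0 X0x).
  by rewrite !size_map.
move=> i y0; rewrite size_obs => ilt z X0z.
rewrite (nth_map 0%N) ?size_iota// (nth_map 0%N) ?size_iota//; exact: hg.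
Qed.

Definition Kobs k n := kill (L M (obs k n)) X0 (expR (asg k n)).

Lemma mKobs k n A : measurable A -> measurable_fun [set: X] (Kobs k n ^~ A).
Proof. by move=> mA; apply: measurable_kill => // B mB; exact: measurable_LA. Qed.

Lemma Kobs_mass k n x : (Kobs k n x setT <= (expR (asg k n))%:E)%E.
Proof. by apply: kill_mass; exact: expR_ge0. Qed.

(** The kernel of a window of observations, acting on bounded functions. *)
Definition obs_op k n f x := \int[Kobs k n x]_z f z.
Local Notation Lr := obs_op.

Lemma bm_Lr k n f : bm f -> bm (Lr k n f).
Proof. by move=> bf; exact: (bm_kernel (mKobs k n) (Kobs_mass k n)). Qed.

Lemma LrE k n f x : X0 x -> (\int[Kobs k n x]_z (f z)%:E = \int[L M (obs k n) x]_z (f z)%:E)%E.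
Proof. by move=> X0x; apply: integral_kill => //; exact: L_obs_mass. Qed.

Lemma Lr_out k n f x : ~ X0 x -> Lr k n f x = 0.
Proof. by move=> nX; exact: Rintegral_kill0. Qed.

Lemma Lr_lin k n f (B : R) x : bm f ->
  Lr k n (fun z => f z + B) x = Lr k n f x + B * Lr k n (fun=> 1) x.
Proof.
move=> bf; rewrite /Lr bm_RintD// !bm_Rint_cst; congr (_ + _).
by rewrite mul1r.
Qed.

Lemma Lr_lin2 k n f1 f2 (B : R) x : bm f1 -> bm f2 ->
  Lr k n (fun z => f1 z + B * f2 z) x = Lr k n f1 x + B * Lr k n f2 x.
Proof. by move=> b1 b2; rewrite /Lr bm_RintD ?bm_RintZ//; exact: bm_mul. Qed.

Lemma Lr_EFin k n f x : bm f -> X0 x ->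
  (Lr k n f x)%:E = (\int[L M (obs k n) x]_z (f z)%:E)%E.
Proof. by move=> bf X0x; rewrite /Lr Rint_EFin// LrE. Qed.

Lemma Lr_comp_ge0 k n1 n2 f : bm f -> (forall x, 0 <= f x) ->
  forall x, Lr k (n1 + n2) f x = Lr k n1 (Lr (k + n1%:Z) n2 f) x.
Proof.
move=> bf f0 x; have [X0x|nX] := pselect (X0 x); last by rewrite !Lr_out.
apply: EFin_inj; rewrite !Lr_EFin//; last exact: bm_Lr.
rewrite obs_cat integral_L_cat//; last first.
  by apply/measurable_EFinP; exact: bf.1.
apply: (ae_eq_int_core mX0).
- exact: (L_core mX0 absX0).
- by move=> z; apply: integral_ge0 => u _; rewrite lee_fin.
- by move=> z; rewrite lee_fin; exact: Rint_ge0.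
- apply: measurable_intL => //; apply/measurable_EFinP; exact: bf.1.
- by apply/measurable_EFinP; exact: (bm_Lr _ _ bf).1.
- by move=> z X0z; rewrite Lr_EFin.
Qed.

Lemma Lr_comp k n1 n2 f : bm f ->
  forall x, Lr k (n1 + n2) f x = Lr k n1 (Lr (k + n1%:Z) n2 f) x.
Proof.
move=> bf x; have [B hB] := bm_nneg bf.
have bB : bm (fun z => f z + B) by exact: bm_add.
have := Lr_comp_ge0 k n1 n2 bB hB x.
rewrite Lr_lin// (Lr_comp_ge0 k n1 n2 (bm_cst 1) (fun=> ler01) x).
rewrite (_ : Lr (k + n1%:Z) n2 (fun z => f z + B) =
   (fun z => Lr (k + n1%:Z) n2 f z + B * Lr (k + n1%:Z) n2 (fun=> 1) z)); last first.
  by apply/funext => z; rewrite Lr_lin.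
by rewrite Lr_lin2; [move/addIr|exact: bm_Lr|exact: bm_Lr].
Qed.

(** The unnormalized predictor, as a finite measure. *)
Definition pobs n := kill (fun _ : unit => muL M chi (obs 0 n)) setT (expR (asg 0 n)) tt.

Lemma muL_obs_mass n : (muL M chi (obs 0 n) setT <= (expR (asg 0 n))%:E)%E.
Proof.
rewrite -[leLHS]/(\int[chi]_x L M (obs 0 n) x setT)%E.
pose F x := if x \in X0 then L M (obs 0 n) x setT else 0%E.
have mF : measurable_fun [set: X] F.
  apply: measurable_fun_if => //.
    by apply: (measurable_fun_bool true); rewrite setTI preimage_mem_true.
  by apply: measurable_funTS; exact: measurable_LA.
have F0 x : (0 <= F x)%E by rewrite /F; case: ifP.
rewrite (ae_eq_int_core mX0 (f2 := F) (chi_core nX0))//; last 2 first.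
- exact: measurable_LA.
- by move=> x X0x; rewrite /F mem_set.
apply: (@le_trans _ _ (\int[chi]_x (expR (asg 0 n))%:E)%E).
  apply: ge0_le_integral => //.
  move=> x _; rewrite /F; case: ifPn => [|_]; last exact: expR_ge0.
  by rewrite inE => X0x; exact: L_obs_mass.
rewrite integral_cst//.
apply: (@le_trans _ _ ((expR (asg 0 n))%:E * 1)%E); last by rewrite mule1.
rewrite le_eqVlt; apply/orP; left; apply/eqP.
by congr (_ * _)%E; exact: probability_setT.
Qed.

Definition obs_int n f := \int[pobs n]_x f x.
Local Notation Pr := obs_int.

Lemma Pr_EFin n f : bm f ->
  (Pr n f)%:E = (\int[muL M chi (obs 0 n)]_z (f z)%:E)%E.
Proof.
move=> bf; rewrite /Pr Rint_EFin// /pobs integral_kill//; exact: muL_obs_mass.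
Qed.

Lemma Pr_lin n f (B : R) : bm f ->
  Pr n (fun z => f z + B) = Pr n f + B * Pr n (fun=> 1).
Proof.
move=> bf; rewrite /Pr bm_RintD// !bm_Rint_cst; congr (_ + _).
by rewrite mul1r.
Qed.

Lemma Pr_lin2 n f1 f2 (B : R) : bm f1 -> bm f2 ->
  Pr n (fun z => f1 z + B * f2 z) = Pr n f1 + B * Pr n f2.
Proof. by move=> b1 b2; rewrite /Pr bm_RintD ?bm_RintZ//; exact: bm_mul. Qed.

Lemma Pr_comp_ge0 n1 n2 f : bm f -> (forall x, 0 <= f x) ->
  Pr (n1 + n2) f = Pr n1 (Lr n1%:Z n2 f).
Proof.
move=> bf f0; apply: EFin_inj.
rewrite (Pr_EFin (n1 + n2) bf) (Pr_EFin n1 (bm_Lr n1%:Z n2 bf)).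
have mf : measurable_fun setT (EFin \o f) by apply/measurable_EFinP; exact: bf.1.
have mi k n : measurable_fun setT (fun x => \int[L M (obs k n) x]_z (f z)%:E)%E.
  exact: measurable_intL.
have i0 k n x : (0 <= \int[L M (obs k n) x]_z (f z)%:E)%E.
  by apply: integral_ge0 => u _; rewrite lee_fin.
rewrite integral_muL//.
transitivity (\int[muL M chi (obs 0 n1)]_x \int[L M (obs n1%:Z n2) x]_z (f z)%:E)%E.
  rewrite [RHS]integral_muL//; apply: eq_integral => x _.
  by rewrite obs_cat add0r integral_L_cat.
apply: (ae_eq_int_core mX0) => //.
- exact: (muL_core mX0 nX0 absX0).
- by move=> z; rewrite lee_fin; exact: Rint_ge0.
- by apply/measurable_EFinP; exact: (bm_Lr _ _ bf).1.
- by move=> z X0z; rewrite Lr_EFin.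
Qed.

(** The Chapman-Kolmogorov property, first for nonnegative functions and then
    by adding a constant. *)
Lemma Pr_comp n1 n2 f : bm f -> Pr (n1 + n2) f = Pr n1 (Lr n1%:Z n2 f).
Proof.
move=> bf; have [B hB] := bm_nneg bf.
have bB : bm (fun z => f z + B) by exact: bm_add.
have := Pr_comp_ge0 n1 n2 bB hB.
rewrite Pr_lin// (Pr_comp_ge0 n1 n2 (bm_cst 1) (fun=> ler01)).
rewrite (_ : Lr n1%:Z n2 (fun z => f z + B) =
   (fun z => Lr n1%:Z n2 f z + B * Lr n1%:Z n2 (fun=> 1) z)); last first.
  by apply/funext => z; rewrite Lr_lin.
by rewrite Pr_lin2; [move/addIr|exact: bm_Lr|exact: bm_Lr].
Qed.

End trajectory.

(** * The terms of the asymptotic variance *)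

Section signed_integrals.
Local Open Scope ereal_scope.
Context {dX dY} {X : measurableType dX} {Y : measurableType dY} {R : realType}.
Variable M : model X Y R.

Lemma measurable_intL_signed s (h : X -> R) : measurable_fun [set: X] h ->
  measurable_fun [set: X] (fun x => \int[L M s x]_z (h z)%:E).
Proof.
move=> mh; under eq_fun do rewrite integralE.
have mh' : measurable_fun [set: X] (EFin \o h) by exact/measurable_EFinP.
apply: emeasurable_funB; apply: measurable_intL => //.
- exact: measurable_funepos.
- exact: measurable_funeneg.
Qed.

End signed_integrals.

Lemma mnormalizeE {d} {T : measurableType d} {R : realType}
  (mu : {measure set T -> \bar R}) (P : probability T R) (c : R) A :
  mu setT = c%:E -> 0 < c -> mnormalize mu P A = ((c^-1)%:E * mu A)%E.
Proof.
by move=> muc c0; rewrite /mnormalize muc eqe gt_eqF//= muleC.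
Qed.

Section variance_term.
Context {dX dY} {X : measurableType dX} {Y : measurableType dY} {R : realType}.
Variables (M : model X Y R) (chi : probability X R) (y : int -> Y) (X0 : set X).
Hypothesis mX0 : measurable X0.
Hypothesis nX0 : null M chi (~` X0).
Hypothesis absX0 : forall x, X0 x -> Q M x (~` X0) = 0%E.
Variable ag : int -> R.
Hypothesis hg : forall l z, X0 z -> g M (z, y l) <= expR (ag l).

Local Notation Pr := (obs_int M chi y ag).
Local Notation Lr := (obs_op M y X0 ag).
Local Notation obs := (obs y).

Lemma take_obs k n : (k <= n)%N -> take k (obs 0 n) = obs 0 k.
Proof.
move=> kn; rewrite -(subnKC kn) obs_cat take_size_cat//.
by rewrite size_obs.
Qed.

Lemma drop_obs k n : (k <= n)%N -> drop k (obs 0 n) = obs k%:Z (n - k).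
Proof.
move=> kn; rewrite -[in LHS](subnKC kn) obs_cat drop_size_cat ?add0r//.
by rewrite size_obs.
Qed.

Lemma Pr_mass n : muL M chi (obs 0 n) setT = (Pr n (fun=> 1))%:E.
Proof. by rewrite (Pr_EFin mX0 nX0 absX0 hg)// integral_cst// mul1e. Qed.

Lemma ge0_integral_predictor n (F : X -> \bar R) : 0 < Pr n (fun=> 1) ->
  (forall x, 0 <= F x)%E -> measurable_fun [set: X] F ->
  (\int[predictor M chi (obs 0 n)]_x F x =
   ((Pr n (fun=> 1))^-1)%:E * \int[muL M chi (obs 0 n)]_x F x)%E.
Proof.
move=> p0 F0 mF; have pi0 : 0 <= (Pr n (fun=> 1))^-1 by rewrite invr_ge0 ltW.
rewrite -[X in (_ = X%:E * _)%E]/((NngNum pi0)%:num) -ge0_integral_mscale//.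
apply: eq_measure_integral => A mA _.
exact: (mnormalizeE _ _ (Pr_mass n)).
Qed.

Lemma Rint_predictor n (h : X -> R) : 0 < Pr n (fun=> 1) -> bm h ->
  (\int[predictor M chi (obs 0 n)]_x (h x)%:E = (Pr n h / Pr n (fun=> 1))%:E)%E.
Proof.
move=> p0 bh; have [B hB] := bm_nneg bh.
have bhB : bm (fun x => h x + B) by exact: bm_add.
have mhB : measurable_fun setT (fun x => (h x + B)%:E).
  by apply/measurable_EFinP; exact: bhB.1.
have hB' x : (0 <= (h x + B)%:E)%E by rewrite lee_fin.
have := ge0_integral_predictor p0 hB' mhB.
rewrite -(Pr_EFin mX0 nX0 absX0 hg)// -Rint_EFin// bm_RintD// bm_Rint_cst -EFinM.
have -> : fine (predictor M chi (obs 0 n) setT) = 1.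
  by transitivity (fine (1%:E : \bar R)) => //; congr fine; exact: probability_setT.
rewrite mulr1 Pr_lin// -Rint_EFin// => e; have e' := EFin_inj e.
congr (_%:E); apply: (addIr B); rewrite e'; field; exact: lt0r_neq0.
Qed.

Lemma int_L_Lr k n (h : X -> R) x : bm h -> X0 x ->
  (\int[L M (obs k n) x]_z (h z)%:E = (Lr k n h x)%:E)%E.
Proof. by move=> bh X0x; rewrite (Lr_EFin mX0 absX0 hg). Qed.

Lemma L_Lr k n x : X0 x -> L M (obs k n) x setT = (Lr k n (fun=> 1) x)%:E.
Proof.
by move=> X0x; rewrite -int_L_Lr// integral_cst// mul1e.
Qed.

(** All the normalizing constants are gathered in a power of the total mass
    [obs_int n 1]. *)
Lemma variance_term n k (h : X -> R) : (k <= n)%N -> bm h ->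
  0 < Pr k (fun=> 1) -> 0 < Pr n (fun=> 1) ->
  (\int[predictor M chi (take k (obs 0 n))]_x
      ((\int[L M (drop k (obs 0 n)) x]_z (h z)%:E
        - (\int[predictor M chi (obs 0 n)]_z (h z)%:E)
           * L M (drop k (obs 0 n)) x setT)
       / muL M (predictor M chi (take k (obs 0 n))) (drop k (obs 0 n)) setT) ^+ 2)%E =
  (Pr k (fun=> 1) * Pr k (fun x => (Lr k%:Z (n - k) h x * Pr n (fun=> 1) -
      Pr n h * Lr k%:Z (n - k) (fun=> 1) x) ^+ 2) / Pr n (fun=> 1) ^+ 4)%:E.
Proof.
move=> kn bh pk pn; rewrite take_obs// drop_obs//.
set p := Pr k (fun=> 1) in pk *; set q := Pr n (fun=> 1) in pn *.
have mLT : measurable_fun setT (fun x => L M (obs k%:Z (n - k)) x setT) by exact: measurable_LA.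
have den : muL M (predictor M chi (obs 0 k)) (obs k%:Z (n - k)) setT = (q / p)%:E.
  rewrite -[LHS]/(\int[predictor M chi (obs 0 k)]_x L M (obs k%:Z (n - k)) x setT)%E.
  rewrite ge0_integral_predictor// -muL_cat//.
  have -> : obs 0 k ++ obs k%:Z (n - k) = obs 0 n.
    by rewrite -{2}(subnKC kn) obs_cat add0r.
  by rewrite Pr_mass -EFinM mulrC.
rewrite den Rint_predictor//.
have mh := bh.1.
pose G x := (((\int[L M (obs k%:Z (n - k)) x]_z (h z)%:E -
    (Pr n h / q)%:E * L M (obs k%:Z (n - k)) x setT) / (q / p)%:E) ^+ 2)%E.
have mG : measurable_fun setT G.
  rewrite /G; under eq_fun do rewrite expe2.
  have m1 : measurable_fun setT (fun x => (\int[L M (obs k%:Z (n - k)) x]_z (h z)%:E -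
    (Pr n h / q)%:E * L M (obs k%:Z (n - k)) x setT) / (q / p)%:E)%E.
    apply: emeasurable_funM => //; apply: emeasurable_funB.
      exact: measurable_intL_signed.
    exact: measurable_funeM.
  exact: emeasurable_funM.
have G0 x : (0 <= G x)%E by rewrite /G expe2; exact: sqre_ge0.
rewrite -/G ge0_integral_predictor//.
pose Gam x := (Lr k%:Z (n - k) h x * q - Pr n h * Lr k%:Z (n - k) (fun=> 1) x) ^+ 2.
have bL f : bm f -> bm (Lr k%:Z (n - k) f) by move=> bf; exact: bm_Lr.
have bGam : bm Gam.
  rewrite /Gam; under eq_fun do rewrite expr2.
  have b1 : bm (fun x => Lr k%:Z (n - k) h x * q - Pr n h * Lr k%:Z (n - k) (fun=> 1) x).
    by apply: bm_sub; apply: bm_mul => //; exact: bL.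
  exact: bm_mul.
have GE x : X0 x -> G x = ((p ^+ 2 / q ^+ 4) * Gam x)%:E.
  move=> X0x; rewrite /G int_L_Lr// L_Lr// inver gt_eqF ?divr_gt0//.
  transitivity (((Lr k%:Z (n - k) h x - Pr n h / q * Lr k%:Z (n - k) (fun=> 1) x) *
    (q / p)^-1) ^+ 2)%:E; first by [].
  congr (_%:E); rewrite /Gam.
  by field; rewrite !gt_eqF.
have bcG : bm (fun x => p ^+ 2 / q ^+ 4 * Gam x) by exact: bm_mul.
rewrite (ae_eq_int_core mX0 (f2 := fun x => (p ^+ 2 / q ^+ 4 * Gam x)%:E)
   (muL_core mX0 nX0 absX0 _))//; last 2 first.
- move=> x; rewrite lee_fin; apply: mulr_ge0; last exact: sqr_ge0.
  by apply: divr_ge0; apply: exprn_ge0; exact: ltW.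
- by apply/measurable_EFinP; exact: bcG.1.
rewrite -(Pr_EFin mX0 nX0 absX0 hg)// -EFinM; congr _%:E.
have -> : Pr k (fun x => p ^+ 2 / q ^+ 4 * Gam x) = p ^+ 2 / q ^+ 4 * Pr k Gam.
  by rewrite /obs_int bm_RintZ.
rewrite -[Pr k (fun x => (_ - _) ^+ 2)]/(Pr k Gam).
rewrite -/p; move: (Pr k Gam) => I; clearbody p q.
by field; rewrite !gt_eqF.
Qed.

End variance_term.

(** * The asymptotic variance along one trajectory *)

Lemma geometric_sum_le {R : realType} (q : R) n : 0 <= q < 1 ->
  \sum_(i < n) q ^+ i <= (1 - q)^-1.
Proof.
move=> /andP[q0 q1]; have q' : 0 < 1 - q by lra.
suff h : (1 - q) * \sum_(i < n) q ^+ i <= 1.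
  by rewrite -[leRHS]mul1r ler_pdivlMr// mulrC.
rewrite -[leLHS]opprK -mulNr opprB -subrX1 opprB.
by rewrite gerBl exprn_ge0.
Qed.

Lemma quotient_sum_le {R : realType} (b : R) (r n : nat) : 0 < b -> (0 < r)%N ->
  \sum_(i < n) expR (- (b * (i %/ r)%:R)) <= expR b / (1 - expR (- (b / r%:R))).
Proof.
move=> b0 r0; have r0' : 0 < (r%:R : R) by rewrite ltr0n.
have q01 : 0 <= expR (- (b / r%:R)) < 1.
  apply/andP; split; first exact: expR_ge0.
  by rewrite expR_lt1 oppr_lt0 divr_gt0.
apply: (@le_trans _ _ (\sum_(i < n) expR b * expR (- (b / r%:R)) ^+ i)).
  apply: ler_sum => i _; rewrite -expRM_natl -expRD ler_expR.
  have h : (i%:R : R) <= r%:R * (i %/ r)%:R + r%:R.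
    by rewrite -natrM -natrD ler_nat -mulnSr mulnC ltnW// ltn_ceil.
  have h2 : b / r%:R * i%:R <= b / r%:R * (r%:R * (i %/ r)%:R + r%:R).
    by rewrite ler_wpM2l// ltW// divr_gt0.
  have h3 : b / r%:R * (r%:R * (i %/ r)%:R + r%:R) = b * (i %/ r)%:R + b.
    by field; rewrite gt_eqF.
  by rewrite h3 in h2; lra.
by rewrite -mulr_sumr ler_wpM2l ?expR_ge0// geometric_sum_le.
Qed.

Section trajectory_bound.
Context {dX dY} {X : measurableType dX} {Y : measurableType dY} {R : realType}.
Variables (M : model X Y R) (chi : probability X R) (y : int -> Y) (X0 : set X).
Hypothesis mX0 : measurable X0.
Hypothesis nX0 : null M chi (~` X0).
Hypothesis absX0 : forall x, X0 x -> Q M x (~` X0) = 0%E.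
Variable ag : int -> R.
Hypothesis ag0 : forall l, 0 <= ag l.
Hypothesis hg : forall l z, X0 z -> g M (z, y l) <= expR (ag l).

Local Notation Pr := (obs_int M chi y ag).
Local Notation Lr := (obs_op M y X0 ag).
Local Notation Kobs := (Kobs M y X0 ag).
Local Notation obs := (obs y).
Local Notation asg := (asg ag).

Lemma Pr_ext n (f1 f2 : X -> R) : bm f1 -> bm f2 ->
  (forall x, X0 x -> f1 x = f2 x) -> Pr n f1 = Pr n f2.
Proof.
move=> b1 b2 f12; apply/eqP; rewrite -subr_eq0 -normr_eq0.
have b12 : bm (fun x => f1 x - f2 x) by exact: bm_sub.
have ba : bm (fun x => `|f1 x - f2 x|) by exact: bm_abs.
have -> : Pr n f1 - Pr n f2 = Pr n (fun x => f1 x - f2 x) by rewrite /obs_int bm_RintB.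
rewrite eq_le normr_ge0 andbT; apply: (le_trans (bm_Rint_norm _ b12)).
rewrite -[leLHS]/(Pr n (fun x => `|f1 x - f2 x|)) -lee_fin.
rewrite (Pr_EFin mX0 nX0 absX0 hg n ba).
rewrite (ae_eq_int_core mX0 (f2 := fun=> 0%E) (muL_core mX0 nX0 absX0 _)).
- by rewrite integral0.
- by move=> x; rewrite lee_fin.
- by [].
- by apply/measurable_EFinP; exact: ba.1.
- exact: measurable_cst.
- by move=> x X0x; rewrite f12// subrr normr0.
Qed.

Variables (r : nat) (C D : set X).
Hypothesis r0 : (0 < r)%N.
Hypothesis mC : measurable C.
Hypothesis mD : measurable D.
Variables (kT : int -> bool) (dT : int -> R) (e th0 : R).
Hypothesis dT0 : forall t, 0 <= dT t.
Hypothesis hd : forall t x, X0 x -> D x ->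
  ((expR (- dT t))%:E <= L M (obs t r) x D)%E.
Hypothesis hdoeb : forall t, kT t ->
  exists (mu : probability X R) (phi : X -> R), (forall x, 0 < phi x) /\
    forall x A, C x -> measurable A ->
      ((e * phi x)%:E * mu A <= L M (obs t r) x (A `&` C))%E /\
      (L M (obs t r) x (A `&` C) <= (phi x)%:E * mu A)%E.
Hypothesis hout : forall t x, kT t -> X0 x -> ~ C x ->
  (L M (obs t r) x setT <= (expR (- (th0 *+ 2)))%:E)%E.

Section anchor.
Variable N : int.

Definition bt (i : nat) : int := N - (i.+1 * r)%:Z.
Definition Kb i := Kobs (bt i) r.

Lemma L_sub_core s x A : X0 x -> measurable A ->
  L M s x (A `&` X0) = L M s x A.
Proof.
move=> X0x mA; have mAX : measurable (A `&` X0) by exact: measurableI.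
have mAY : measurable (A `&` ~` X0) by apply: measurableI => //; exact: measurableC.
have e0 : L M s x (A `&` ~` X0) = 0%E.
  apply/eqP; rewrite eq_le measure_ge0 andbT.
  apply: (@le_trans _ _ (L M s x (~` X0))).
    by rewrite le_measure ?inE//; exact: measurableC.
  by rewrite le_eqVlt; apply/orP; left; apply/eqP; exact: L_core mX0 absX0 _ _ X0x.
symmetry; transitivity (L M s x ((A `&` X0) `|` (A `&` ~` X0))).
  by rewrite -setIUr setUv setIT.
transitivity (L M s x (A `&` X0) + L M s x (A `&` ~` X0))%E.
  by apply: measureU => //; rewrite setIACA setICr setI0.
transitivity (L M s x (A `&` X0) + 0)%E; last exact: adde0.
by congr (_ + _)%E.
Qed.

Lemma Kb_eq i x A : X0 x -> Kb i x A = L M (obs (bt i) r) x A.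
Proof. by move=> X0x; apply: killedE => //; exact: (L_obs_mass mX0 absX0 hg). Qed.

Lemma Kb_out i x A : ~ X0 x -> Kb i x A = 0%E.
Proof. by move=> nX; exact: killed0. Qed.

Lemma Kb_doeblin i : kT (bt i) -> doeblin e (C `&` X0) (Kb i).
Proof.
move=> /hdoeb [mu [phi [phi0 h]]]; exists mu, phi; split => // x A [Cx X0x] mA.
have [h1 h2] := h x A Cx mA.
have E : Kb i x (A `&` (C `&` X0)) = L M (obs (bt i) r) x (A `&` C).
  by rewrite Kb_eq// setIA L_sub_core//; exact: measurableI.
by rewrite E.
Qed.

Lemma Kb_outC i x : kT (bt i) -> x \notin C `&` X0 ->
  (Kb i x setT <= (expR (- (th0 *+ 2)))%:E)%E.
Proof.
move=> ki /negP; rewrite inE => nC.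
have [X0x|nX] := pselect (X0 x); last first.
  apply: (@le_trans _ _ 0%E); last by rewrite lee_fin expR_ge0.
  by rewrite le_eqVlt; apply/orP; left; apply/eqP; exact: Kb_out.
apply: (@le_trans _ _ (L M (obs (bt i) r) x setT)).
  by rewrite le_eqVlt; apply/orP; left; apply/eqP; exact: Kb_eq.
by apply: hout => // Cx; apply: nC.
Qed.

Lemma Kb_D i x : (D `&` X0) x -> ((expR (- dT (bt i)))%:E <= Kb i x (D `&` X0))%E.
Proof.
move=> [Dx X0x]; apply: (le_trans (hd _ X0x Dx)).
rewrite le_eqVlt; apply/orP; left; apply/eqP.
transitivity (L M (obs (bt i) r) x (D `&` X0)); first by rewrite L_sub_core.
by symmetry; exact: Kb_eq.
Qed.

Lemma W_Lr j t (f : X -> R) x : bm f -> X0 x ->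
  W Kb j t f x = Lr (N - ((j + t) * r)%:Z) (t * r)%N f x.
Proof.
move=> bf; elim: t x => [|t IH] x X0x.
  apply: EFin_inj; rewrite (Lr_EFin mX0 absX0 hg)//= (integral_L_nil M)//.
  by apply/measurable_EFinP; exact: bf.1.
rewrite mulSn (Lr_comp mX0 absX0 hg)// /=.
rewrite (_ : N - ((j + t.+1) * r)%:Z + r%:Z = N - ((j + t) * r)%:Z); last first.
  by rewrite addnS mulSn PoszD; ring.
rewrite addnS -/(bt (j + t)) /obs_op -/(obs_op _ _ _ _ _ _ _) -/(Kb (j + t)).
have bW : bm (W Kb j t f).
  exact: (W_bm (fun i => mKobs M y mX0 ag (bt i) r) (fun i => Kobs_mass M y X0 ag (bt i) r)).
have bL : bm (Lr (N - ((j + t) * r)%:Z) (t * r)%N f) by exact: bm_Lr.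
apply/eqP; rewrite -subr_eq0 -bm_RintB//.
rewrite -normr_eq0 eq_le normr_ge0 andbT.
have b12 : bm (fun z => W Kb j t f z - Lr (N - ((j + t) * r)%:Z) (t * r)%N f z) by exact: bm_sub.
apply: (le_trans (bm_Rint_norm _ b12)).
have ba := bm_abs b12.
rewrite -lee_fin Rint_EFin//.
have K0 : Kb (j + t) x (~` X0) = 0%E.
  by rewrite Kb_eq//; exact: (L_core mX0 absX0 _ X0x).
rewrite (ae_eq_int_core mX0 (f2 := fun=> 0%E) K0).
- by rewrite integral0.
- by move=> z; rewrite lee_fin.
- by [].
- by apply/measurable_EFinP; exact: ba.1.
- exact: measurable_cst.
- by move=> z X0z; rewrite IH// subrr normr0.
Qed.

End anchor.

(** The abstract predictor is that of the model when the first [l] observations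
    are absorbed in the initial law. *)
Lemma mint_Pr l J j (N : int) (f : X -> R) : bm f -> (j <= J)%N ->
  N = (l + J * r)%N%:Z ->
  mint (Kb N) (pobs M chi y ag l) J j f = Pr (l + (J - j) * r)%N f.
Proof.
move=> bf jJ NE; rewrite (Pr_comp mX0 nX0 absX0 hg _ _ bf).
rewrite -[LHS]/(Pr l (W (Kb N) j (J - j) f)).
apply: Pr_ext.
- exact: (W_bm (fun i => mKobs M y mX0 ag (bt N i) r) (fun i => Kobs_mass M y X0 ag (bt N i) r)).
- exact: bm_Lr.
- move=> x X0x; rewrite (W_Lr N j (J - j) bf X0x).
  suff -> : N - ((j + (J - j)) * r)%N%:Z = l%:Z by [].
  by rewrite NE subnKC// PoszD addrK.
Qed.

Lemma Lr_norm_le k n (h : X -> R) H x : bm h -> (forall z, `|h z| <= H) ->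
  `|Lr k n h x| <= H * Lr k n (fun=> 1) x.
Proof.
move=> bh hH; apply: (le_trans (bm_Rint_norm _ bh)).
rewrite /obs_op -bm_RintZ//; apply: bm_Rint_le.
- exact: bm_abs.
- exact: bm_mul.
- by move=> z; rewrite mulr1.
Qed.

Variables (E delta c vth H : R) (n0 q2 : nat) (x0 : X).
Hypothesis e01 : 0 < e <= 1.
Hypothesis E0 : 0 <= E.
Hypothesis delta0 : 0 <= delta.
Hypothesis c0 : 0 <= c.
Hypothesis q2_gt0 : (0 < q2)%N.
Hypothesis n0_ge10 : (10 <= n0)%N.
Hypothesis hn0c : 100 * c <= n0%:R.
Hypothesis hn0e : expR (- n0%:R) <= e ^+ 2 / 2.
Hypothesis hdelta : 100 * delta * (q2%:R + 1) <= 1.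
Hypothesis hth0 : 70 * E + 110 <= th0.
Hypothesis vth01 : 0 < vth <= 1.
Hypothesis hvth : 1 - e ^+ 2 <= expR (- vth).
Hypothesis hq2 : 16 * (2 * E + 4) <= vth * q2%:R.
Hypothesis Dx0 : D x0.
Hypothesis X0x0 : X0 x0.

Definition var_const : R :=
  4 * H ^+ 2 * expR (vth * (1 + 2 * c) + (2 * E + 4) * n0%:R) *
    (1 + expR ((E + 3) * n0%:R)) ^+ 2.

Section at_time.
Variables (n : nat) (h : X -> R).
Hypothesis bh : bm h.
Hypothesis H0 : 0 <= H.
Hypothesis hH : forall x, `|h x| <= H.
Hypothesis hS : forall s, (s < r)%N -> (s <= n)%N -> forall i t,
  asum (fun i => asg (bt (n - s)%N%:Z i) r) i t + asum (fun i => dT (bt (n - s)%N%:Z i)) i t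
    <= E * t%:R + delta * (i + t)%:R + c.
Hypothesis hk : forall s, (s < r)%N -> (s <= n)%N -> forall i t,
  5 / 8 * t%:R - delta * (i + t)%:R - c <= ksum (fun i => kT (bt (n - s)%N%:Z i)) i t.
Hypothesis term_hi : forall s, (s < r)%N -> (s <= n)%N -> asg (n - s)%N%:Z s <= c.
Hypothesis term_lo : forall s, (s < r)%N -> (s <= n)%N -> forall x, X0 x -> D x ->
  ((expR (- c))%:E <= L M (obs (n - s)%N%:Z s) x setT)%E.
Hypothesis init : forall l, (l < r)%N ->
  Pr l (fun=> 1) <= expR c * Pr l (\1_(D `&` X0)) /\ 0 < Pr l (\1_(D `&` X0)).

(** The [n - k] last observations are [j] complete blocks followed by [s < r]
    observations. The latter enter through the terminal function
    [f = L<y_(n-s)^(n-1)> 1], and the first [l < r] observations, which do not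
    fill a block, through the initial law. *)
Lemma term_bound k : (k <= n)%N ->
  [/\ 0 < Pr k (fun=> 1), 0 < Pr n (fun=> 1) &
  Pr k (fun=> 1) * Pr k (fun x => (Lr k%:Z (n - k) h x * Pr n (fun=> 1) -
      Pr n h * Lr k%:Z (n - k) (fun=> 1) x) ^+ 2) <=
  var_const * expR (- (vth / 16 * ((n - k) %/ r)%:R)) * Pr n (fun=> 1) ^+ 4].
Proof.
move=> kn; pose s := ((n - k) %% r)%N; pose j := ((n - k) %/ r)%N.
have sr : (s < r)%N by rewrite ltn_mod.
have ejs : (n - k = j * r + s)%N by exact: divn_eq.
have sn : (s <= n)%N by apply: leq_trans (leq_subr k n); rewrite ejs leq_addl.
pose N := (n - s)%N; pose l := (N %% r)%N; pose J := (N %/ r)%N.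
have lr : (l < r)%N by rewrite ltn_mod.
have NJ : N = (l + J * r)%N by rewrite addnC; exact: divn_eq.
have Nk : N = (k + j * r)%N.
  by apply/eqP; rewrite -(eqn_add2r s) /N subnK// -addnA -ejs subnKC.
have jJ : (j <= J)%N.
  by rewrite /J leq_divRL// Nk leq_addl.
have kl : (l + (J - j) * r = k)%N.
  apply/eqP; rewrite -(eqn_add2r (j * r)) -addnA -mulnDl subnK//.
  by rewrite -NJ Nk.
have bf : bm (Lr N%:Z s (fun=> 1)) by exact: bm_Lr.
have bLh : bm (Lr N%:Z s h) by exact: bm_Lr.
have mCX : measurable (C `&` X0) by exact: measurableI.
have mDX : measurable (D `&` X0) by exact: measurableI.
have mi1 : mint (Kb N%:Z) (pobs M chi y ag l) J j (fun=> 1) = Pr k (fun=> 1).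
  exact: (etrans (mint_Pr (bm_cst 1) jJ (congr1 Posz NJ)) (congr1 (fun q => Pr q (fun=> 1)) kl)).
have nN : n = (N + s)%N by rewrite /N subnK.
have Pr_split f : bm f -> Pr n f = Pr N (Lr N%:Z s f).
  by move=> b; rewrite [in LHS]nN; exact: (Pr_comp mX0 nX0 absX0 hg _ _ b).
have mi0g (f' : X -> R) v : bm f' -> v = Pr N f' ->
    mint (Kb N%:Z) (pobs M chi y ag l) J 0 f' = v.
  move=> b ->; transitivity (Pr (l + (J - 0) * r)%N f').
    exact: (mint_Pr b (leq0n J) (congr1 Posz NJ)).
  by congr (obs_int _ _ _ _ _ _); rewrite subn0 -NJ.
have mi0 : mint (Kb N%:Z) (pobs M chi y ag l) J 0 (Lr N%:Z s (fun=> 1)) = Pr n (fun=> 1).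
  exact: (mi0g _ _ bf (Pr_split _ (bm_cst 1))).
have mih : mint (Kb N%:Z) (pobs M chi y ag l) J 0 (Lr N%:Z s h) = Pr n h.
  exact: (mi0g _ _ bLh (Pr_split _ bh)).
have [minit mpos] := init lr.
have fhi x : 0 <= Lr N%:Z s (fun=> 1) x <= expR c.
  apply/andP; split; first exact: Rint_ge0.
  have [X0x|nX] := pselect (X0 x); last by rewrite Lr_out// expR_ge0.
  rewrite -lee_fin -(L_Lr mX0 absX0 hg)//.
  apply: (le_trans (L_obs_mass mX0 absX0 hg N%:Z s X0x)).
  by rewrite lee_fin ler_expR; exact: term_hi.
have flo x : expR (- c) * \1_(D `&` X0) x <= Lr N%:Z s (fun=> 1) x.
  have [[Dx X0x]|nDX] := pselect ((D `&` X0) x); last first.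
    rewrite indicE memNset// mulr0; exact: Rint_ge0.
  rewrite indicE mem_set ?mulr1; last by split.
  rewrite -lee_fin -(L_Lr mX0 absX0 hg)//; exact: term_lo.
have mK' := fun i => mKobs M y mX0 ag (bt N%:Z i) r.
have Ka' := fun i => Kobs_mass M y X0 ag (bt N%:Z i) r.
have a0' i : 0 <= asg (bt N%:Z i) r by rewrite asgE sumr_ge0.
have DX0 : (D `&` X0) x0 by split.
have Kd' i x := @Kb_D N%:Z i x.
have hDoeb i := @Kb_doeblin N%:Z i.
have hOut i x := @Kb_outC N%:Z i x.
have hh x : `|Lr N%:Z s h x| <= H * Lr N%:Z s (fun=> 1) x by exact: Lr_norm_le.
have v01 : 0 <= vth <= 1 by have /andP[a b] := vth01; rewrite (ltW a).
have p1 := mint_1_gt0 mK' Ka' mDX Kd' mpos jJ.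
have p2 := mint0_gt0 mK' Ka' a0' (fun i => dT0 (bt N%:Z i)) mCX mDX DX0 e01
  hDoeb hOut Kd' E0 delta0 c0 q2_gt0 n0_ge10 hn0c hn0e hdelta hth0 (hS sr sn) (hk sr sn)
  J minit mpos bf flo.
have vb := variance_bound mK' Ka' a0' (fun i => dT0 (bt N%:Z i)) mCX mDX DX0 e01
  hDoeb hOut Kd' E0 delta0 c0 q2_gt0 n0_ge10 hn0c hn0e hdelta hth0 (hS sr sn) (hk sr sn)
  minit mpos bf fhi flo bLh H0 hh v01 hvth hq2 jJ.
have p1' : 0 < Pr k (fun=> 1) by rewrite -mi1.
have p2' : 0 < Pr n (fun=> 1) by rewrite -mi0.
suff e3 : Pr k (fun x => (Lr k%:Z (n - k) h x * Pr n (fun=> 1) -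
      Pr n h * Lr k%:Z (n - k) (fun=> 1) x) ^+ 2) =
    mint (Kb N%:Z) (pobs M chi y ag l) J j (fun x =>
      (W (Kb N%:Z) 0 j (Lr N%:Z s h) x * mint (Kb N%:Z) (pobs M chi y ag l) J 0 (Lr N%:Z s (fun=> 1)) -
       mint (Kb N%:Z) (pobs M chi y ag l) J 0 (Lr N%:Z s h) * W (Kb N%:Z) 0 j (Lr N%:Z s (fun=> 1)) x) ^+ 2).
  split; [exact: p1'|exact: p2'|].
  by rewrite e3 -[X in X * _]mi1 -[X in _ * X ^+ 4]mi0; exact: vb.
have bW (F : X -> R) : bm F -> bm (W (Kb N%:Z) 0 j F) by exact: (W_bm mK' Ka').
have bsq (F G : X -> R) (u v : R) : bm F -> bm G -> bm (fun x => (F x * u - v * G x) ^+ 2).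
  move=> bF bG; under eq_fun do rewrite expr2.
  have b : bm (fun x => F x * u - v * G x) by apply: bm_sub; apply: bm_mul => //; exact: bm_cst.
  exact: bm_mul.
have WL (F : X -> R) x : bm F -> X0 x ->
    W (Kb N%:Z) 0 j (Lr N%:Z s F) x = Lr k%:Z (n - k) F x.
  move=> bF X0x; have bLF : bm (Lr N%:Z s F) by exact: bm_Lr.
  rewrite (W_Lr N%:Z 0 j bLF X0x) ejs.
  rewrite (Lr_comp mX0 absX0 hg k%:Z _ _ bF).
  have -> : N%:Z - ((0 + j) * r)%N%:Z = k%:Z by rewrite add0n Nk PoszD addrK.
  by rewrite Nk PoszD.
rewrite mi0 mih (mint_Pr (bsq _ _ _ _ (bW _ bLh) (bW _ bf)) jJ (congr1 Posz NJ)) kl.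
apply: Pr_ext.
- by apply: bsq; exact: bm_Lr.
- exact: (bsq _ _ _ _ (bW _ bLh) (bW _ bf)).
- by move=> x X0x; rewrite !WL.
Qed.

Lemma asymptotic_variance_bound :
  (`|asymptotic_variance M chi (obs 0 n) h| <=
   (var_const * (expR (vth / 16) / (1 - expR (- (vth / 16 / r%:R)))))%:E)%E.
Proof.
have v0 : 0 < vth / 16 by have /andP[a _] := vth01; rewrite divr_gt0.
have ter k : (k <= n)%N -> exists2 u : R, 0 <= u <= var_const * expR (- (vth / 16 * ((n - k) %/ r)%:R)) &
   (\int[predictor M chi (take k (obs 0 n))]_x
      ((\int[L M (drop k (obs 0 n)) x]_z (h z)%:E
        - (\int[predictor M chi (obs 0 n)]_z (h z)%:E)
           * L M (drop k (obs 0 n)) x setT)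
       / muL M (predictor M chi (take k (obs 0 n))) (drop k (obs 0 n)) setT) ^+ 2)%E = u%:E.
  move=> kn; have [pk pn tb] := term_bound kn.
  rewrite (variance_term mX0 nX0 absX0 hg kn bh pk pn); eexists; last by [].
  rewrite ler_pdivrMr ?exprn_gt0// tb andbT.
  rewrite divr_ge0 ?exprn_ge0 ?(ltW pn)// mulr_ge0 ?(ltW pk)//.
  by apply: Rint_ge0 => x; exact: sqr_ge0.
pose T k := (\int[predictor M chi (take k (obs 0 n))]_x
      ((\int[L M (drop k (obs 0 n)) x]_z (h z)%:E
        - (\int[predictor M chi (obs 0 n)]_z (h z)%:E)
           * L M (drop k (obs 0 n)) x setT)
       / muL M (predictor M chi (take k (obs 0 n))) (drop k (obs 0 n)) setT) ^+ 2)%E.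
have -> : asymptotic_variance M chi (obs 0 n) h = (\sum_(0 <= k < n.+1) T k)%E.
  by rewrite /asymptotic_variance size_obs.
have {}ter k : (k <= n)%N -> exists2 u : R,
    0 <= u <= var_const * expR (- (vth / 16 * ((n - k) %/ r)%:R)) & T k = u%:E by exact: ter.
clearbody T; have T0 k : (k <= n)%N -> (0 <= T k)%E.
  by move=> /ter[u /andP[u0 _] ->]; rewrite lee_fin.
rewrite big_mkord gee0_abs; last by apply: sume_ge0 => k _; apply: T0; rewrite -ltnS.
apply: (@le_trans _ _ (\sum_(k < n.+1) (var_const * expR (- (vth / 16 * ((n - k) %/ r)%:R)))%:E)%E).
  apply: lee_sum => k _; have /ter[u /andP[_ u1] ->] : (k <= n)%N by rewrite -ltnS.
  by rewrite lee_fin.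
rewrite sumEFin lee_fin -mulr_sumr ler_wpM2l//.
  rewrite /var_const; apply: mulr_ge0; last by rewrite exprn_ge0// addr_ge0// expR_ge0.
  by rewrite mulr_ge0 ?expR_ge0// mulr_ge0// exprn_ge0.
rewrite (reindex_inj rev_ord_inj) /=.
apply: le_trans (quotient_sum_le n.+1 v0 r0).
apply: ler_sum => i _; rewrite subSS subKn// -ltnS; exact: ltn_ord.
Qed.

End at_time.
End trajectory_bound.

(** * Measurability in the observations *)

Lemma measurable_inve {d} {T : measurableType d} {R : realType} (f : T -> \bar R) :
  (forall x, 0 <= f x)%E -> measurable_fun [set: T] f ->
  measurable_fun [set: T] (fun x => (f x)^-1)%E.
Proof.
move=> f0 mf; apply: (measurability _ (ErealGenOInfty.measurableE R)) => //= _ [_ [a ->] <-].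
rewrite setTI; have [a0|a0] := ltP a 0.
  rewrite (_ : _ @^-1` _ = setT)//; apply/seteqP; split=> // x _ /=.
  rewrite in_itv/= andbT; apply: (@lt_le_trans _ _ 0%E); first by rewrite lte_fin.
  by rewrite inve_ge0.
rewrite (_ : _ @^-1` _ = f @^-1` [set` `]-oo, (a%:E^-1)%E[ ]).
  by rewrite -[X in measurable X]setTI; apply: mf => //; exact: emeasurable_itv.
apply/seteqP; split=> x /=; rewrite !in_itv/= ?andbT inve_pgt ?inE ?lee_fin//.
Qed.

Section pulled_back.
Context {dS dX dY} {S : measurableType dS} {X : measurableType dX}
  {Y : measurableType dY} {R : realType}.
Variable M : model X Y R.

(** A kernel on the product with the parameter space, to which the theorem on
    measurability of parameterized integrals applies. *)
Definition Qsnd (z : S * X) : {measure set X -> \bar R} := Q M z.2.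

Lemma measurable_Qsnd A : measurable A -> measurable_fun [set: S * X] (Qsnd ^~ A).
Proof.
move=> mA; apply: (measurableT_comp (f := fun x => Q M x A)); last exact: measurable_snd.
exact: measurable_kernel.
Qed.

HB.instance Definition _ := isKernel.Build _ _ _ _ R Qsnd measurable_Qsnd.
Lemma QsndT z : Qsnd z setT = 1%E. Proof. exact: prob_kernel. Qed.
HB.instance Definition _ := Kernel_isProbability.Build _ _ _ _ _ Qsnd QsndT.

Local Open Scope ereal_scope.

Lemma measurable_Q_param (F : S * X -> \bar R) : (forall z, 0 <= F z) ->
  measurable_fun [set: S * X] F ->
  measurable_fun [set: S * X] (fun z => \int[Q M z.2]_x' F (z.1, x')).
Proof.
move=> F0 mF.
have mG : measurable_fun [set: (S * X) * X] (fun u : (S * X) * X => F (u.1.1, u.2)).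
  apply: (measurableT_comp mF); apply: measurable_fun_pair => //.
  exact: (measurableT_comp measurable_fst).
exact: (measurable_fun_integral_finite_kernel (fun u : (S * X) * X => F (u.1.1, u.2)) (Qsnd : R.-fker _ ~> _) (fun u => F0 _) mG).
Qed.

Implicit Types (ys : seq (S -> Y)).

Definition all_measurable ys := forall i, (i < size ys)%N ->
  forall y0, measurable_fun [set: S] (nth y0 ys i).

Lemma measurable_L_param ys (F : S * X -> \bar R) :
  all_measurable ys -> (forall z, 0 <= F z) -> measurable_fun [set: S * X] F ->
  measurable_fun [set: S * X]
    (fun z => \int[L M [seq f z.1 | f <- ys] z.2]_x' F (z.1, x')).
Proof.
move=> + F0 mF; have mF2 p : measurable_fun setT (fun x' => F (p, x')).
  by apply: measurableT_comp mF _; exact: measurable_pair1.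
elim: ys => [_|f ys IH mys] /=.
  by under eq_fun do rewrite (integral_L_nil M)// -surjective_pairing.
under eq_fun do rewrite integral_L_cons//.
have mf : measurable_fun setT f by exact: (mys 0%N erefl f).
have {}IH := IH (fun i ilt => mys i.+1 ilt).
have mg := @measurable_g _ _ _ _ _ M.
have mi : measurable_fun setT (fun z : S * X =>
    \int[Q M z.2]_z0 \int[L M [seq f0 z.1 | f0 <- ys] z0]_x' F (z.1, x')).
  apply: (measurable_Q_param _ IH) => z; exact: integral_ge0.
apply: emeasurable_funM; last exact: mi.
apply/measurable_EFinP; apply: (measurableT_comp mg).
apply: measurable_fun_pair; first exact: measurable_snd.
apply: (measurableT_comp mf); exact: measurable_fst.
Qed.
Variable chi : probability X R.

Lemma measurable_probability_param (F : S * X -> \bar R) : (forall z, 0 <= F z) ->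
  measurable_fun [set: S * X] F ->
  measurable_fun [set: S] (fun p => \int[chi]_x F (p, x)).
Proof. by move=> F0 mF; exact: (measurable_fun_fubini_tonelli_F (m2 := chi) F mF F0). Qed.

Lemma measurable_section_param (F : S * X -> \bar R) p :
  measurable_fun [set: S * X] F -> measurable_fun setT (fun x => F (p, x)).
Proof. by move=> mF; apply: measurableT_comp mF _; exact: measurable_pair1. Qed.

Lemma measurable_muL_param ys (F : S * X -> \bar R) :
  all_measurable ys -> (forall z, 0 <= F z) -> measurable_fun [set: S * X] F ->
  measurable_fun [set: S] (fun p => \int[muL M chi [seq f p | f <- ys]]_x F (p, x)).
Proof.
move=> mys F0 mF.
under eq_fun do rewrite (integral_muL _ _ _ (fun x => F0 (_, x)) (measurable_section_param _ mF)).
apply: (measurable_probability_param (F := fun z => \int[L M [seq f z.1 | f <- ys] z.2]_x' F (z.1, x'))).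
  by move=> z; exact: integral_ge0.
exact: measurable_L_param.
Qed.

(** Both cases of the normalization are needed, since measurability is claimed
    at every parameter and the mass may be infinite for some of them. *)
Lemma integral_predictorE s (F : X -> \bar R) : (forall x, 0 <= F x) ->
  measurable_fun [set: X] F ->
  \int[predictor M chi s]_x F x =
  (let m := \int[muL M chi s]_x 1 in
   if (m == 0) || (m == +oo) then \int[chi]_x F x
   else m^-1 * \int[muL M chi s]_x F x).
Proof.
move=> F0 mF; have mE : \int[muL M chi s]_x 1 = muL M chi s setT.
  by rewrite integral_cst// mul1e.
rewrite mE /=; case: ifPn => [h|].
  by apply: eq_measure_integral => A mA _; rewrite /predictor/= /mnormalize h.
rewrite negb_or => /andP[n0 noo].
have mfin : muL M chi s setT \is a fin_num by rewrite ge0_fin_numE// ltey.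
have m0 : (0 < fine (muL M chi s setT))%R by rewrite fine_gt0// lt0e n0 measure_ge0 ltey.
have i0 : (0 <= (fine (muL M chi s setT))^-1)%R by rewrite invr_ge0 ltW.
rewrite -(fineK mfin) inver gt_eqF//.
rewrite -[X in (_ = X%:E * _)%E]/((NngNum i0)%:num) -ge0_integral_mscale//.
apply: eq_measure_integral => A mA _.
by rewrite /predictor/= /mnormalize (negbTE n0) (negbTE noo)/= muleC.
Qed.

Lemma measurable_predictor_param ys (F : S * X -> \bar R) :
  all_measurable ys -> (forall z, 0 <= F z) -> measurable_fun [set: S * X] F ->
  measurable_fun [set: S] (fun p => \int[predictor M chi [seq f p | f <- ys]]_x F (p, x)).
Proof.
move=> mys F0 mF.
under eq_fun do rewrite (integral_predictorE _ (fun x => F0 (_, x)) (measurable_section_param _ mF)).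
have mm : measurable_fun [set: S] (fun p => \int[muL M chi [seq f p | f <- ys]]_x 1).
  by apply: (measurable_muL_param (F := fun=> 1)) => //; exact: measurable_cst.
have m0 (p : S) : 0 <= \int[muL M chi [seq f p | f <- ys]]_x 1 by exact: integral_ge0.
apply: measurable_fun_ifT.
- by apply: measurable_or; exact: measurable_fun_eqe.
- exact: measurable_probability_param.
- apply: emeasurable_funM; last exact: measurable_muL_param.
  exact: measurable_inve.
Qed.

Lemma measurable_signed_param (mu : S * X -> {measure set X -> \bar R}) (h : X -> R) :
  (forall f : X -> \bar R, (forall x, 0 <= f x) -> measurable_fun [set: X] f ->
    measurable_fun [set: S * X] (fun z => \int[mu z]_x f x)) ->
  measurable_fun [set: X] h ->
  measurable_fun [set: S * X] (fun z => \int[mu z]_x (h x)%:E).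
Proof.
move=> Hmu mh; under eq_fun do rewrite integralE.
have mh' : measurable_fun [set: X] (EFin \o h) by exact/measurable_EFinP.
apply: emeasurable_funB; apply: Hmu => //.
- exact: measurable_funepos.
- exact: measurable_funeneg.
Qed.

Lemma measurable_asymptotic_variance ys (h : X -> R) :
  all_measurable ys -> measurable_fun [set: X] h ->
  measurable_fun [set: S] (fun p => asymptotic_variance M chi [seq f p | f <- ys] h).
Proof.
move=> mys mh; rewrite /asymptotic_variance.
under eq_fun do rewrite size_map big_mkord.
apply: emeasurable_sum => k _ /=.
have mt : all_measurable (take k ys).
  move=> i; rewrite size_take_min leq_min => /andP[ik i_lt] y0.
  by rewrite nth_take//; exact: mys.
have md : all_measurable (drop k ys).
  by move=> i; rewrite size_drop ltn_subRL => i_lt y0; rewrite nth_drop; exact: mys.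
under eq_fun do rewrite -map_take -map_drop.
have msnd (f : X -> \bar R) : measurable_fun setT f -> measurable_fun setT (fun z : S * X => f z.2).
  by move=> mf; apply: (measurableT_comp mf); exact: measurable_snd.
have mfst (f : S -> \bar R) : measurable_fun setT f -> measurable_fun setT (fun z : S * X => f z.1).
  by move=> mf; apply: (measurableT_comp mf); exact: measurable_fst.
pose G (z : S * X) := ((\int[L M [seq f z.1 | f <- drop k ys] z.2]_x (h x)%:E
        - (\int[predictor M chi [seq f z.1 | f <- ys]]_x (h x)%:E)
            * L M [seq f z.1 | f <- drop k ys] z.2 setT)
       / muL M (predictor M chi [seq f z.1 | f <- take k ys]) [seq f z.1 | f <- drop k ys] setT) ^+ 2.
have mLT : measurable_fun [set: S * X] (fun z => L M [seq f z.1 | f <- drop k ys] z.2 setT).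
  have -> : (fun z : S * X => L M [seq f z.1 | f <- drop k ys] z.2 setT) =
      (fun z => \int[L M [seq f z.1 | f <- drop k ys] z.2]_x 1).
    by apply/funext => z; rewrite integral_cst// mul1e.
  apply: (measurable_L_param (F := fun=> 1)) => //; exact: measurable_cst.
have mG : measurable_fun [set: S * X] G.
  rewrite /G; under eq_fun do rewrite expe2.
  have m1 : measurable_fun [set: S * X] (fun z => (\int[L M [seq f z.1 | f <- drop k ys] z.2]_x (h x)%:E
        - (\int[predictor M chi [seq f z.1 | f <- ys]]_x (h x)%:E)
            * L M [seq f z.1 | f <- drop k ys] z.2 setT)
       / muL M (predictor M chi [seq f z.1 | f <- take k ys]) [seq f z.1 | f <- drop k ys] setT).
    apply: emeasurable_funM; [apply: emeasurable_funB; [|apply: emeasurable_funM]|].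
    - apply: (measurable_signed_param (mu := fun z => L M [seq f z.1 | f <- drop k ys] z.2)) => // f f0 mf.
      exact: (measurable_L_param (F := fun z => f z.2) md (fun z => f0 z.2) (msnd _ mf)).
    - apply: (measurable_signed_param (mu := fun z => predictor M chi [seq f z.1 | f <- ys])) => // f f0 mf.
      apply: (mfst (fun p => \int[predictor M chi [seq f p | f <- ys]]_x f x)).
      exact: (measurable_predictor_param (F := fun z => f z.2) mys (fun z => f0 z.2) (msnd _ mf)).
    - exact: mLT.
    - apply: measurable_inve; first by move=> z; exact: measure_ge0.
      apply: (mfst (fun p => muL M (predictor M chi [seq f p | f <- take k ys]) [seq f p | f <- drop k ys] setT)).
      exact: (measurable_predictor_param (F := fun z => L M [seq f z.1 | f <- drop k ys] z.2 setT) mt _ mLT).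
  exact: emeasurable_funM.
have G0 z : 0 <= G z by rewrite /G expe2; exact: sqre_ge0.
exact: (measurable_predictor_param (F := G) mt G0 mG).
Qed.

End pulled_back.

(** * Essential suprema through levels *)

Section lnpm.
Context {R : realType}.
Implicit Types (x : \bar R) (u : R).

Lemma lne_expR u : lne (expR u)%:E = u%:E.
Proof. by rewrite lne_EFin ?expR_gt0// expRK. Qed.

Lemma le_lnp u x : ((expR u)%:E <= x -> u%:E <= lnp x)%E.
Proof.
move=> h; rewrite /lnp le_max; apply/orP; left.
rewrite -lne_expR lee_lne// in_itv/= andbC/= ?leey ?lee_fin ?expR_ge0//.
by rewrite (le_trans _ h)// lee_fin expR_ge0.
Qed.

Lemma le_lnm u x : (0 <= x -> x <= (expR (- u))%:E -> u%:E <= lnm x)%E.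
Proof.
move=> x0 h; rewrite /lnm le_max; apply/orP; left.
rewrite leeNr -EFinN -lne_expR lee_lne// in_itv/= ?x0 ?leey//.
by rewrite lee_fin expR_ge0.
Qed.

Lemma lnm_ge0 x : (0 <= lnm x)%E.
Proof. by rewrite /lnm le_max lexx orbT. Qed.

Lemma lnp_ge0 x : (0 <= lnp x)%E.
Proof. by rewrite /lnp le_max lexx orbT. Qed.

Lemma lnm_fin x : (0 <= x -> lnm x < +oo -> (expR (- fine (lnm x)))%:E <= x)%E.
Proof.
move=> x0 xoo; rewrite leNgt; apply/negP => xlt.
have xe : (x < +oo)%E by rewrite (lt_trans xlt)// ltry.
have xf : x \is a fin_num by rewrite ge0_fin_numE.
move: xoo xlt x0; rewrite -(fineK xf); set t := fine x => xoo xlt t0.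
have [t1|t1] := eqVneq t 0.
  by move: xoo; rewrite t1 /lnm /lne lexx /= maxye.
have tp : 0 < t by rewrite lt_neqAle eq_sym t1.
have lE : lnm t%:E = (Num.max (- ln t) 0)%:E by rewrite /lnm lne_EFin// -EFinN EFin_max.
move: xlt; rewrite lE /= lte_fin -[t in (t < _)%R]lnK ?posrE// ltr_expR.
by apply/negP; rewrite -leNgt lerNl le_max lexx.
Qed.

End lnpm.

Section level.
Context {d} {T : measurableType d} {R : realType}.
Variable B : nat -> set T.

(** For a decreasing sequence of sets, the number of them that contain [t]. With
    [B k] the set of parameters at which a function exceeds [k] on a set that is
    not null, it is an essential supremum rounded up. It is measurable, which a
    supremum need not be. *)
Definition level (t : T) : \bar R := esups (fun k => (k.+1%:R * \1_(B k) t)%:E) 0.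

Lemma level_ge k t : B k t -> (k.+1%:R%:E <= level t)%E.
Proof.
move=> Bk; apply: ereal_sup_ubound; exists k => //.
by rewrite indicE mem_set// mulr1.
Qed.

Lemma level_ge0 t : (0 <= level t)%E.
Proof.
apply: (@le_trans _ _ (1%:R * \1_(B 0%N) t)%:E); first by rewrite lee_fin mul1r.
by apply: ereal_sup_ubound; exists 0%N.
Qed.

Lemma level_le (b : \bar R) t : (0 <= b)%E ->
  (forall k, B k t -> (k%:R%:E <= b)%E) -> (level t <= b + 1)%E.
Proof.
move=> b0 h; apply: ge_ereal_sup => _ [k _ <-].
have [Bk|nB] := pselect (B k t).
  by rewrite indicE mem_set// mulr1 -natr1 EFinD leeD2r// h.
by rewrite indicE memNset// mulr0 adde_ge0.
Qed.

Lemma level_fin t : (level t < +oo)%E -> exists2 n, ~ B n t & n%:R <= fine (level t).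
Proof.
move=> Loo; have Lf : level t \is a fin_num by rewrite ge0_fin_numE// level_ge0.
have : exists n, `[< ~ B n t >].
  apply: contrapT => /forallNP h.
  have Bn n : B n t by apply: contrapT => nB; apply: (h n); exact/asboolP.
  have := level_ge (Bn (Num.trunc (fine (level t)))).
  rewrite -(fineK Lf) lee_fin leNgt /=.
  by have /andP[_ ->] := trunc_itv (fine_ge0 (level_ge0 t)).
move=> ex; pose n := ex_minn ex.
exists n; first by rewrite /n; case: ex_minnP => m /asboolP.
rewrite /n; case: ex_minnP => -[|m] /asboolP nB mmin; first by rewrite fine_ge0// level_ge0.
rewrite -lee_fin fineK//; apply: level_ge; apply: contrapT => nBm.
by have := mmin m (introT (asboolP _) nBm); rewrite ltnn.
Qed.

Lemma measurable_level : (forall k, measurable (B k)) -> measurable_fun [set: T] level.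
Proof.
move=> mB; apply: measurable_fun_esups => k; apply/measurable_EFinP.
by apply: measurable_funM => //; exact: measurable_indic.
Qed.

Definition rlevel (t : T) : R := fine (level t).

Lemma rlevel_ge0 t : 0 <= rlevel t.
Proof. by rewrite fine_ge0// level_ge0. Qed.

Lemma measurable_rlevel : (forall k, measurable (B k)) -> measurable_fun [set: T] rlevel.
Proof. by move=> mB; apply: measurableT_comp => //; exact: measurable_level. Qed.

End level.
Arguments level {d T} R B t.
Arguments rlevel {d T} R B t.

Section nonnull.
Context {dS dX dY} {S : measurableType dS} {X : measurableType dX}
  {Y : measurableType dY} {R : realType}.
Variables (M : model X Y R) (chi : probability X R).

Definition nonnull (N : set (S * X)) : set S := [set t | ~ null M chi (xsection N t)].

Lemma measurable_nonnull N : measurable N -> measurable (nonnull N).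
Proof.
move=> mN; rewrite (_ : nonnull N = \bigcup_k [set t | (lam M chi k (xsection N t) != 0)%E]).
  apply: bigcup_measurable => k _.
  have mf := @measurable_fun_xsection _ _ S X R (lam M chi k) _ mN.
  rewrite -[X in measurable X]setTI.
  exact: (emeasurable_neq measurableT mf).
apply/seteqP; split=> t /=.
  move=> nn; apply: contrapT => /forall2NP h; apply: nn; split; first exact: measurable_xsection.
  move=> k; have [hk|hk] := h k; first by case: hk.
  by apply/eqP/negPn/negP.
by move=> [k _ /eqP h] [_ /(_ k)].
Qed.

Lemma nonnull_ex N t : nonnull N t -> exists x, N (t, x).
Proof.
move=> nn; apply: contrapT => /forallNP h; apply: nn.
rewrite (_ : xsection N t = set0); last first.
  by apply/seteqP; split=> x //; rewrite /xsection /= inE => /h.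
by split => // k; exact: measure0.
Qed.

Lemma null_xsection N t (A : set X) : measurable A -> ~ nonnull N t ->
  (forall x, A x -> N (t, x)) -> null M chi A.
Proof.
move=> mA /contrapT nn AN; apply: null_sub mA _ nn => x /AN.
by rewrite /xsection /= inE.
Qed.

Lemma null_bigcup_int (N : int -> set X) : (forall l, null M chi (N l)) ->
  null M chi [set x | exists l, N l x].
Proof.
move=> h; rewrite (_ : [set x | _] = \bigcup_n (N n%:Z `|` N (- n%:Z))).
  by apply: null_bigcup => n; apply: null_setU.
apply/seteqP; split=> x /=.
  move=> [[n|n] Nx]; first by exists n => //; left.
  by exists n.+1 => //; right; rewrite -NegzE.
by move=> [n _ [Nx|Nx]]; [exists n%:Z|exists (- n%:Z)].
Qed.

End nonnull.

(** * Tightness from stationarity *)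

Section process_laws.
Context {d d'} {Omega : measurableType d} {T : measurableType d'}.
Context {R : realType} (P : probability Omega R) (Yp : int -> {RV P >-> T}).

Lemma block_obs k n w : (block Yp k n w : seq T) = obs (fun t => Yp t w) k n.
Proof.
by rewrite /obs -val_enum_ord -map_comp.
Qed.

Hypothesis stat : strictly_stationary P Yp.

Lemma law_coord l A : measurable A -> P (Yp l @^-1` A) = P (Yp 0 @^-1` A).
Proof.
move=> mA; have mB : measurable ((fun u : paths T => u 0) @^-1` A).
  by rewrite -[X in measurable X]setTI; exact: (measurable_coord 0).
have E j : shifted Yp j @^-1` ((fun u : paths T => u 0) @^-1` A) = Yp j @^-1` A.
  by apply/seteqP; split => w; rewrite /= /shifted add0r.
by have := stationary_paths stat l mB; rewrite !E.
Qed.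

Lemma law_block l n A : measurable A ->
  P (block Yp l n @^-1` A) = P (block Yp 0 n @^-1` A).
Proof.
move=> mA; pose ev (u : paths T) := [tuple u (i : nat)%:Z | i < n].
have mev : measurable_fun setT ev.
  apply/measurable_fun_tnthP => i.
  rewrite (_ : _ \o _ = fun u : paths T => u i%:Z); first exact: measurable_coord.
  by apply/funext => w; rewrite /= tnth_mktuple.
have mB : measurable (ev @^-1` A) by rewrite -[X in measurable X]setTI; exact: mev.
have E j : shifted Yp j @^-1` (ev @^-1` A) = block Yp j n @^-1` A.
  apply/funext => w; rewrite /preimage /=; congr A; rewrite /ev /block.
  by apply: eq_mktuple => i; rewrite /shifted addrC.
by have := stationary_paths stat l mB; rewrite !E.
Qed.

Lemma integrable_coord l (f : T -> R) : measurable_fun setT f ->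
  P.-integrable setT (fun w => (f (Yp 0 w))%:E) ->
  P.-integrable setT (fun w => (f (Yp l w))%:E).
Proof.
move=> mf /integrableP[_ i0]; apply/integrableP; split.
  by apply/measurable_EFinP; apply: (measurableT_comp mf); exact: measurable_funPT.
apply: le_lt_trans i0; rewrite le_eqVlt; apply/orP; left; apply/eqP.
have mF : measurable_fun setT (fun x => `|(f x)%:E|%E).
  by apply: measurableT_comp => //; exact/measurable_EFinP.
have F0 x : (0 <= `|(f x)%:E|)%E by [].
transitivity (\int[distribution P (Yp l)]_x `|(f x)%:E|)%E.
  by rewrite (ge0_integral_distribution (Yp l) mF F0).
transitivity (\int[distribution P (Yp 0)]_x `|(f x)%:E|)%E; last first.
  by rewrite (ge0_integral_distribution (Yp 0) mF F0).
by apply: eq_measure_integral => A mA _; exact: law_coord.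
Qed.

Lemma integrable_tight (f : Omega -> \bar R) (eps : R) :
  (forall w, 0 <= f w)%E -> P.-integrable setT f -> 0 < eps ->
  exists c : R, 0 <= c /\ exists B, [/\ measurable B, (P B <= eps%:E)%E &
    forall w, ~ B w -> (f w <= c%:E)%E].
Proof.
move=> f0 intf eps0; have [mf foo] := integrableP _ _ _ intf.
have If : (\int[P]_w `|f w| \is a fin_num)%E.
  by rewrite ge0_fin_numE//; exact: integral_ge0.
pose I := fine (\int[P]_w `|f w|)%E.
have I0 : 0 <= I by apply: fine_ge0; exact: integral_ge0.
pose c := (I + 1) / eps; have c0 : 0 < c by rewrite divr_gt0// ltr_wpDl.
exists c; split; first exact: ltW.
have mB : measurable (setT `&` [set w | (c%:E <= `|f w|)%E]).
  by apply: emeasurable_fun_c_infty => //; exact: measurableT_comp.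
exists (setT `&` [set w | (c%:E <= `|f w|)%E]); split; first exact: mB.
- have := le_integral_abse P measurableT mf c0.
  move: mB; set B := _ `&` _ => mB; rewrite -(fineK If) -/I => h.
  have PB : P B \is a fin_num by exact: (fin_num_measure P B mB).
  have {}h : (c%:E * (fine (P B))%:E <= I%:E)%E by rewrite (fineK PB).
  rewrite -EFinM lee_fin in h; rewrite -(fineK PB) lee_fin.
  have : c * fine (P B) <= c * eps.
    by apply: (le_trans h); rewrite /c divfK ?gt_eqF// lerDl.
  by rewrite ler_pM2l.
- move=> w nB; rewrite leNgt; apply/negP => h; apply: nB; split => //=.
  by rewrite gee0_abs// ltW.
Qed.

(** The levels inherit integrability from an upper bound of the supremum that
    they replace. *)
Section level_process.
Context {dS} {S : measurableType dS} (Z : Omega -> S) (B : nat -> set S).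
Hypothesis mZ : measurable_fun setT Z.
Hypothesis mB : forall k, measurable (B k).
Variable bd : Omega -> \bar R.
Hypothesis bd0 : forall w, (0 <= bd w)%E.
Hypothesis ibd : P.-integrable setT bd.
Hypothesis Bbd : forall k w, B k (Z w) -> (k%:R%:E <= bd w)%E.

Lemma integrable_rlevel : P.-integrable setT (fun w => (rlevel R B (Z w))%:E).
Proof.
apply: (le_integrable measurableT (g := fun w => (bd w + 1)%E)).
- apply/measurable_EFinP; apply: (measurableT_comp (measurable_rlevel mB)); exact: mZ.
- move=> w _; have h := level_le (R := R) (bd0 w) (fun k => @Bbd k w).
  rewrite !gee0_abs ?adde_ge0// ?lee_fin ?rlevel_ge0//.
  apply: le_trans h; rewrite /rlevel.
  by have := level_ge0 (R := R) B (Z w); case: (level R B (Z w)) => [u||]//; rewrite ?leey.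
- by apply: integrableD => //; exact: finite_measure_integrable_cst.
Qed.

Lemma level_infinite : P [set w | level R B (Z w) = +oo%E] = 0%E.
Proof.
have mS : measurable [set w | level R B (Z w) = +oo%E].
  rewrite (_ : [set w | _] = (level R B \o Z) @^-1` [set +oo%E])//.
  rewrite -[X in measurable X]setTI.
  by apply: (measurableT_comp (measurable_level mB) mZ) => //; exact: emeasurable_set1.
have [N [mN N0 SN]] := integrable_ae measurableT ibd.
apply/eqP; rewrite eq_le measure_ge0 andbT -N0 le_measure ?inE// => w /= Loo.
apply: SN => /(_ Logic.I) bf.
have := level_le (R := R) (bd0 w) (fun k => @Bbd k w).
by rewrite Loo leye_eq -(fineK bf).
Qed.

End level_process.
End process_laws.

(** * Good blocks of observations *)

Section birkhoff.
Context {d d'} {Omega : measurableType d} {T : measurableType d'}.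
Context {R : realType} (P : probability Omega R) (Yp : int -> {RV P >-> T}).
Variable r : nat.
Hypothesis stat : strictly_stationary P Yp.
Hypothesis erg : ergodic_process P (fun n : int => block Yp (n * r%:Z)%R r).

(** Two-sided version, from the upper bound for [f] and [- f]. *)
Lemma block_ergodic (f : r.-tuple T -> R) (delta eps : R) :
  measurable_fun setT f ->
  P.-integrable setT (fun w => (f (block Yp 0 r w))%:E) ->
  0 < delta -> 0 < eps ->
  exists c : R, 0 <= c /\ forall N : int, exists B : set Omega,
    [/\ measurable B, (P B <= eps%:E)%E &
      forall w, ~ B w -> forall n : nat,
        `|\sum_(i < n) f (block Yp (N - (i.+1 * r)%:Z) r w) -
          (\int[P]_w f (block Yp 0 r w)) * n%:R| <= delta * n%:R + c].
Proof.
move=> mf intf delta0 eps0; have e2 : 0 < eps / 2 by rewrite divr_gt0.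
have [c1 [c10 h1]] := block_ergodic_upper stat erg mf intf delta0 e2.
have mg : measurable_fun setT (fun z => - f z) by exact: measurableT_comp.
have intg : P.-integrable setT (fun w => (- f (block Yp 0 r w))%:E).
  exact: (integrableN intf).
have [c2 [c20 h2]] := block_ergodic_upper stat erg mg intg delta0 e2.
exists (c1 + c2); split; first exact: addr_ge0.
move=> N; have [B1 [mB1 PB1 hB1]] := h1 N; have [B2 [mB2 PB2 hB2]] := h2 N.
exists (B1 `|` B2); split; first exact: measurableU.
  apply: (@le_trans _ _ (P B1 + P B2)%E); first exact: measureU2.
  by apply: (le_trans (leeD PB1 PB2)); rewrite -EFinD lee_fin -splitr.
move=> w nB n; have nB1 : ~ B1 w by move=> ?; apply: nB; left.
have nB2 : ~ B2 w by move=> ?; apply: nB; right.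
have := hB1 w nB1 n; have := hB2 w nB2 n.
have -> : (\int[P]_w (- f (block Yp 0 r w)))%R = - \int[P]_w f (block Yp 0 r w).
  by under eq_Rintegral do rewrite -mulN1r; rewrite RintegralZl// mulN1r.
rewrite sumrN => k2 k1; rewrite ler_norml; apply/andP; split; nra.
Qed.
End birkhoff.

Section model_sets.
Context {dX dY dO} {X : measurableType dX} {Y : measurableType dY}
  {Omega : measurableType dO} {R : realType}.
Variables (M : model X Y R) (chi : probability X R) (r : nat).

Lemma measurable_L_tuple (A : set X) : measurable A ->
  measurable_fun [set: r.-tuple Y * X] (fun u => L M u.1 u.2 A).
Proof.
move=> mA; pose ys : seq (r.-tuple Y -> Y) := [seq (fun z => tnth z i) | i <- enum 'I_r].
have E (z : r.-tuple Y) : [seq f z | f <- ys] = z.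
  by rewrite /ys -map_comp -[RHS](map_tnth_enum z).
have mys : all_measurable ys.
  move=> i; rewrite size_map => ilt y0; rewrite (nth_map (Ordinal (leq_ltn_trans (leq0n i) (leq_trans ilt (eq_leq (size_enum_ord r)))))) //.
  exact: measurable_tnth.
have mF : measurable_fun [set: r.-tuple Y * X] (fun u => (\1_A u.2 : R)%:E).
  apply/measurable_EFinP; apply: (measurableT_comp (measurable_indic mA)).
  exact: measurable_snd.
have := measurable_L_param M mys (fun u => _) mF.
under eq_fun do rewrite E integral_indic// setIT.
by apply => u; rewrite lee_fin.
Qed.

Definition g_level (c : R) : set (Y * X) := [set u | expR c < g M (u.2, u.1)].
Definition return_level (D : set X) (c : R) : set (r.-tuple Y * X) :=
  [set u : r.-tuple Y * X | D u.2 /\ (L M u.1 u.2 D < (expR (- c))%:E)%E].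
Definition outside_level (C : set X) (b : R) : set (r.-tuple Y * X) :=
  [set u : r.-tuple Y * X | ~ C u.2 /\ (b%:E < L M u.1 u.2 setT)%E].

Lemma measurable_g_level c : measurable (g_level c).
Proof.
have mg : measurable_fun setT (fun u : Y * X => g M (u.2, u.1)).
  apply: (measurableT_comp (@measurable_g _ _ _ _ _ M)).
  by apply: measurable_fun_pair; [exact: measurable_snd|exact: measurable_fst].
have := mg measurableT _ (measurable_itv `]expR c, +oo[); rewrite setTI.
rewrite (_ : _ @^-1` _ = g_level c)//.
by apply/seteqP; split => u /=; rewrite in_itv/= andbT.
Qed.

Lemma probability_inhabited : exists x : X, True.
Proof.
apply: contrapT => nx; have T0 : [set: X] = set0.
  by apply/seteqP; split=> x // _; apply: nx; exists x.
have : chi setT = 1%E by exact: probability_setT.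
have : chi setT = 0%E by rewrite T0; exact: measure0.
by move=> -> [] /eqP; rewrite eq_sym oner_eq0.
Qed.

Lemma measurable_snd_set {dS} {S : measurableType dS} (A : set X) : measurable A ->
  measurable [set u : S * X | A u.2].
Proof. by move=> mA; rewrite -[X in measurable X]setTI; exact: measurable_snd. Qed.

Lemma measurable_return_level D c : measurable D -> measurable (return_level D c).
Proof.
move=> mD; apply: measurableI; first exact: measurable_snd_set.
have mf := measurable_L_tuple mD.
have := mf measurableT _ (emeasurable_itv `]-oo, (expR (- c))%:E[); rewrite setTI.
rewrite [X in measurable X -> _](_ : _ = [set u : r.-tuple Y * X | (L M u.1 u.2 D < (expR (- c))%:E)%E])//.
Qed.

Lemma measurable_outside_level C b : measurable C -> measurable (outside_level C b).
Proof.
move=> mC; apply: measurableI; first by apply: (@measurable_snd_set _ _ (~` C)); exact: measurableC.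
have mf := measurable_L_tuple measurableT.
have := mf measurableT _ (emeasurable_itv `]b%:E, +oo[); rewrite setTI.
rewrite [X in measurable X -> _](_ : _ = [set u : r.-tuple Y * X | (b%:E < L M u.1 u.2 setT)%E])//.
by apply/seteqP; split => u /=; rewrite in_itv/= andbT.
Qed.

Lemma outside_level_sub C b1 b2 z : b1 <= b2 -> measurable C ->
  nonnull M chi (outside_level C b2) z -> nonnull M chi (outside_level C b1) z.
Proof.
move=> b12 mC n2 n1; apply: n2; apply: null_sub n1.
  by apply: measurable_xsection; exact: measurable_outside_level.
move=> x; rewrite /xsection /= !inE => -[nC h]; split => //.
by apply: le_lt_trans h; rewrite lee_fin.
Qed.

Lemma g_level_le c y : nonnull M chi (g_level c) y ->
  (c%:E <= lnp (supnorm (fun x => (g M (x, y))%:E)))%E.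
Proof.
move=> /nonnull_ex[x gx]; apply: le_lnp; apply: ereal_sup_ge.
exists `|(g M (x, y))%:E|%E; first by exists x.
by rewrite gee0_abs ?lee_fin ?(ltW gx)// ltW// g_gt0.
Qed.

Lemma return_level_le D c (z : r.-tuple Y) : nonnull M chi (return_level D c) z ->
  (c%:E <= lnm (ereal_inf [set L M z x D | x in D]))%E.
Proof.
move=> /nonnull_ex[x [Dx Lx]]; apply: le_lnm.
  by apply: le_ereal_inf_tmp => _ [x' _ <-]; exact: measure_ge0.
by apply: ge_ereal_inf; exists (L M z x D); [exists x|exact: ltW].
Qed.

Variables (P : probability Omega R) (Yp : int -> {RV P >-> Y}).

(** The set [C] is chosen after [th], whereas the ergodic theorem has to be
    applied to a set of good blocks that is fixed beforehand. A bound [b] on the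
    supremum of the mass of the block selects the good blocks: it is not
    measurable, and is replaced by the conditions that it implies for the
    Doeblin sets [C_j] associated with [eta = 1 / (j + 1)]. These conditions
    increase to [K] with [b], so that some [b] keeps the probability above 2/3;
    any [th] is then reached by taking [j] large. *)
Lemma good_observations (K : set (r.-tuple Y)) : measurable K ->
  ((2 / 3)%:E < P [set w | K (block Yp 0 r w)])%E ->
  (forall eta : R, (0 < eta)%R ->
        exists (C : set X) (em ep : r.-tuple Y -> R),
          [/\ local_doeblin_with M C em ep,
              forall z, K z ->
                (ereal_sup [set L M z x setT | x in ~` C]
                  <= eta%:E * supnorm (fun x => L M z x setT) < +oo)%E &
              (0 < ereal_inf [set (em z / ep z)%:E | z in K])%E]) ->
  exists K' : set (r.-tuple Y), [/\ measurable K',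
    ((2 / 3)%:E < P [set w | K' (block Yp 0 r w)])%E &
    forall th : R, exists (C : set X) (e : R), [/\ measurable C, 0 < e <= 1,
      forall z, K' z -> exists (mu : probability X R) (phi : X -> R), (forall x, 0 < phi x) /\
        forall x A, C x -> measurable A ->
          ((e * phi x)%:E * mu A <= L M z x (A `&` C))%E /\
          (L M z x (A `&` C) <= (phi x)%:E * mu A)%E &
      forall z, K' z -> ~ nonnull M chi (outside_level C (expR (- th))) z]].
Proof.
move=> mK PK hK.
have /choice[CC hCC] : forall j : nat, exists t : set X * (r.-tuple Y -> R) * (r.-tuple Y -> R),
    [/\ local_doeblin_with M t.1.1 t.1.2 t.2,
              forall z, K z ->
                (ereal_sup [set L M z x setT | x in ~` t.1.1]
                  <= (j.+1%:R^-1)%:E * supnorm (fun x => L M z x setT) < +oo)%E &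
              (0 < ereal_inf [set (t.1.2 z / t.2 z)%:E | z in K])%E].
  move=> j; have [|C [em [ep h]]] := hK j.+1%:R^-1; first by rewrite invr_gt0.
  by exists (C, em, ep).
have mCC j : measurable (CC j).1.1 by have [[]] := hCC j.
pose bad (b : nat) j := nonnull M chi (outside_level (CC j).1.1 (b%:R / j.+1%:R)).
pose K' (b : nat) := K `&` \bigcap_j ~` bad b j.
have mK' b : measurable (K' b).
  apply: measurableI => //; apply: bigcap_measurable => // j _.
  by apply: measurableC; apply: measurable_nonnull; exact: measurable_outside_level.
pose F b := [set w | K' b (block Yp 0 r w)].
have mbl := @measurable_block _ _ _ _ _ P Yp 0 r.
have mF b : measurable (F b) by rewrite -[X in measurable X]setTI; exact: mbl.
have UF : \bigcup_b F b = [set w | K (block Yp 0 r w)].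
  apply/seteqP; split => w /=; first by move=> [b _ []].
  move=> Kw; set z := block Yp 0 r w in Kw *.
  have s0 : (0 <= supnorm (fun x => L M z x setT))%E.
    have [x _] := probability_inhabited.
    by apply: ereal_sup_ge; exists `|L M z x setT|%E; [exists x|exact: abse_ge0].
  have sf : supnorm (fun x => L M z x setT) \is a fin_num.
    have [_ h _] := hCC 0%N; have /andP[_ h2] := h _ Kw.
    rewrite (ge0_fin_numE s0); rewrite invr1 mul1e in h2; exact: h2.
  pose b := (Num.trunc (fine (supnorm (fun x => L M z x setT)))).+1.
  exists b => //; split => // j _ /nonnull_ex[x [nC]] /=.
  apply/negP; rewrite -leNgt; have [_ /(_ _ Kw)/andP[h _] _] := hCC j.
  apply: (@le_trans _ _ (ereal_sup [set L M z x setT | x in ~` (CC j).1.1])).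
    by apply: ereal_sup_ubound; exists x.
  apply: (le_trans h); rewrite -(fineK sf) -EFinM lee_fin mulrC ler_wpM2r//.
  exact/ltW/truncnS_gt.
have ndF : {homo F : n m / (n <= m)%N >-> (n <= m)%O}.
  move=> n m nm; apply/subsetPset => w [Kw h]; split => // j _ hb; apply: (h j Logic.I).
  by apply: outside_level_sub hb => //; rewrite ler_wpM2r ?invr_ge0// ler_nat.
have mU : measurable (\bigcup_b F b) by exact: bigcup_measurable.
have := nondecreasing_cvg_mu (mu := P) mF mU ndF; rewrite UF => cv.
have [b Pb] : exists b, ((2 / 3)%:E < P (F b))%E.
  apply: contrapT => /forallNP h.
  have : (P [set w | K (block Yp 0 r w)] <= (2 / 3)%:E)%E.
    rewrite -(cvg_lim _ cv)//; apply: lime_le; first by apply/cvg_ex; eexists; exact: cv.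
    by apply: nearW => b; rewrite leNgt; apply/negP; exact: h.
  by rewrite leNgt PK.
exists (K' b); split => // th.
have [j hj] : exists j : nat, b%:R / j.+1%:R <= expR (- th).
  exists (Num.trunc (b%:R / expR (- th))).
  rewrite ler_pdivrMr// mulrC -ler_pdivrMr ?expR_gt0//; exact/ltW/truncnS_gt.
have [[mC em0 ep0 [mu [phi [phi0 hmu]]]] _ inf0] := hCC j.
set C := (CC j).1.1 in mC hmu; set em := (CC j).1.2 in em0 inf0 hmu.
set ep := (CC j).2 in ep0 inf0 hmu.
have [e [/andP[e0 e1] einf]] : exists e : R, 0 < e <= 1 /\
    (e%:E <= ereal_inf [set (em z / ep z)%:E | z in K])%E.
  case: (ereal_inf _) inf0 => [t||//]; last by exists 1; rewrite ltr01 lexx leey.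
  rewrite lte_fin => t0; exists (Num.min 1 t); rewrite lt_min ltr01 t0/= ge_min lexx/=.
  by rewrite lee_fin ge_min lexx orbT.
exists C, e; split => //; first by rewrite e0.
- move=> z [Kz _]; exists (mu z), (fun x => ep z * phi z x); split.
    by move=> x; rewrite mulr_gt0.
  move=> x A Cx mA; have [_ /(_ A x mA Cx)[h1 h2]] := hmu z; split => //.
  apply: le_trans h1; apply: lee_wpmul2r => //; rewrite lee_fin mulrA ler_wpM2r ?(ltW (phi0 _ _))//.
  rewrite -ler_pdivlMr// -lee_fin; apply: (le_trans einf).
  by apply: ereal_inf_lbound; exists z.
- move=> z [_ /(_ j Logic.I) nb] bd; apply: nb.
  exact: outside_level_sub bd.
Qed.
End model_sets.

(** * The levels along the observed process *)

Section observed_levels.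
Context {dX dY dO} {X : measurableType dX} {Y : measurableType dY}
  {Omega : measurableType dO} {R : realType}.
Variables (M : model X Y R) (chi : probability X R) (r : nat) (D : set X).
Variables (P : probability Omega R) (Yp : int -> {RV P >-> Y}).
Hypothesis stat : strictly_stationary P Yp.
Hypothesis mD : measurable D.
Hypothesis iD : P.-integrable setT (fun w =>
  lnm (ereal_inf [set L M (block Yp 0 r w) x D | x in D])).
Hypothesis ig : P.-integrable setT (fun w =>
  lnp (supnorm (fun x => (g M (x, Yp 0 w))%:E))).

Definition Bg k : set Y := nonnull M chi (g_level M k%:R).
Definition Bd k : set (r.-tuple Y) := nonnull M chi (return_level M D k%:R).
Definition glev : Y -> R := rlevel R Bg.
Definition dlev : r.-tuple Y -> R := rlevel R Bd.
(** The sum of the logarithmic bounds on the growth of the mass during the block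
    and on its loss from [D] to [D]. It is the only quantity, besides the
    indicator of good blocks, to which the ergodic theorem is applied. *)
Definition cost (z : r.-tuple Y) : R := \sum_(i < r) glev (tnth z i) + dlev z.

Lemma mBg k : measurable (Bg k).
Proof. by apply: measurable_nonnull; exact: measurable_g_level. Qed.

Lemma mBd k : measurable (Bd k).
Proof. by apply: measurable_nonnull; exact: measurable_return_level. Qed.

Lemma glev_ge0 y : 0 <= glev y. Proof. exact: rlevel_ge0. Qed.
Lemma dlev_ge0 z : 0 <= dlev z. Proof. exact: rlevel_ge0. Qed.
Lemma cost_ge0 z : 0 <= cost z.
Proof. by apply: addr_ge0; [apply: sumr_ge0 => i _; exact: glev_ge0|exact: dlev_ge0]. Qed.

Lemma measurable_cost : measurable_fun setT cost.
Proof.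
apply: measurable_funD; last exact: (measurable_rlevel mBd).
apply: measurable_sum => i; apply: measurableT_comp; last exact: measurable_tnth.
exact: (measurable_rlevel mBg).
Qed.

Lemma integrable_glev : P.-integrable setT (fun w => (glev (Yp 0 w))%:E).
Proof.
apply: (integrable_rlevel (@measurable_funPT _ _ _ _ (Yp 0)) mBg _ ig).
- by move=> w; exact: lnp_ge0.
- by move=> k w; exact: g_level_le.
Qed.

Lemma integrable_cost : P.-integrable setT (fun w => (cost (block Yp 0 r w))%:E).
Proof.
have i1 : P.-integrable setT (fun w => (dlev (block Yp 0 r w))%:E).
  apply: (integrable_rlevel (@measurable_block _ _ _ _ _ P Yp 0 r) mBd _ iD).
  - by move=> w; exact: lnm_ge0.
  - by move=> k w; exact: return_level_le.
have i2 : P.-integrable setT (fun w => \sum_(i < r) (glev (Yp (0 + i%:Z) w))%:E)%E.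
  apply: integrable_sum => // i _.
  exact: (integrable_coord stat _ (measurable_rlevel mBg) integrable_glev).
have := integrableD measurableT i2 i1.
congr (_.-integrable _ _); apply/funext => w.
rewrite /cost EFinD sumEFin; congr (_%:E + _)%E.
by apply: eq_bigr => i _; rewrite tnth_mktuple.
Qed.

(** At time [0] the levels are dominated by integrable variables, and their law
    does not depend on the time. *)
Lemma finite_levels : exists N, [/\ measurable N, P N = 0%E &
  forall w, ~ N w -> (forall l, level R Bg (Yp l w) < +oo)%E /\
    (forall l, level R Bd (block Yp l r w) < +oo)%E].
Proof.
have mg := measurable_level (R := R) mBg; have md := measurable_level (R := R) mBd.
have mgs : measurable (level R Bg @^-1` [set +oo%E]).
  by rewrite -[X in measurable X]setTI; apply: mg => //; exact: emeasurable_set1.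
have mds : measurable (level R Bd @^-1` [set +oo%E]).
  by rewrite -[X in measurable X]setTI; apply: md => //; exact: emeasurable_set1.
pose A l := (Yp l @^-1` (level R Bg @^-1` [set +oo%E])) `|` (block Yp l r @^-1` (level R Bd @^-1` [set +oo%E])).
have mA1 l : measurable (Yp l @^-1` (level R Bg @^-1` [set +oo%E])).
  by rewrite -[X in measurable X]setTI; exact: measurable_funPT.
have mA2 l : measurable (block Yp l r @^-1` (level R Bd @^-1` [set +oo%E])).
  by rewrite -[X in measurable X]setTI; exact: measurable_block.
have mA l : measurable (A l) by exact: measurableU.
have A0 l : P (A l) = 0%E.
  apply/eqP; rewrite eq_le measure_ge0 andbT.
  apply: (@le_trans _ _ (P (Yp l @^-1` (level R Bg @^-1` [set +oo%E])) +
     P (block Yp l r @^-1` (level R Bd @^-1` [set +oo%E])))%E); first exact: measureU2.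
  rewrite (law_coord stat l mgs) (law_block stat l mds).
  have h1 : P (Yp 0 @^-1` (level R Bg @^-1` [set +oo%E])) = 0%E.
    apply: (level_infinite (@measurable_funPT _ _ _ _ (Yp 0)) mBg _ ig).
    - by move=> w; exact: lnp_ge0.
    - by move=> k w; exact: g_level_le.
  have h2 : P (block Yp 0 r @^-1` (level R Bd @^-1` [set +oo%E])) = 0%E.
    apply: (level_infinite (@measurable_block _ _ _ _ _ P Yp 0 r) mBd _ iD).
    - by move=> w; exact: lnm_ge0.
    - by move=> k w; exact: return_level_le.
  by rewrite h1 h2 adde0.
pose N := \bigcup_n (A n%:Z `|` A (- n%:Z)).
exists N; split.
- by apply: bigcup_measurable => n _; exact: measurableU.
- have negA l : P.-negligible (A l) by exists (A l); split.
  have negN : P.-negligible N by apply: negligible_bigcup => n; exact: negligibleU.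
  apply: measure_negligible => //; apply: bigcup_measurable => n _; exact: measurableU.
- move=> w nN; have nA l : ~ A l w.
    move=> Aw; apply: nN; case: l Aw => n Aw; first by exists n => //; left.
    by exists n.+1 => //; right; rewrite -NegzE.
  split=> l; rewrite ltey; apply/negP => /eqP h; apply: (nA l); [by left|by right].
Qed.

Section core.
Variables (K : set (r.-tuple Y)) (C : set X) (th : R) (w : Omega).
Hypothesis mC : measurable C.
Hypothesis hK : forall z, K z -> ~ nonnull M chi (outside_level M C (expR (- th))) z.
Hypothesis wg : (forall l, level R Bg (Yp l w) < +oo)%E.
Hypothesis wd : (forall l, level R Bd (block Yp l r w) < +oo)%E.
Local Notation y := (fun t => Yp t w).

(** At every time, each bound by a level fails on a null set only; the core
    avoids these countably many sets at once. *)
Lemma observed_core : exists X0 : set X, [/\ measurable X0, null M chi (~` X0),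
  forall x, X0 x -> Q M x (~` X0) = 0%E,
  (forall l z, X0 z -> g M (z, y l) <= expR (glev (y l))) &
  (forall l x, X0 x -> D x ->
    ((expR (- dlev (block Yp l r w)))%:E <= L M (obs y l r) x D)%E) /\
  (forall l x, K (block Yp l r w) -> X0 x -> ~ C x ->
    (L M (obs y l r) x setT <= (expR (- th))%:E)%E)].
Proof.
pose N1 l := xsection (g_level M (glev (y l))) (y l).
pose N2 l := xsection (return_level M D (dlev (block Yp l r w))) (block Yp l r w).
pose N3 l := if `[< K (block Yp l r w) >]
  then xsection (outside_level M C (expR (- th))) (block Yp l r w) else set0.
have n1 l : null M chi (N1 l).
  have [n nB nle] := level_fin (wg l); apply: null_xsection nB _.
    by apply: measurable_xsection; exact: measurable_g_level.
  move=> x; rewrite /N1 /xsection /= inE /g_level /=; apply: le_lt_trans.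
  by rewrite ler_expR.
have n2 l : null M chi (N2 l).
  have [n nB nle] := level_fin (wd l); apply: null_xsection nB _.
    by apply: measurable_xsection; exact: measurable_return_level.
  move=> x; rewrite /N2 /xsection /= inE /return_level /= => -[Dx h]; split => //.
  by apply: (lt_le_trans h); rewrite lee_fin ler_expR lerN2.
have n3 l : null M chi (N3 l).
  rewrite /N3; case: asboolP => [/hK/contrapT//|_].
  by split => // k; exact: measure0.
pose N := [set x | exists l, (N1 l `|` (N2 l `|` N3 l)) x].
have nN : null M chi N.
  by apply: null_bigcup_int => l; apply: null_setU => //; exact: null_setU.
have [X0 [mX0 X0N nX0 absX0]] := absorbing_core nN.
exists X0; split => //.
- move=> l z X0z; rewrite leNgt; apply/negP => h; apply: (X0N z X0z); exists l; left.
  by rewrite /N1 /xsection /= inE.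
- split=> l x; rewrite -block_obs.
    move=> X0x Dx; rewrite leNgt; apply/negP => h; apply: (X0N x X0x); exists l; right; left.
    by rewrite /N2 /xsection /= inE.
  move=> Kl X0x nC; rewrite leNgt; apply/negP => h; apply: (X0N x X0x); exists l; right; right.
  by rewrite /N3 asboolT// /xsection /= inE.
Qed.

End core.
End observed_levels.

(** * From the ergodic averages to a bound *)

Section path.
Context {dX dY dO} {X : measurableType dX} {Y : measurableType dY}
  {Omega : measurableType dO} {R : realType}.
Variables (M : model X Y R) (chi : probability X R) (r : nat) (D : set X).
Variables (P : probability Omega R) (Yp : int -> {RV P >-> Y}).
Hypothesis r0 : (0 < r)%N.
Hypothesis mD : measurable D.
Variables (K : set (r.-tuple Y)) (C : set X) (E p delta cB c1 cG c e th0 vth H : R)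
  (n0 q2 : nat).
Hypothesis mC : measurable C.
Hypothesis hKd : forall z, K z -> exists (mu : probability X R) (phi : X -> R), (forall x, 0 < phi x) /\
        forall x A, C x -> measurable A ->
          ((e * phi x)%:E * mu A <= L M z x (A `&` C))%E /\
          (L M z x (A `&` C) <= (phi x)%:E * mu A)%E.
Hypothesis hK : forall z, K z ->
  ~ nonnull M chi (outside_level M C (expR (- (th0 *+ 2)))) z.
Hypothesis p23 : 2 / 3 <= p.
Hypothesis e01 : 0 < e <= 1.
Hypothesis E0 : 0 <= E.
Hypothesis delta0 : 0 <= delta.
Hypothesis cB0 : 0 <= cB.
Hypothesis c10 : 0 <= c1.
Hypothesis cG0 : 0 <= cG.
Hypothesis cE : c = 2 * cB + c1 + cG.
Hypothesis q2_gt0 : (0 < q2)%N.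
Hypothesis n0_ge10 : (10 <= n0)%N.
Hypothesis hn0c : 100 * c <= n0%:R.
Hypothesis hn0e : expR (- n0%:R) <= e ^+ 2 / 2.
Hypothesis hdelta : 100 * (2 * delta) * (q2%:R + 1) <= 1.
Hypothesis hth0 : 70 * E + 110 <= th0.
Hypothesis vth01 : 0 < vth <= 1.
Hypothesis hvth : 1 - e ^+ 2 <= expR (- vth).
Hypothesis hq2 : 16 * (2 * E + 4) <= vth * q2%:R.
Variables (n : nat) (w : Omega) (h : X -> R).
Hypothesis bh : bm h.
Hypothesis H0 : 0 <= H.
Hypothesis hH : forall x, `|h x| <= H.
Hypothesis wg : forall l, (level R (Bg M chi) (Yp l w) < +oo)%E.
Hypothesis wd : forall l, (level R (Bd M chi D) (block Yp l r w) < +oo)%E.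
Local Notation cost := (cost M chi D).
Hypothesis hB1 : forall s, (s < r)%N -> forall m : nat,
  `|\sum_(i < m) cost (block Yp ((n - s)%N%:Z - (i.+1 * r)%:Z) r w) - E * m%:R|
    <= delta * m%:R + cB.
Hypothesis hB2 : forall s, (s < r)%N -> forall m : nat,
  `|\sum_(i < m) (\1_K (block Yp ((n - s)%N%:Z - (i.+1 * r)%:Z) r w) : R) - p * m%:R|
    <= delta * m%:R + cB.
Hypothesis hB3 : forall s, (s < r)%N -> cost (block Yp (n - s)%N%:Z r w) <= c1.
Hypothesis hB4 : cost (block Yp 0 r w) <= c1.
Hypothesis hG : forall l, (l < r)%N -> (lnm (muL M chi (block Yp 0 l w) D) <= cG%:E)%E.

Lemma window_split (F : nat -> R) (i t : nat) :
  \sum_(l < t) F (i + l)%N = \sum_(l < i + t) F l - \sum_(l < i) F l.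
Proof. by rewrite big_split_ord /= addrAC subrr add0r. Qed.

(** The hypotheses of [asymptotic_variance_bound] are read off the deviations of
    the averages at the anchors [n - s]. Sums over a window are differences of
    two sums from the anchor, which doubles the constants. A cost at a single
    block controls the last incomplete block, both from above and, by comparing
    it with the complete block that starts at the same time, from below. *)
Lemma path_bound :
  (`|asymptotic_variance M chi (block Yp 0 n w) h| <=
    (var_const E c vth H n0 * (expR (vth / 16) / (1 - expR (- (vth / 16 / r%:R)))))%:E)%E.
Proof.
pose y t := Yp t w; pose ag t := glev M chi (y t); pose dT t := dlev M chi D (block Yp t r w).
pose kT t := `[< K (block Yp t r w) >].
have ag0 l : 0 <= ag l by exact: glev_ge0.
have dT0 l : 0 <= dT l by exact: dlev_ge0.
have [X0 [mX0 nX0 absX0 hg [hd hout]]] := observed_core mD hK wg wd.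
have costE t : asg ag t r + dT t = cost (block Yp t r w).
  by rewrite asgE; congr (_ + _); apply: eq_bigr => i _; rewrite tnth_mktuple.
have asg_ge0 t k : 0 <= asg ag t k by rewrite asgE sumr_ge0.
have asg_le t k : (k <= r)%N -> asg ag t k <= cost (block Yp t r w).
  move=> kr; rewrite -costE -(subnKC kr) asg_cat.
  by rewrite -addrA lerDl addr_ge0.
have pE l : muL M chi (block Yp 0 l w) D = muL M chi (obs y 0 l) D by rewrite block_obs.
have plow l : (l < r)%N -> ((expR (- cG))%:E <= muL M chi (obs y 0 l) D)%E.
  move=> lr; have hl := hG lr; rewrite pE in hl.
  have loo : (lnm (muL M chi (obs y 0 l) D) < +oo)%E by rewrite (le_lt_trans hl)// ltry.
  apply: le_trans (lnm_fin (measure_ge0 _ _) loo).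
  rewrite lee_fin ler_expR lerN2 -lee_fin fineK//.
  by rewrite ge0_fin_numE// lnm_ge0.
have mDX : measurable (D `&` X0) by exact: measurableI.
have PrD l : (obs_int M chi y ag l (\1_(D `&` X0)))%:E = muL M chi (obs y 0 l) D.
  have b1 : bm (\1_(D `&` X0) : X -> R) by exact: bm_indic.
  rewrite (Pr_EFin mX0 nX0 absX0 hg l b1) integral_indic// setIT.
  apply/eqP; rewrite eq_le; apply/andP; split.
    by rewrite le_measure ?inE// => x [].
  apply: (@le_trans _ _ (muL M chi (obs y 0 l) ((D `&` X0) `|` ~` X0))).
    rewrite le_measure ?inE//; first by apply: measurableU => //; exact: measurableC.
    by move=> x Dx; have [X0x|nX] := pselect (X0 x); [left|right].
  have nX : muL M chi (obs y 0 l) (~` X0) = 0%E by exact: (muL_core mX0 nX0 absX0).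
  apply: (@le_trans _ _ (muL M chi (obs y 0 l) (D `&` X0) + muL M chi (obs y 0 l) (~` X0))%E).
    by apply: measureU2 => //; exact: measurableC.
  by rewrite nX adde0.
have [x0 [Dx0 X0x0]] : exists x, (D `&` X0) x.
  apply: contrapT => /forallNP nDX.
  have DX0 : D `&` X0 = set0 by apply/seteqP; split=> x // /nDX.
  have := plow 0%N r0; rewrite -PrD DX0 indic0 /obs_int Rintegral_cst//.
  by rewrite mul0r leNgt lte_fin expR_gt0.
rewrite (block_obs Yp 0 n w) -/y.
have hdoeb t : kT t -> exists (mu : probability X R) (phi : X -> R), (forall x, 0 < phi x) /\
    forall x A, C x -> measurable A ->
      ((e * phi x)%:E * mu A <= L M (obs y t r) x (A `&` C))%E /\
      (L M (obs y t r) x (A `&` C) <= (phi x)%:E * mu A)%E.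
  by move=> /asboolP /hKd; rewrite block_obs.
have hout' t x : kT t -> X0 x -> ~ C x ->
    (L M (obs y t r) x setT <= (expR (- (th0 *+ 2)))%:E)%E.
  by move=> /asboolP kt; exact: hout.
have cE' := cE; have c10' := c10; have cG0' := cG0; have cB0' := cB0.
have c0 : 0 <= c by lra.
have d0 : 0 <= 2 * delta by rewrite mulr_ge0.
have hSS s : (s < r)%N -> (s <= n)%N -> forall i t,
   asum (fun i => asg ag (bt r (n - s)%N%:Z i) r) i t + asum (fun i => dT (bt r (n - s)%N%:Z i)) i t
    <= E * t%:R + 2 * delta * (i + t)%:R + c.
  move=> sr sn i t; rewrite /asum -big_split /=.
  rewrite (eq_bigr (fun l : 'I_t => cost (block Yp ((n - s)%N%:Z - ((i + l).+1 * r)%:Z) r w))); last first.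
    by move=> l _; rewrite costE.
  rewrite (window_split (fun l => cost (block Yp ((n - s)%N%:Z - (l.+1 * r)%:Z) r w))).
  have := hB1 sr i; have := hB1 sr (i + t)%N; rewrite !natrD !ler_norml.
  set S1 := \sum_(_ < _) _; set S2 := \sum_(_ < _) _ => /andP[_ h1] /andP[h2 _].
  have t0 : 0 <= (t%:R : R) by exact: ler0n.
  have dt : 0 <= delta * t%:R by rewrite mulr_ge0.
  lra.
have hkk s : (s < r)%N -> (s <= n)%N -> forall i t,
  5 / 8 * t%:R - 2 * delta * (i + t)%:R - c <= ksum (fun i => kT (bt r (n - s)%N%:Z i)) i t.
  move=> sr sn i t; rewrite /ksum /asum.
  rewrite (eq_bigr (fun l : 'I_t => (\1_K (block Yp ((n - s)%N%:Z - ((i + l).+1 * r)%:Z) r w) : R))); last first.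
    by move=> l _; rewrite indicE; congr (_%:R); congr nat_of_bool; apply/asboolP/idP; rewrite inE.
  rewrite (window_split (fun l => (\1_K (block Yp ((n - s)%N%:Z - (l.+1 * r)%:Z) r w) : R))).
  have := hB2 sr i; have := hB2 sr (i + t)%N; rewrite !natrD !ler_norml.
  set S1 := \sum_(_ < _) _; set S2 := \sum_(_ < _) _ => /andP[h1 _] /andP[_ h2].
  have t0 : 0 <= (t%:R : R) by exact: ler0n.
  have dt : 0 <= delta * t%:R by rewrite mulr_ge0.
  have pt : 2 / 3 * t%:R <= p * t%:R by rewrite ler_wpM2r.
  lra.
have thi s : (s < r)%N -> (s <= n)%N -> asg ag (n - s)%N%:Z s <= c.
  move=> sr sn; apply: (le_trans (asg_le _ _ (ltnW sr))); apply: (le_trans (hB3 sr)).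
  by lra.
have tlo s : (s < r)%N -> (s <= n)%N -> forall x, X0 x -> D x ->
  ((expR (- c))%:E <= L M (obs y (n - s)%N%:Z s) x setT)%E.
  move=> sr sn x X0x Dx; set N := (n - s)%N%:Z.
  have A0 : asg ag N r = asg ag N s + asg ag (N + s%:Z) (r - s).
    by rewrite -asg_cat subnKC// ltnW.
  have h1 : (L M (obs y N r) x D <= L M (obs y N s) x setT * (expR (asg ag (N + s%:Z) (r - s)))%:E)%E.
    pose Q' := obs_op M y X0 ag (N + s%:Z) (r - s) (fun=> 1).
    have bQ : bm Q' by exact: bm_Lr.
    have Qle z : Q' z <= expR (asg ag (N + s%:Z) (r - s)).
      have [X0z|nX] := pselect (X0 z); last by rewrite /Q' Lr_out// expR_ge0.
      by rewrite -lee_fin -(L_Lr mX0 absX0 hg _ _ X0z); exact: (L_obs_mass mX0 absX0 hg).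
    apply: (@le_trans _ _ (L M (obs y N r) x setT)); first by rewrite le_measure ?inE.
    rewrite (L_Lr mX0 absX0 hg N r X0x) (L_Lr mX0 absX0 hg N s X0x) -EFinM lee_fin.
    rewrite -{1}(subnKC (ltnW sr)) (Lr_comp mX0 absX0 hg _ _ _ (bm_cst 1)) -/Q' mulrC /obs_op.
    rewrite -bm_RintZ//; apply: bm_Rint_le => //.
    by move=> z; rewrite mulr1.
  have Lf : L M (obs y N s) x setT \is a fin_num.
    rewrite ge0_fin_numE ?measure_ge0//.
    by apply: (le_lt_trans (L_obs_mass mX0 absX0 hg N s X0x)); rewrite ltry.
  have := le_trans (hd N x X0x Dx) h1; rewrite -(fineK Lf) -EFinM !lee_fin => h2.
  have : expR (- dlev M chi D (block Yp N r w)) * expR (- asg ag (N + s%:Z) (r - s)) <=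
      fine (L M (obs y N s) x setT).
    by rewrite [X in _ * X]expRN ler_pdivrMr ?expR_gt0.
  apply: le_trans; rewrite -expRD ler_expR.
  have := hB3 sr; rewrite -costE -/N A0.
  have := asg_ge0 N s.
  rewrite /dT; lra.
have ini l : (l < r)%N -> obs_int M chi y ag l (fun=> 1) <= expR c * obs_int M chi y ag l (\1_(D `&` X0)) /\
    0 < obs_int M chi y ag l (\1_(D `&` X0)).
  move=> lr; have := plow l lr; rewrite -PrD lee_fin => h1; split; last first.
    by apply: lt_le_trans h1; exact: expR_gt0.
  apply: (@le_trans _ _ (expR (asg ag 0 l))).
    by rewrite -lee_fin -(Pr_mass mX0 nX0 absX0 hg); exact: (muL_obs_mass mX0 nX0 absX0 hg).
  apply: (@le_trans _ _ (expR c * expR (- cG))); last by rewrite ler_wpM2l ?expR_ge0.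
  rewrite -expRD ler_expR; have := asg_le 0 l (ltnW lr); have := hB4.
  by lra.
exact: (asymptotic_variance_bound mX0 nX0 absX0 ag0 hg r0 mC mD dT0 hd hdoeb hout'
  e01 E0 d0 c0 q2_gt0 n0_ge10 hn0c hn0e hdelta hth0 vth01 hvth hq2 Dx0 X0x0
  bh H0 hH hSS hkk thi tlo ini).
Qed.
End path.

(** * Tightness *)

Lemma large_nat {R : realType} (x : R) : exists n : nat, x <= n%:R.
Proof. by exists (Num.trunc x).+1; exact/ltW/truncnS_gt. Qed.

Lemma measurable_variance_event {dX dY dO} {X : measurableType dX} {Y : measurableType dY}
  {Omega : measurableType dO} {R : realType} (M : model X Y R) (chi : probability X R)
  (P : probability Omega R) (Yp : int -> {RV P >-> Y}) (h : X -> R) (a : R) n :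
  measurable_fun [set: X] h ->
  measurable [set w | (a%:E < `|asymptotic_variance M chi (block Yp 0 n w) h|)%E].
Proof.
move=> mh; pose ys : seq (Omega -> Y) := [seq (fun w => Yp (0 + i%:Z) w) | i <- iota 0 n].
have mys : all_measurable ys.
  move=> i; rewrite size_map size_iota => ilt y0.
  by rewrite (nth_map 0%N) ?size_iota//; exact: measurable_funPT.
have mA : measurable_fun setT (fun w => `|asymptotic_variance M chi [seq f w | f <- ys] h|%E).
  by apply: measurableT_comp => //; exact: measurable_asymptotic_variance.
have -> : [set w | (a%:E < `|asymptotic_variance M chi (block Yp 0 n w) h|)%E] =
    (fun w => `|asymptotic_variance M chi [seq f w | f <- ys] h|%E) @^-1` [set` `]a%:E, +oo[ ].
  apply/seteqP; split => w /=; rewrite in_itv/= andbT block_obs /ys -map_comp //.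
by rewrite -[X in measurable X]setTI; apply: mA => //; exact: emeasurable_itv.
Qed.

Theorem theorem10 (R : realType) (dX dY dO : measure_display)
    (X : measurableType dX) (Y : measurableType dY) (Omega : measurableType dO)
    (hX : countably_generated X)
    (M : model X Y R) (P : probability Omega R) (Yp : int -> {RV P >-> Y})
    (r : nat) (D : set X)
    (hA1 : A1 M Yp r D) (hA2 : A2 M Yp)
    (chi : probability X R) (hchi : initial_class M Yp D r chi)
    (h : X -> R) (mh : measurable_fun [set: X] h) (bh : bounded_fun h) :
  forall eps : R, 0 < eps -> exists2 a : R, 0 < a &
    forall n : nat, (0 < n)%N ->
      (P [set w | (a%:E < `|asymptotic_variance M chi (block Yp 0 n w) h|)%E]
        <= eps%:E)%E.
Proof.
move=> eps eps0.
have [stat erg r0 [K0 [mK0 [ergZ PK0] hK0 [mD iD]]]] := hA1.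
have [_ ig] := hA2.
have [H [H0 hH]] : exists H, 0 <= H /\ forall x, `|h x| <= H.
  have [H [_ hH]] := bh; exists (Num.max 0 H + 1).
  split; first by rewrite addr_ge0// le_max lexx.
  by move=> x; apply: hH => //; rewrite ltr_pwDr// le_max lexx orbT.
have bmh : bm h by split => //; exists H.
have [K [mK PK hKth]] := good_observations chi mK0 PK0 hK0.
have icost := integrable_cost chi stat mD iD ig.
pose E := \int[P]_w cost M chi D (block Yp 0 r w).
have E0 : 0 <= E by apply: Rint_ge0 => w; exact: cost_ge0.
have mbl := @measurable_block _ _ _ _ _ P Yp 0 r.
have mKb : measurable (block Yp 0 r @^-1` K) by rewrite -[X in measurable X]setTI; exact: mbl.
have iK : P.-integrable setT (fun w => (\1_K (block Yp 0 r w) : R)%:E).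
  exact: (bm_integrable P (bm_indic mKb)).
pose p : R := \int[P]_w (\1_K (block Yp 0 r w)).
have p23 : 2 / 3 <= p.
  have PKf : P (block Yp 0 r @^-1` K) \is a fin_num by exact: fin_num_measure.
  have -> : p = fine (P (block Yp 0 r @^-1` K)).
    rewrite /p /Rintegral; congr fine.
    transitivity (\int[P]_w (\1_(block Yp 0 r @^-1` K) w : R)%:E)%E; first by [].
    by rewrite integral_indic// setIT.
  by rewrite -lee_fin fineK//; exact: ltW.
(* The constants are chosen in the order [E], [th0], [C], [e], [vth], [q2],
   [delta], [c], [n0]: each one may depend on the previous ones only. *)
pose th0 := 70 * E + 110.
have [C [e [mC e01 hKd hKo]]] := hKth (th0 *+ 2).
have /andP[e0 e1] := e01; pose vth := e ^+ 2.
have vth0 : 0 < vth by rewrite exprn_gt0.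
have vth01 : 0 < vth <= 1 by rewrite vth0 exprn_ile1// ltW.
have hvth : 1 - e ^+ 2 <= expR (- vth) by exact: expR_ge1Dx.
have [q hq] := large_nat (16 * (2 * E + 4) / vth).
pose q2 := q.+1.
have hq2 : 16 * (2 * E + 4) <= vth * q2%:R.
  rewrite [leRHS]mulrC -ler_pdivrMr//; apply: (le_trans hq); by rewrite ler_nat.
pose delta : R := (200 * (q2%:R + 1))^-1.
have q20 : 0 < q2%:R + 1 :> R by rewrite ltr_wpDl.
have delta0 : 0 < delta by rewrite invr_gt0 mulr_gt0.
have hdelta : 100 * (2 * delta) * (q2%:R + 1) <= 1.
  by rewrite le_eqVlt; apply/orP; left; apply/eqP; rewrite /delta; field; rewrite gt_eqF.
(* The exceptional event is a union of [3 r + 2] events of probability at most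
   [eps'], and of a null event. *)
pose eps' := eps / (3 * r%:R + 2).
have den0 : 0 < 3 * r%:R + 2 :> R by rewrite ltr_wpDl// mulr_ge0.
have eps'0 : 0 < eps' by rewrite divr_gt0.
have mcost : measurable_fun [set: r.-tuple Y] (cost M chi D) by exact: measurable_cost.
have [b1 [b10 /choice[B1 hB1]]] := block_ergodic stat ergZ mcost icost delta0 eps'0.
have [b2 [b20 /choice[B2 hB2]]] := block_ergodic stat ergZ (measurable_indic mK) iK delta0 eps'0.
pose cB := b1 + b2; pose c1 := E + delta + b1.
pose G w := (\sum_(l < r) lnm (muL M chi (block Yp 0 l w) D))%E.
have iG : P.-integrable setT G.
  by apply: integrable_sum => // l _; apply: hchi; exact/ltnW/ltn_ord.
have G0 w : (0 <= G w)%E by apply: sume_ge0 => l _; exact: lnm_ge0.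
have [cG [cG0 [BG [mBG PBG hBG]]]] := integrable_tight G0 iG eps'0.
have [NN [mNN PNN hNN]] := finite_levels chi stat mD iD ig.
pose c := 2 * cB + c1 + cG.
have cB0 : 0 <= cB by rewrite addr_ge0.
have c10 : 0 <= c1 by rewrite !addr_ge0// ltW.
have [n1 hn1] := large_nat (100 * c).
have [n2 hn2] := large_nat (2 / e ^+ 2).
pose n0 := (10 + n1 + n2)%N.
have n0_ge10 : (10 <= n0)%N by rewrite /n0 -addnA leq_addr.
have hn0c : 100 * c <= n0%:R.
  by apply: (le_trans hn1); rewrite ler_nat /n0 addnAC leq_addl.
have hn0e : expR (- n0%:R) <= e ^+ 2 / 2.
  rewrite expRN -[leRHS]invrK lef_pV2 ?posrE ?invr_gt0 ?divr_gt0 ?expR_gt0//.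
  rewrite invf_div; apply: (le_trans hn2).
  apply: (@le_trans _ _ (1 + n0%:R)); last exact: expR_ge1Dx.
  by rewrite ler_wpDl// ler_nat /n0 leq_addl.
pose V := var_const E c vth H n0 * (expR (vth / 16) / (1 - expR (- (vth / 16 / r%:R)))).
exists (`|V| + 1); first by rewrite ltr_wpDl.
move=> n n_gt0.
pose N (s : nat) : int := (n - s)%N%:Z.
(* The anchors [n - s] serve the averages, the anchors [n - s + r] and [r] serve
   the cost of the block that starts at [n - s] or at [0], and [BG] the mass of
   [D] under the first predictors. *)
pose bad := NN `|` BG `|` B1 r%:Z `|`
  \big[setU/set0]_(s < r) (B1 (N s) `|` B2 (N s) `|` B1 (N s + r%:Z)).
have mB1 l : measurable (B1 l) by have [] := hB1 l.
have mB2 l : measurable (B2 l) by have [] := hB2 l.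
have mbig (s : 'I_r) : measurable (B1 (N s) `|` B2 (N s) `|` B1 (N s + r%:Z)).
  by do 2?apply: measurableU.
have mU : measurable (\big[setU/set0]_(s < r) (B1 (N s) `|` B2 (N s) `|` B1 (N s + r%:Z))).
  exact: bigsetU_measurable.
have mbad : measurable bad by do 3?apply: measurableU.
apply: (@le_trans _ _ (P bad)).
  rewrite le_measure ?inE//; first exact: measurable_variance_event.
  move=> w /=; apply: contraPP => nbad; apply/negP; rewrite -leNgt.
  apply: (@le_trans _ _ V%:E); last by rewrite lee_fin (le_trans (ler_norm _))// lerDl.
  have nNN : ~ NN w by move=> ?; apply: nbad; do 3?left.
  have nBG : ~ BG w by move=> ?; apply: nbad; left; left; right.
  have nB1r : ~ B1 r%:Z w by move=> ?; apply: nbad; left; right.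
  have nS s : (s < r)%N -> ~ (B1 (N s) `|` B2 (N s) `|` B1 (N s + r%:Z)) w.
    move=> sr hw; apply: nbad; right.
    rewrite -(bigcup_mkord r (fun s => B1 (N s) `|` B2 (N s) `|` B1 (N s + r%:Z))).
    by exists s.
  have [wg wd] := hNN w nNN.
  (* The average over a single block bounds its cost. *)
  have cost1 l : ~ B1 (l + r%:Z) w -> cost M chi D (block Yp l r w) <= c1.
    move=> nB; have [_ _ /(_ w nB 1%N)] := hB1 (l + r%:Z).
    rewrite big_ord1 mul1n addrK !mulr1 ler_norml => /andP[_].
    by rewrite /c1 -/E => hh; lra.
  apply: (path_bound r0 mD mC hKd hKo p23 e01 E0 (ltW delta0) cB0 c10 cG0 erefl
    (ltn0Sn q) n0_ge10 hn0c hn0e hdelta (lexx _) vth01 hvth hq2 bmh H0 hH wg wd).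
  - move=> s sr m; have nB : ~ B1 (N s) w by move=> ?; apply: (nS s sr); left; left.
    have [_ _ /(_ w nB m)] := hB1 (N s); move=> hh; apply: (le_trans hh).
    by rewrite lerD2l /cB lerDl.
  - move=> s sr m; have nB : ~ B2 (N s) w by move=> ?; apply: (nS s sr); left; right.
    have [_ _ /(_ w nB m)] := hB2 (N s); move=> hh; apply: (le_trans hh).
    by rewrite lerD2l /cB lerDr.
  - move=> s sr; apply: cost1 => ?; apply: (nS s sr); by right.
  - by apply: cost1; rewrite add0r.
  - move=> l lr; apply: le_trans (hBG w nBG).
    rewrite /G (bigD1 (Ordinal lr))//= leeDl//.
    by apply: sume_ge0 => i _; exact: lnm_ge0.
have PB1 l : (P (B1 l) <= eps'%:E)%E by have [] := hB1 l.
have PB2 l : (P (B2 l) <= eps'%:E)%E by have [] := hB2 l.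
have U3 (A1 A2 A3 : set Omega) a1 a2 a3 : measurable A1 -> measurable A2 -> measurable A3 ->
    (P A1 <= a1%:E -> P A2 <= a2%:E -> P A3 <= a3%:E -> P (A1 `|` A2 `|` A3) <= (a1 + a2 + a3)%:E)%E.
  move=> m1 m2 m3 h1 h2 h3; rewrite 2!EFinD.
  apply: (le_trans (measureU2 _ (measurableU _ _ m1 m2) m3)); apply: leeD => //.
  by apply: (le_trans (measureU2 _ m1 m2)); exact: leeD.
have Pbig : (P (\big[setU/set0]_(s < r) (B1 (N s) `|` B2 (N s) `|` B1 (N s + r%:Z)%R)) <=
    (r%:R * (3 * eps'))%:E)%E.
  have mN s : (s < r)%N -> measurable (B1 (N s) `|` B2 (N s) `|` B1 (N s + r%:Z)).
    by move=> sr; exact: (mbig (Ordinal sr)).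
  apply: (le_trans (Boole_inequality P mN)).
  apply: (@le_trans _ _ (\sum_(s < r) (3 * eps')%:E)%E).
    apply: lee_sum => s _; have -> : 3 * eps' = eps' + eps' + eps' by ring.
    exact: U3.
  by rewrite sumEFin lee_fin sumr_const card_ord -[leLHS]mulr_natl.
have PNN' : (P NN <= 0%:E)%E by rewrite PNN.
apply: (le_trans (measureU2 _ _ _)) => //; first by do 2?apply: measurableU.
apply: (@le_trans _ _ ((0 + eps' + eps')%:E + (r%:R * (3 * eps'))%:E)%E).
  by apply: leeD => //; exact: U3.
rewrite -EFinD lee_fin.
have -> : 0 + eps' + eps' + r%:R * (3 * eps') = (3 * r%:R + 2) * eps' by ring.
by rewrite /eps' mulrC divfK// gt_eqF.
Qed.
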